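(* Assume the following. (i) $\Theta\subset\mathbb{R}^s$ is convex and compact with nonempty interior. (ii) There are constants $c_1\ge c_2>0$ such that the prior density satisfies $c_1\ge p(\theta)\ge c_2$ for all $\theta\in\Theta$. (iii) For every $(\xi,\eta)\in\Xi\times\mathcal{H}$, $f(\xi|\eta,\theta)>0$ for all $\theta\in\Theta$. (iv) For every $(\xi,\eta)\in\Xi\times\mathcal{H}$, $\theta\mapsto f(\xi|\eta,\theta)$ is continuous on $\Theta$. (v) The Markov chain $\{\eta_t\}_{t\ge1}$ is irreducible and aperiodic. (vi) $\log f(\xi|\eta,\theta)$, $\theta\in\Theta$, is dominated by an integrable function with respect to $P^*$. (vii) The model is correctly specified and identifiable at a parameter $\theta^*\in\mathrm{int}(\Theta)$: $q(\cdot|\eta)=f(\cdot|\eta,\theta^* )$ for all $\eta\in\mathcal{H}$, and whenever $\theta'\in\Theta$ satisfies $f(\cdot|\eta,\theta^* )=f(\cdot|\eta,\theta')$ for all $\eta\in\mathcal{H}$, then $\theta'=\theta^*$. (viii) There exists $\epsilon>0$ such that the open ball $B_\epsilon(\theta^* )\subseteq\Theta$, for all $(\xi,\eta)\in\Xi\times\mathcal{H}$ the function $f(\xi|\eta,\cdot)$ is continuously differentiable on $B_\epsilon(\theta^* )$, and for all $\eta\in\mathcal{H}$ the functions $\|s(\cdot|\eta,\theta)\|_2^2f(\cdot|\eta,\theta)$, $\theta\in\overline{B}_{\epsilon/2}(\theta^* )$, are dominated by a Lebesgue-integrable function on $\Xi$, where $s(\xi|\eta,\theta)=\nabla_\theta\log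 f(\xi|\eta,\theta)$. (ix) The optimal policy $\pi^*$ of the original problem is unique, i.e. for every $(x,\eta)\in\mathcal{X}\times\mathcal{H}$ the infimum in the Bellman equation for $V^*$ is attained at the unique point $\pi^*(x,\eta)\in\mathcal{U}$. (x) The matrix $I(\theta^* )$ is nonsingular, $N^{1/2}(\hat\theta_N-\theta^* )$ converges in distribution under $\mathbb{P}^*$ to $\mathcal{N}(0,I(\theta^* )^{-1})$, and $$\lim_{N\to\infty}\int_{\mathbb{R}^s}(1+\|\tau\|_2^2)\,|\mathsf{p}_N^*(\tau)-\phi_I(\tau)|\,\mathrm{d}\tau=0\quad\mathbb{P}^*\text{-almost surely},$$ where $\phi_I$ is the density of $\mathcal{N}(0,I(\theta^* )^{-1})$. Let $(x_1,\eta_1)\in\mathcal{X}\times\mathcal{H}$ be fixed and suppose moreover that $$N^{1/2}\big(V_N^*(x_1,\eta_1)-\mathbb{E}_{\theta\sim\mathsf{p}_N}[V_\theta^{\pi^*}(x_1,\eta_1)]\big)\to0\quad\text{in }\mathbb{P}^*\text{-probability}.$$ Then, under $\mathbb{P}^*$, $N^{1/2}\big(V_N^*(x_1,\eta_1)-V^*(x_1,\eta_1)\big)$ converges in distribution as $N\to\infty$ to $$\mathcal{N}\Big(0,\ \mathbb{E}_{\mathbb{P}_{\theta^*}}[H_{\theta^*}(x_1,\eta_1)]^\top I(\theta^* )^{-1}\,\mathbb{E}_{\mathbb{P}_{\theta^*}}[H_{\theta^*}(x_1,\eta_1)]\Big),$$ where $$H_{\theta^*}(x_1,\eta_1)=\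sum_{t=1}^\infty\gamma^{t-1}c(x_t,\pi^*(x_t,\eta_t),\xi_t)\,S_{\theta^*,t}.$$
   Context: Data and learning. $\mathcal{H}$ is a finite set and $\{\eta_t\}_{t\ge1}$ is a time-homogeneous Markov chain on $\mathcal{H}$ with transition probabilities $\varpi_{h,h'}=\mathbb{P}(\eta_{t+1}=h'|\eta_t=h)$ and deterministic $\eta_1$. $\Xi\subset\mathbb{R}^d$ is closed. Conditional on $\eta_t$, the random vector $\xi_t\in\Xi$ has density $q(\cdot|\eta_t)$ and is conditionally independent of the past; also $\eta_{t+1}$ conditional on $\eta_t$ is independent of $(\xi_1,\dots,\xi_t)$; and $\xi_i$ is conditionally independent of $\xi_1,\dots,\xi_{i-1}$ given $\{\eta_i\}_{i=1}^N$. $\mathbb{P}^*$ denotes the law of this true data-generating process $\{(\xi_t,\eta_t)\}_{t\ge1}$. $\{f(\cdot|\eta,\theta):\theta\in\Theta\}$, $\eta\in\mathcal{H}$, is a parametric family of probability densities on $\Xi$, with $\Theta\subset\mathbb{R}^s$; $\mathbb{P}_\theta$ denotes the law of $\{(\xi_t,\eta_t)\}_{t\ge1}$ when $q$ is replaced by $f(\cdot|\cdot,\theta)$. $p$ is a prior density on $\Theta$. The posterior density given $(\xi_i,\eta_i)$, $i=1,\dots,N$, is $$\mathsf{p}_N(\theta)=\frac{\mathsf{f}_N(\theta)p(\theta)}{\int_\Theta \mathsf{f}_N(\vartheta)p(\vartheta)\,\mathrm{d}\vartheta},\qquad \mathsf{f}_N(\theta)=f(\xi_1|\eta_1,\theta)\prod_{i=2}^N\big[f(\xi_i|\eta_i,\theta)\varpi_{\eta_{i-1},\eta_i}\big].$$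 $\nu_\eta$ denotes the stationary distribution of the chain $\{\eta_t\}$, and $P^*$ is the stationary one-period law $\mathrm{d}P^*(\xi,\eta)=\nu_\eta(\eta)q(\xi|\eta)\,\mathrm{d}\xi$. $\hat\theta_N$ is a maximizer over $\Theta$ of $\lambda_N(\theta)=\frac1N\sum_{i=1}^N\log f(\xi_i|\eta_i,\theta)$, and $\mathsf{p}_N^*$ is the density (on $\mathbb{R}^s$) of the local parameter $\tau=N^{1/2}(\theta-\hat\theta_N)$ when $\theta$ has density $\mathsf{p}_N$. The Fisher information matrices are $$I(\theta;\eta)=\mathbb{E}_{\xi\sim f(\cdot|\eta,\theta)}[s(\xi|\eta,\theta)s(\xi|\eta,\theta)^\top],\qquad I(\theta)=\sum_{h\in\mathcal{H}}\nu_\eta(h)I(\theta;h).$$ $\overline{B}_r(\theta)$ denotes the closed Euclidean ball. Control problem. $\gamma\in(0,1)$; $\mathcal{X}\subset\mathbb{R}^n$ is the state space; $\mathcal{U}\subset\mathbb{R}^m$ is a nonempty control set; $c:\mathbb{R}^n\times\mathbb{R}^m\times\mathbb{R}^d\to\mathbb{R}$ is measurable and bounded on $\mathcal{X}\times\mathcal{U}\times\Xi$; $F:\mathbb{R}^n\times\mathbb{R}^m\times\mathbb{R}^d\to\mathbb{R}^n$ is measurable with $F(\mathcal{X}\times\mathcal{U}\times\Xi)\subset\mathcal{X}$. Write $\mathbb{E}_{\eta'|\eta}[V(y,\eta')]=\sum_{\eta'\in\mathcal{H}}\varpi_{\eta,\eta'}V(y,\eta')$. In the paper's setting the following equations have unique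 bounded solutions on $\mathcal{X}\times\mathcal{H}$, and policies are measurable maps $\mathcal{X}\times\mathcal{H}\to\mathcal{U}$. $V^*$ is the unique bounded solution of $$V(x,\eta)=\inf_{u\in\mathcal{U}}\mathbb{E}_{\xi\sim q(\cdot|\eta)}\Big[c(x,u,\xi)+\gamma\,\mathbb{E}_{\eta'|\eta}[V(F(x,u,\xi),\eta')]\Big].$$ $V_N^*$ is the unique bounded solution of $$V(x,\eta)=\inf_{u\in\mathcal{U}}\mathbb{E}_{\mathsf{p}_N|\eta}\Big[c(x,u,\xi)+\gamma\,\mathbb{E}_{\eta'|\eta}[V(F(x,u,\xi),\eta')]\Big],$$ where for bounded $Y$, $\mathbb{E}_{\mathsf{p}_N|\eta}[Y]=\int_\Theta\int_\Xi Y(\xi)f(\xi|\eta,\theta)\mathsf{p}_N(\theta)\,\mathrm{d}\xi\,\mathrm{d}\theta$. For $\theta\in\Theta$, $V_\theta^{\pi^*}$ is the unique bounded solution of $$V(x,\eta)=\mathbb{E}_{\xi\sim f(\cdot|\eta,\theta)}\Big[c(x,\pi^*(x,\eta),\xi)+\gamma\,\mathbb{E}_{\eta'|\eta}[V(F(x,\pi^*(x,\eta),\xi),\eta')]\Big].$$ In $H_{\theta^*}(x_1,\eta_1)$ the trajectory starts at the initial values $(x_1,\eta_1)$ and follows $x_{t+1}=F(x_t,\pi^*(x_t,\eta_t),\xi_t)$, and $S_{\theta,t}=\sum_{k=1}^t s(\xi_k|\eta_k,\theta)$. A normal law with zero variance is understood as the point mass at its mean. *)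

(* Defs.v *)
From HB Require Import structures.
From mathcomp Require Import all_boot all_order all_algebra.
From mathcomp Require Import all_classical all_reals all_analysis.
From mathcomp Require Import measurable_realfun.
Import Order.TTheory GRing.Theory Num.Theory numFieldNormedType.Exports.

Set Implicit Arguments.
Unset Strict Implicit.
Unset Printing Implicit Defensive.

Local Open Scope classical_set_scope.
Local Open Scope ring_scope.

Definition mx_borel_display : measure_display. Proof. exact: default_measure_display. Qed.

Section mx_borel.
Variables (R : realType) (m n : nat).
Definition mx_borel : set (set 'M[R]_(m, n)) := <<s open >>.
HB.instance Definition _ := @isMeasurable.Build mx_borel_display 'M[R]_(m, n)
  mx_borel (@sigma_algebra0 _ _ _) (@sigma_algebraC _ _)
  (@sigma_algebra_bigcup _ _ _).
End mx_borel.

Section rV_measurable.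
Variable R : realType.
Implicit Type n : nat.

Lemma open_measurable_rV n (U : set 'rV[R]_n) : open U -> measurable U.
Proof. exact: sub_sigma_algebra. Qed.

Lemma measurable_coord n (i : 'I_n) :
  measurable_fun [set: 'rV[R]_n] (fun v => v 0 i).
Proof.
apply: (measurability _ (RGenOInfty.measurableE R)) => _ [_ [a ->] <-].
rewrite setTI; apply: open_measurable_rV.
apply: open_comp; last exact: interval_open.
by move=> v _; exact: coord_continuous.
Qed.

Lemma open_rV_bigcup_box n (U : set 'rV[R]_n) : open U ->
  U = \bigcup_(qk in [set qk : 'rV[rat]_n * nat |
          ball (map_mx ratr qk.1 : 'rV[R]_n) qk.2.+1%:R^-1 `<=` U])
      ball (map_mx ratr qk.1 : 'rV[R]_n) qk.2.+1%:R^-1.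
Proof.
move=> oU; apply/seteqP; split=> [v Uv|v [qk /= qU]]; last exact: qU.
have /nbhs_ballP[e /= e0 eU] : nbhs v U by exact: open_nbhs_nbhs.
have e20 : 0 < e / 2 by rewrite divr_gt0.
have [k _ /(_ _ (leqnn k)) /= ke] := near_infty_natSinv_lt (PosNum e20).
have k0 : 0 < k.+1%:R^-1 :> R by rewrite invr_gt0.
have ex_q i : exists q : rat, `|v 0 i - ratr q| < k.+1%:R^-1.
  have /rat_in_itvoo[q] : v 0 i - k.+1%:R^-1 < v 0 i + k.+1%:R^-1.
    by rewrite ltrD2l gtrN.
  by rewrite in_itv/= => qv; exists q; rewrite distrC ltr_distl.
have [q qv] := choice ex_q; clear ex_q.
exists (\row_i q i, k) => /=; last first.
  by split=> // i j; rewrite !mxE ord1 -ball_normE /= distrC.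
move=> w [_ qw]; apply: eU; split=> // i j.
rewrite -ball_normE/= ord1.
have := qw 0 j; rewrite -ball_normE/= !mxE => qwj.
have := ltrD (qv j) qwj => /(le_lt_trans (ler_distD (ratr (q j)) _ _)).
move/lt_trans; apply; rewrite [ltRHS](splitr e).
by apply: ltrD; exact: ke.
Qed.

Lemma measurable_fun_rVP d (T : measurableType d) n (f : T -> 'rV[R]_n) :
  measurable_fun setT f <->
  forall i, measurable_fun setT (fun x => f x 0 i).
Proof.
split=> [mf i|mf]; first exact: measurableT_comp (@measurable_coord n i) mf.
apply: (@measurability _ _ T 'rV[R]_n setT f open erefl) => _ [U oU <-].
rewrite setTI (open_rV_bigcup_box oU) preimage_bigcup.
rewrite bigcup_mkcond; apply: countable_bigcupT_measurable => // -[q k] /=.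
case: ifP => // _; set B := ball _ _.
have -> : f @^-1` B = \bigcap_(i in [set: 'I_n])
    ((fun x => f x 0 i) @^-1` ball (ratr (q 0 i) : R) k.+1%:R^-1).
  apply/seteqP; split=> [x [_ Bx] i _|x Bx] /=.
    by have := Bx 0 i; rewrite mxE.
  by split=> [|i j]; rewrite ?invr_gt0// ord1 mxE; exact: Bx.
apply: fin_bigcap_measurable => // i _.
rewrite -[X in measurable X]setTI; apply: mf => //.
by apply: open_measurable; apply: ball_open; rewrite invr_gt0.
Qed.

Definition rV_cons n (p : measurableTypeR R * 'rV[R]_n) : 'rV[R]_n.+1 := row_mx p.1%:M p.2.
Definition rV_uncons n (v : 'rV[R]_n.+1) : measurableTypeR R * 'rV[R]_n :=
  (v 0 0, rsubmx (v : 'rV_(1 + n))).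

Lemma rV_consK n : cancel (@rV_cons n) (@rV_uncons n).
Proof.
move=> [x v]; rewrite /rV_uncons /rV_cons row_mxKr; congr pair.
rewrite (_ : (0 : 'I_n.+1) = lshift n (0 : 'I_1)); last exact/val_inj.
by rewrite /= (row_mxEl (x%:M) v) mxE eqxx.
Qed.

Lemma measurable_rV_cons n : measurable_fun setT (@rV_cons n).
Proof.
apply/measurable_fun_rVP => i; case: (@split_ordP 1 n i) => j -> {i}.
- rewrite (_ : (fun _ => _) = fst); first exact: measurable_fst.
  by apply/funext => p; rewrite /rV_cons (row_mxEl p.1%:M p.2) ord1 mxE eqxx.
- rewrite (_ : (fun _ => _) = (fun v : 'rV[R]_n => v 0 j) \o snd).
    exact: measurableT_comp (@measurable_coord n j) measurable_snd.
  by apply/funext => p; rewrite /rV_cons (row_mxEr p.1%:M p.2).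
Qed.

Lemma measurable_rV_uncons n : measurable_fun setT (@rV_uncons n).
Proof.
apply: measurable_fun_pair; first exact: measurable_coord.
apply/measurable_fun_rVP => i.
rewrite (_ : (fun _ => _) = (fun v : 'rV[R]_n.+1 => v 0 (rshift 1 i))).
  exact: measurable_coord.
by apply/funext => v; rewrite mxE.
Qed.

End rV_measurable.

Section lebesgue_rV.
Variable R : realType.

Section rV_product.
Variables (n : nat) (mu : {sigma_finite_measure set 'rV[R]_n -> \bar R}).

Definition rV_product : set 'rV[R]_n.+1 -> \bar R :=
  pushforward (lebesgue_measure \x mu)%E (@rV_cons R n).

HB.instance Definition _ := Measure.copy rV_product
  (measure_function_pushforward__canonical__measure_function_Measure
     (lebesgue_measure \x mu)%E (@measurable_rV_cons R n)).

Let rV_product_sigma_finite : sigma_finite setT rV_product.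
Proof.
have /sigma_finiteP[A [AT ndA mA]] :=
  sigma_finiteT (@lebesgue_measure R : {sigma_finite_measure set _ -> \bar R}).
have /sigma_finiteP[B [BT ndB mB]] := sigma_finiteT mu.
exists (fun k => @rV_uncons R n @^-1` (A k `*` B k)).
  rewrite -preimage_bigcup -[LHS](preimage_setT (@rV_uncons R n)).
  congr (_ @^-1` _); rewrite -setXTT AT BT; apply/seteqP; split; last first.
    by move=> [x y] [k _ [/= Ax By]]; split; exists k.
  move=> [x y] [/= [k _ Akx] [l _ Bly]]; exists (maxn k l) => //; split => /=.
    by move: x Akx; exact/subsetPset/ndA/leq_maxl.
  by move: y Bly; exact/subsetPset/ndB/leq_maxr.
move=> k; have [mAk Ak] := mA k; have [mBk Bk] := mB k; split.
  rewrite -[X in measurable X]setTI; apply: measurable_rV_uncons => //.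
  exact: measurableX.
rewrite /rV_product /pushforward -comp_preimage.
rewrite (_ : @rV_uncons R n \o _ = id) ?preimage_id; last first.
  exact/funext/rV_consK.
by rewrite product_measure1E// lte_mul_pinfty// ge0_fin_numE.
Qed.

HB.instance Definition _ :=
  Measure_isSigmaFinite.Build _ _ _ rV_product rV_product_sigma_finite.
End rV_product.

Fixpoint lebesgue_rV n : {sigma_finite_measure set 'rV[R]_n -> \bar R} :=
  if n is m.+1 then rV_product (lebesgue_rV m) else dirac (0 : 'rV[R]_0).

Lemma lebesgue_rV_box n (A : 'I_n -> set R) : (forall i, measurable (A i)) ->
  lebesgue_rV n [set v | forall i, A i (v 0 i)] =
  (\prod_(i < n) lebesgue_measure (A i))%E.
Proof.
elim: n A => [|n IH] A mA.
  by rewrite big_ord0 /= diracE mem_set// => -[].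
have mB : measurable [set v : 'rV[R]_n | forall i, A (lift ord0 i) (v 0 i)].
  rewrite (_ : mkset _ = \bigcap_(i in [set: 'I_n])
      ((fun v : 'rV[R]_n => v 0 i) @^-1` A (lift ord0 i))); last first.
    by apply/seteqP; split=> [v Av i _|v Av i]; exact: Av.
  apply: fin_bigcap_measurable => // i _.
  by rewrite -[X in measurable X]setTI; exact: measurable_coord.
rewrite big_ord_recl -IH// -product_measure1E//=; last exact: mA.
rewrite /rV_product /pushforward.
congr ((_ \x _)%E _).
have E0 (x : R) (v : 'rV[R]_n) : rV_cons (x, v) 0 ord0 = x.
  exact: (congr1 fst (rV_consK (x, v))).
have ES (x : R) (v : 'rV[R]_n) i : rV_cons (x, v) 0 (lift ord0 i) = v 0 i.
  rewrite (_ : lift ord0 i = rshift 1 i); last exact/val_inj.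
  exact: (row_mxEr x%:M v).
apply/seteqP; split=> [[x v] /= Axv|[x v] /= [Ax Av] i].
  by split=> [|i]; [rewrite -(E0 x v)|rewrite -(ES x v)]; exact: Axv.
by case: (unliftP ord0 i) => [j|] ->; rewrite ?E0 ?ES.
Qed.

End lebesgue_rV.

Section calculus.
Variables (R : realType) (s : nat).
Implicit Types (v th : 'rV[R]_s).

(* The library norm on ['rV_s] is the sup norm. *)
Definition euclid_norm v : R := Num.sqrt (\sum_i v 0 i ^+ 2).
Definition euclid_ball th (r : R) : set 'rV[R]_s :=
  [set x | euclid_norm (x - th) < r].
Definition euclid_closed_ball th (r : R) : set 'rV[R]_s :=
  [set x | euclid_norm (x - th) <= r].

Definition gradient (g : 'rV[R]_s -> R) th : 'rV[R]_s :=
  \row_j 'D_(delta_mx 0 j) g th.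

Definition continuously_differentiable_on (B : set 'rV[R]_s)
    (g : 'rV[R]_s -> R) : Prop :=
  (forall th, B th -> differentiable g th) /\
  (forall th, B th -> {for th, continuous (gradient g)}).

Definition is_density (D : set 'rV[R]_s) (g : 'rV[R]_s -> R) : Prop :=
  [/\ measurable_fun D g, forall x, D x -> 0 <= g x &
      (\int[lebesgue_rV R s]_(x in D) (g x)%:E = 1)%E].

(* density of the centred normal law with nonsingular covariance Sigma *)
Definition normal_density (Sigma : 'M[R]_s) (tau : 'rV[R]_s) : R :=
  (Num.sqrt ((2 * pi) ^+ s * \det Sigma))^-1
  * expR (- (tau *m invmx Sigma *m tau^T) 0 0 / 2).
End calculus.

(* Measurability with respect to the trace sigma-algebra on D; unlike
   [measurable_fun D f] it is not vacuous when D is not measurable. *)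
Definition trace_measurable d d' (T : measurableType d) (T' : measurableType d')
    (D : set T) (f : T -> T') : Prop :=
  forall Y, measurable Y ->
    exists2 B, measurable B & D `&` f @^-1` Y = D `&` B.

Section markov_chain.
Variables (R : realType) (H : finType) (varpi : H -> H -> R).

Definition stochastic_kernel : Prop :=
  (forall h k, 0 <= varpi h k) /\ (forall h, \sum_k varpi h k = 1).

Fixpoint nstep (n : nat) (h k : H) : R :=
  if n is m.+1 then \sum_l varpi h l * nstep m l k else (h == k)%:R.

Definition irreducible_chain : Prop := forall h k, exists n, 0 < nstep n h k.

(* every state has period (gcd of its return times) equal to 1 *)
Definition aperiodic_chain : Prop := forall h (p : nat),
  (forall n, (0 < n)%N -> 0 < nstep n h h -> (p %| n)%N) -> p = 1%N.

Definition stationary_distribution (nu : H -> R) : Prop :=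
  [/\ forall h, 0 <= nu h, \sum_h nu h = 1 &
      forall k, \sum_h nu h * varpi h k = nu k].
End markov_chain.

(* Times are shifted by one: [xi t] and [eta t] are the observations
   $\xi_{t+1}$, $\eta_{t+1}$, so a sample of size N is indexed by t < N. *)
Section data_process.
Variables (R : realType) (d : nat) (H : finType).
Variables (Xi : set 'rV[R]_d) (varpi : H -> H -> R) (h1 : H).
Variables (g : 'rV[R]_d -> H -> R).
Variables (disp : measure_display) (Om : measurableType disp).
Variables (P : probability Om R).
Variables (xi : nat -> Om -> 'rV[R]_d) (eta : nat -> Om -> H).

Definition history (t : nat) (h : nat -> H) (A : nat -> set 'rV[R]_d) : set Om :=
  [set w | forall i, (i < t)%N -> eta i w = h i /\ A i (xi i w)].

(* (xi, eta) has the law of the process with initial state h1, transition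
   probabilities varpi and emission densities g(.|eta).  The conditional laws
   given the past are written in product form, which needs no convention for
   conditioning on null events; events of the form [history] generate the past. *)
Record is_data_process : Prop := {
  process_xi_measurable : forall t, measurable_fun setT (xi t) ;
  process_eta_measurable : forall t h, measurable [set w | eta t w = h] ;
  process_xi_support : forall t w, Xi (xi t w) ;
  process_initial : forall w, eta 0%N w = h1 ;
  process_transition : forall t h A k, (forall i, measurable (A i)) ->
    P (history t.+1 h A `&` [set w | eta t.+1 w = k])
    = ((varpi (h t) k)%:E * P (history t.+1 h A))%E ;
  process_emission : forall t h A k B,
    (forall i, measurable (A i)) -> measurable B ->
    P (history t h A `&` [set w | eta t w = k] `&` [set w | B (xi t w)])
    = ((\int[lebesgue_rV R d]_(x in Xi `&` B) (g x k)%:E)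
       * P (history t h A `&` [set w | eta t w = k]))%E }.
End data_process.

Section convergence.
Variables (R : realType) (disp : measure_display) (Om : measurableType disp).
Variable P : probability Om R.

(* X_N converges in distribution to the law mu, which enters through its
   expectation functional [E g = \int g dmu]. *)
Definition cvg_in_distribution (T : topologicalType) (X : nat -> Om -> T)
    (E : (T -> R) -> R) : Prop :=
  forall g : T -> R, continuous g -> (exists M, forall x, `|g x| <= M) ->
    (fun N => \int[P]_w g (X N w)) @ \oo --> E g.

Definition cvg_in_probability0 (X : nat -> Om -> R) : Prop :=
  forall e : R, 0 < e ->
    (fun N => P [set w | e < `|X N w|]) @ \oo --> 0%E.
End convergence.

(* Expectation under N(m, v); [normal_prob] takes the standard deviation, and
   for a zero one it is not the point mass. *)
Definition normal_expectation (R : realType) (m v : R) (g : R -> R) : R :=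
  if v == 0 then g m else \int[normal_prob m (Num.sqrt v)]_x g x.

Definition mvnormal_expectation (R : realType) (s : nat) (Sigma : 'M[R]_s)
    (g : 'rV[R]_s -> R) : R :=
  \int[lebesgue_rV R s]_x (g x * normal_density Sigma x).

Section bayes.
Variables (R : realType) (d s : nat) (H : finType).
Variables (Xi : set 'rV[R]_d) (Theta : set 'rV[R]_s) (varpi : H -> H -> R).
Variables (f : 'rV[R]_d -> H -> 'rV[R]_s -> R) (p : 'rV[R]_s -> R).

Definition score (x : 'rV[R]_d) (h : H) (th : 'rV[R]_s) : 'rV[R]_s :=
  gradient (fun t => ln (f x h t)) th.

Section sample.
Variables (x : nat -> 'rV[R]_d) (h : nat -> H) (N : nat).

Definition likelihood (th : 'rV[R]_s) : R :=
  f (x 0%N) (h 0%N) th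
  * \prod_(1 <= i < N) (f (x i) (h i) th * varpi (h i.-1) (h i)).

Definition posterior (th : 'rV[R]_s) : R :=
  likelihood th * p th
  / \int[lebesgue_rV R s]_(t in Theta) (likelihood t * p t).

Definition mean_loglikelihood (th : 'rV[R]_s) : R :=
  N%:R^-1 * \sum_(0 <= i < N) ln (f (x i) (h i) th).

Definition is_mle (th : 'rV[R]_s) : Prop :=
  Theta th /\
  forall t, Theta t -> mean_loglikelihood t <= mean_loglikelihood th.

(* density of tau = N^(1/2) (theta - that) when theta has density [posterior]
   on Theta, by the change of variables theta = that + N^(-1/2) tau *)
Definition local_posterior (that tau : 'rV[R]_s) : R :=
  let r := (Num.sqrt N%:R)^-1 in
  let th := that + r *: tau in
  r ^+ s * (posterior th * \1_Theta th).

Definition posterior_expectation (Y : 'rV[R]_s -> R) : R :=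
  \int[lebesgue_rV R s]_(th in Theta) (Y th * posterior th).

Definition predictive_expectation (k : H) (Y : 'rV[R]_d -> R) : R :=
  \int[lebesgue_rV R s]_(th in Theta)
    (\int[lebesgue_rV R d]_(y in Xi) (Y y * f y k th * posterior th)).
End sample.

Definition fisher_information_at (th : 'rV[R]_s) (h : H) : 'M[R]_s :=
  \matrix_(i, j) \int[lebesgue_rV R d]_(x in Xi)
    (score x h th 0 i * score x h th 0 j * f x h th).

Definition fisher_information (nu : H -> R) (th : 'rV[R]_s) : 'M[R]_s :=
  \sum_h nu h *: fisher_information_at th h.
End bayes.

Definition density_expectation (R : realType) (d : nat) (H : finType)
    (Xi : set 'rV[R]_d) (g : 'rV[R]_d -> H -> R) (h : H)
    (Y : 'rV[R]_d -> R) : R :=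
  \int[lebesgue_rV R d]_(x in Xi) (Y x * g x h).

(* integrability with respect to dP*(x, h) = nu(h) q(x|h) dx on Xi * H *)
Definition stationary_integrable (R : realType) (d : nat) (H : finType)
    (Xi : set 'rV[R]_d) (nu : H -> R) (q : 'rV[R]_d -> H -> R)
    (Y : 'rV[R]_d -> H -> R) : Prop :=
  forall h, (lebesgue_rV R d).-integrable Xi
    (fun x => (Y x h * (nu h * q x h))%:E).

Section control.
Variables (R : realType) (n m d s : nat) (H : finType).
Variables (gamma : R) (varpi : H -> H -> R) (X : set 'rV[R]_n) (U : set 'rV[R]_m).
Variables (c : 'rV[R]_n -> 'rV[R]_m -> 'rV[R]_d -> R).
Variables (F : 'rV[R]_n -> 'rV[R]_m -> 'rV[R]_d -> 'rV[R]_n).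
Implicit Types (V : 'rV[R]_n -> H -> R) (pi : 'rV[R]_n -> H -> 'rV[R]_m).

Definition stage_value V x h u (y : 'rV[R]_d) : R :=
  c x u y + gamma * \sum_k varpi h k * V (F x u y) k.

Section bellman.
(* [E h Y] is the expectation of Y(xi) given that the chain is in state h *)
Variable E : H -> ('rV[R]_d -> R) -> R.

Definition action_value V x h u : R := E h (stage_value V x h u).
Definition optimal_bellman V x h : R := inf [set action_value V x h u | u in U].
Definition policy_bellman pi V x h : R := action_value V x h (pi x h).
End bellman.

(* Value functions are measurable in x, so that the expectations in the
   Bellman equations are those of measurable functions. *)
Definition bounded_measurable V : Prop :=
  (forall h, trace_measurable X (V ^~ h)) /\
  exists M, forall x h, X x -> `|V x h| <= M.

Definition unique_bounded_solution
    (T : ('rV[R]_n -> H -> R) -> 'rV[R]_n -> H -> R) V : Prop :=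
  [/\ bounded_measurable V, forall x h, X x -> V x h = T V x h &
      forall W, bounded_measurable W ->
        (forall x h, X x -> W x h = T W x h) ->
        forall x h, X x -> W x h = V x h].

Definition is_policy pi : Prop :=
  (forall x h, X x -> U (pi x h)) /\ (forall h, trace_measurable X (pi ^~ h)).

Section score_functional.
Variables (pi : 'rV[R]_n -> H -> 'rV[R]_m) (x1 : 'rV[R]_n).
Variables (f : 'rV[R]_d -> H -> 'rV[R]_s -> R) (th : 'rV[R]_s).
Variables (xi : nat -> 'rV[R]_d) (eta : nat -> H).

Fixpoint trajectory (t : nat) : 'rV[R]_n :=
  if t is t'.+1
  then F (trajectory t') (pi (trajectory t') (eta t')) (xi t') else x1.

Definition cumulative_score (t : nat) : 'rV[R]_s :=
  \sum_(k < t.+1) score f (xi k) (eta k) th.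

Definition H_functional : 'rV[R]_s :=
  \row_j limn (series (fun t : nat =>
    gamma ^+ t * c (trajectory t) (pi (trajectory t) (eta t)) (xi t)
    * cumulative_score t 0 j)).
End score_functional.
End control.

Definition row_expectation (R : realType) (disp : measure_display)
    (Om : measurableType disp) (P : probability Om R) (s : nat)
    (Y : Om -> 'rV[R]_s) : 'rV[R]_s :=
  \row_j \int[P]_w (Y w 0 j).

(* Main.v *)
Require Import Defs.
From HB Require Import structures.
From mathcomp Require Import all_boot all_order all_algebra.
From mathcomp Require Import all_classical all_reals all_analysis.
From mathcomp Require Import ring lra measurable_realfun.
Import Order.TTheory GRing.Theory Num.Theory numFieldNormedType.Exports.

Set Implicit Arguments.
Unset Strict Implicit.
Unset Printing Implicit Defensive.

Local Open Scope classical_set_scope.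
Local Open Scope ring_scope.

(** Let v(theta) be the value, from the fixed initial point, of the policy pistar when the
    emission densities are f(.|theta), let g be its gradient at thstar, and put
    Y_N = sqrt N (that_N - thstar).  Since pistar is optimal and the model is correctly
    specified, Vstar = v(thstar) at the initial point.  By the additional hypothesis it is then
    enough to study sqrt N (E[v] - v(thstar)), where E is the posterior expectation, and this
    quantity turns out to be Y_N . g up to an error that tends to 0 in probability.

    _The gradient exists and is the expectation of the score functional_.  The bound on
    |score|^2 f makes the square root of the density Lipschitz in theta
    ([sqrt_density_lipschitz]).  This dominates the difference quotients of f, so f(.|theta) is
    differentiable at thstar as a map into L^1, with derivative score * f
    ([density_L1_differentiable]).  Bellman operators are contractions, hence
    V_theta - V_thstar = O(|theta - thstar|) ([solutionB_le]).  Write delta = theta - thstar.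
    Subtracting the two Bellman equations and taking expectations along the controlled process
    under thstar gives, for a_t = E[(V_theta - V_thstar)(x_t, eta_t)], the recursion
    a_t = b_t . delta + gamma a_(t+1) + o(|delta|), where b_t is the mean of the integral of
    (cost-to-go) * score * f at time t.  It unrolls to the gradient sum_t gamma^t b_t
    ([value_differentiable]).  The expectation of H is the same series: with
    A_t = E[S_(t-1) V(x_t, eta_t)], conditioning on the past shows
    E[S_t c_t] = A_t - gamma A_(t+1) + b_t, and A_t grows at most linearly
    ([score_functional_gradient]).

    _The posterior mean_.  In the local parameter the posterior is close to the normal density
    phi, with weight 1 + |tau|^2.  Expanding v around thstar, the linear term in tau has mean 0
    under phi by symmetry, and the quadratic remainder is controlled by the second moment; so
    sqrt N (E[v] - v(thstar)) = Y_N . g + B_N with |B_N| <= Q_N (1 + |Y_N|^2) and Q_N -> 0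
    almost surely ([posterior_mean_expansion]).  As phi has second moments, the convergence in
    distribution of Y_N makes 1 + |Y_N|^2 tight, whence B_N -> 0 in probability.

    _The limit law_.  Under the normal law with covariance Sigma, the linear form x . a has the
    law N(0, a Sigma a^T) ([normal_expectation_projection]); Slutsky's lemma concludes.

    All this needs posterior expectations to be random variables, which follows from the joint
    measurability of the likelihood in the sample and the parameter ([caratheodory]). *)

(** * Affine changes of variables *)

Section affine_change.
Variable R : realType.
Local Notation leb := (@lebesgue_measure R).

(** Fixes the measure structure on a pushforward by naming the proof that the map is measurable,
    which cannot be recovered from the function alone. *)
Definition image_measure d d' (T : measurableType d) (T' : measurableType d')
    (mu : {measure set T -> \bar R}) (g : T -> T') (mg : measurable_fun setT g) :
    {measure set T' -> \bar R} :=
  measure_function_pushforward__canonical__measure_function_Measure mu mg.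

Lemma measurable_affine (b r : R) :
  measurable_fun [set: measurableTypeR R]
    ((fun x => b + r * x) : measurableTypeR R -> measurableTypeR R).
Proof. by apply: measurable_funD => //; exact: measurable_funM. Qed.

(** Lebesgue measure is determined by its values on the intervals ]a, c], and the preimage of
    such an interval is an interval, half-open on the other side when [r] is negative. *)
Lemma lebesgue_measure_affine (b r : R) (A : set (measurableTypeR R)) : r != 0 -> measurable A ->
  leb A = (`|r|%:E * leb ((fun x => (b + r * x)%R) @^-1` A))%E.
Proof.
move=> r0 mA.
pose m : {measure set (measurableTypeR R) -> \bar R} := mscale (NngNum (normr_ge0 r))
  (image_measure leb (measurable_affine b r)).
have -> : (`|r|%:E * leb ((fun x => (b + r * x)%R) @^-1` A))%E = m A by [].
apply: lebesgue_measure_unique => // _ [[a c]] /= ac <-.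
rewrite [RHS](_ : _ = (`|r|%:E * leb ((fun x => (b + r * x)%R) @^-1` `]a, c]))%E)//.
have [rp|rn|/eqP] := ltgtP r 0; last by rewrite (negbTE r0).
- rewrite (_ : _ @^-1` _ = `[(c - b) / r, (a - b) / r[%classic).
    rewrite !lebesgue_measure_itv/= !lte_fin ltr_ndivrMr// divfK// ltrD2r.
    case: ifPn => _; rewrite ?mule0// -!EFinD -EFinM; congr EFin.
    by rewrite ltr0_norm//; field.
  apply/seteqP; split=> x /=; rewrite !in_itv/= ler_ndivrMr// ltr_ndivlMr// mulrC; lra.
- rewrite (_ : _ @^-1` _ = `](a - b) / r, (c - b) / r]%classic).
    rewrite !lebesgue_measure_itv/= !lte_fin ltr_pdivlMr// divfK// ltrD2r.
    case: ifPn => _; rewrite ?mule0// -!EFinD -EFinM; congr EFin.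
    by rewrite gtr0_norm//; field.
  apply/seteqP; split=> x /=; rewrite !in_itv/= ler_pdivlMr// ltr_pdivrMr// mulrC; lra.
Qed.

Lemma ge0_integral_affine (b r : R) (F : R -> \bar R) : r != 0 ->
  measurable_fun [set: measurableTypeR R] F -> (forall x, 0 <= F x)%E ->
  (\int[leb]_x F x = `|r|%:E * \int[leb]_x F (b + r * x)%R)%E.
Proof.
move=> r0 mF F0.
rewrite (eq_measure_integral (mscale (NngNum (normr_ge0 r))
  (image_measure leb (measurable_affine b r)))); last first.
  by move=> A mA _; exact: lebesgue_measure_affine.
rewrite ge0_integral_mscale//; congr (_ * _)%E.
by rewrite (ge0_integral_pushforward (measurable_affine b r)).
Qed.

Lemma ge0_integral_rV_cons n (F : 'rV[R]_n.+1 -> \bar R) :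
  measurable_fun setT F -> (forall x, 0 <= F x)%E ->
  (\int[lebesgue_rV R n.+1]_x F x =
   \int[leb]_x \int[lebesgue_rV R n]_v F (rV_cons (x, v)))%E.
Proof.
move=> mF F0.
rewrite (eq_measure_integral (image_measure (leb \x lebesgue_rV R n)%E (@measurable_rV_cons R n)))//.
rewrite (ge0_integral_pushforward (@measurable_rV_cons R n))//.
rewrite preimage_setT fubini_tonelli1//; last by move=> z; exact: F0.
exact: measurableT_comp mF (@measurable_rV_cons R n).
Qed.

Lemma measurable_rV_affine n (b : 'rV[R]_n) (r : R) :
  measurable_fun setT (fun x : 'rV[R]_n => b + r *: x).
Proof.
apply/measurable_fun_rVP => i.
apply: (eq_measurable_fun (fun x : 'rV[R]_n => b 0 i + r * x 0 i)).
  by move=> x _; rewrite !mxE.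
apply: measurable_funD => //; apply: measurable_funM => //.
exact: measurable_coord.
Qed.

(** By induction on the dimension, splitting off the first coordinate by Tonelli and changing
    one variable at a time. *)
Lemma ge0_integral_rV_affine n (b : 'rV[R]_n) (r : R) (F : 'rV[R]_n -> \bar R) : r != 0 ->
  measurable_fun setT F -> (forall x, 0 <= F x)%E ->
  (\int[lebesgue_rV R n]_x F x =
   `|r|%:E ^+ n * \int[lebesgue_rV R n]_x F (b + r *: x)%R)%E.
Proof.
move=> r0; elim: n b F => [|n IH] b F mF F0.
  rewrite expe0 mul1e; apply: eq_integral => x _; congr F.
  by apply/rowP => -[].
have mFA := measurableT_comp mF (measurable_rV_affine b r).
rewrite !ge0_integral_rV_cons//.
set G := fun x => (\int[lebesgue_rV R n]_v F (rV_cons (x, v)))%E.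
have mG : measurable_fun [set: measurableTypeR R] G.
  apply: (measurable_fun_fubini_tonelli_F (fun z => F (rV_cons z))) => //.
  exact: measurableT_comp mF (@measurable_rV_cons R n).
rewrite (@ge0_integral_affine (b 0 0) r)//; last by move=> x; exact: integral_ge0.
rewrite expeS -muleA; congr (_ * _)%E.
rewrite -ge0_integralZl//; last 3 first.
- apply: (measurable_fun_fubini_tonelli_F (fun z => F (b + r *: rV_cons z))) => //.
  exact: measurableT_comp mFA (@measurable_rV_cons R n).
- by move=> x _; exact: integral_ge0.
- by apply: expe_ge0; rewrite lee_fin.
apply: eq_integral => x _; rewrite /G.
rewrite (IH (rsubmx (b : 'rV_(1 + n)))); last 2 first.
- apply: measurableT_comp mF _; apply: measurableT_comp (@measurable_rV_cons R n) _.
  exact: measurable_pair1.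
- by move=> y; exact: F0.
congr (_ * _)%E; apply: eq_integral => v _; congr F.
have aff k (c u : 'rV[R]_k) i : (c + r *: u) 0 i = c 0 i + r * u 0 i.
  by rewrite !mxE.
(* entry by entry: the first coordinate and the others *)
apply/rowP => i; rewrite aff.
have E0 (y : R) (u : 'rV[R]_n) : rV_cons (y, u) 0 ord0 = y.
  exact: (congr1 fst (rV_consK (y, u))).
have ES (y : R) (u : 'rV[R]_n) j : rV_cons (y, u) 0 (lift ord0 j) = u 0 j.
  rewrite (_ : lift ord0 j = rshift 1 j); last exact/val_inj.
  exact: (row_mxEr y%:M u).
case: (unliftP ord0 i) => [j|] ->; rewrite ?E0 ?ES// aff mxE.
by congr (b 0 _ + _); exact/val_inj.
Qed.

End affine_change.

(** * Measures with a density *)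

Section density.
Context d (T : measurableType d) (R : realType).
Variables (mu : {measure set T -> \bar R}) (rho : T -> R).
Hypothesis mrho : measurable_fun setT rho.
Hypothesis rho0 : forall x, 0 <= rho x.

Definition density_measure (A : set T) : \bar R := (\int[mu]_(x in A) (rho x)%:E)%E.

Let density0 : density_measure set0 = 0%E.
Proof. exact: integral_set0. Qed.

Let density_ge0 A : (0 <= density_measure A)%E.
Proof. by apply: integral_ge0 => x _; rewrite lee_fin. Qed.

Let density_sigma_additive : semi_sigma_additive density_measure.
Proof.
move=> F mF tF mUF; rewrite /density_measure.
rewrite ge0_integral_bigcup//; last 2 first.
- by apply: measurable_funTS; exact/measurable_EFinP.
- by move=> x _; rewrite lee_fin.
apply: is_cvg_ereal_nneg_natsum_cond => n _ _.
by apply: integral_ge0 => x _; rewrite lee_fin.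
Qed.

HB.instance Definition _ := isMeasure.Build _ _ _
  density_measure density0 density_ge0 density_sigma_additive.

(** Carries the proofs that [rho] is measurable and nonnegative, on which the measure structure
    depends but which [density_measure] does not mention. *)
Definition measure_of_density : {measure set T -> \bar R} := density_measure.
End density.

Section integral_density.
Local Open Scope ereal_scope.
Context d (T : measurableType d) (R : realType).
Variables (mu nu : {measure set T -> \bar R}) (rho : T -> R).
Hypothesis mrho : measurable_fun setT rho.
Hypothesis rho0 : forall x, (0 <= rho x)%R.
Hypothesis nuE : forall A, measurable A -> nu A = \int[mu]_(x in A) (rho x)%:E.
Import HBNNSimple.

(** Clear for indicators by definition of the density, hence for simple functions by linearity
    and in general by monotone convergence. *)
Lemma ge0_integral_density (g : T -> \bar R) :
  measurable_fun setT g -> (forall x, 0 <= g x) ->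
  \int[nu]_x g x = \int[mu]_x (g x * (rho x)%:E).
Proof.
move=> mg g0.
pose f_ := nnsfun_approx measurableT mg.
transitivity (limn (fun n => \int[nu]_x (f_ n x)%:E)).
  rewrite -monotone_convergence//.
  - by apply: eq_integral => y _; apply/esym/cvg_lim => //; apply: cvg_nnsfun_approx.
  - by move=> n; exact/measurable_EFinP/measurable_funP.
  - by move=> n y _; rewrite lee_fin.
  - by move=> y _ m n mn; rewrite lee_fin; exact/lefP/nd_nnsfun_approx.
rewrite [X in limn X](_ : _ = (fun n => \int[mu]_x ((f_ n x)%:E * (rho x)%:E))).
  rewrite -monotone_convergence//; last 3 first.
  - move=> n; apply: emeasurable_funM; last exact/measurable_EFinP.
    by apply/measurable_EFinP; exact: measurable_funP.
  - by move=> n x _; rewrite mule_ge0// lee_fin.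
  - move=> x _ m n mn; apply: lee_wpmul2r; rewrite lee_fin//.
    exact/lefP/nd_nnsfun_approx.
  apply: eq_integral => x _; apply/cvg_lim => //.
  by apply: cvgeZr => //; exact: cvg_nnsfun_approx.
apply/funext => n.
under eq_integral do rewrite fimfunE -fsumEFin//.
rewrite ge0_integral_fsum//; last 2 first.
- by move=> y; exact/measurable_EFinP/measurable_funM.
- by move=> y x _; rewrite nnfun_muleindic_ge0.
transitivity (\sum_(k \in range (f_ n))
    \int[mu]_x ((k * \1_(f_ n @^-1` [set k]) x)%:E * (rho x)%:E)).
  apply: eq_fsbigr => r _; rewrite integralZl_indic_nnsfun// integral_indic//= setIT.
  rewrite nuE//.
  have [r0|r0] := leP 0%R r; last first.
    rewrite preimage_nnfun0//= integral_set0 mule0.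
    by under eq_integral do rewrite indicE in_set0 mulr0 mul0e; rewrite integral0.
  rewrite integral_mkcond -ge0_integralZl//; last 2 first.
  - apply/(measurable_restrictT _ _).1 => //; apply: measurable_funTS.
    exact/measurable_EFinP.
  - by move=> x _; rewrite patchE; case: ifP => // _; rewrite lee_fin.
  apply: eq_integral => x _; rewrite patchE indicE EFinM -muleA.
  by case: ifPn => _; rewrite ?mul1e ?mul0e.
rewrite -ge0_integral_fsum//.
- apply: eq_integral => x _; rewrite -ge0_mule_fsuml; last first.
    by move=> r; rewrite nnfun_muleindic_ge0.
  by rewrite fsumEFin// -fimfunE.
- move=> r; apply: emeasurable_funM; last exact/measurable_EFinP.
  exact/measurable_EFinP/measurable_funM.
- by move=> r x _; apply: mule_ge0; [rewrite nnfun_muleindic_ge0|rewrite lee_fin].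
Qed.
End integral_density.

(** * Linear images of the normal law *)

Section normal_density_facts.
Variables (R : realType) (s : nat) (Sigma : 'M[R]_s).
Local Notation phi := (normal_density Sigma).

Lemma measurable_rV_linear (a : 'rV[R]_s) :
  measurable_fun setT (fun x : 'rV[R]_s => (x *m a^T) 0 0).
Proof.
under eq_fun do rewrite mxE.
apply: measurable_sum => i; apply: measurable_funM => //.
exact: measurable_coord.
Qed.

Lemma measurable_normal_density : measurable_fun setT phi.
Proof.
apply: measurable_funM => //; apply: measurableT_comp => //.
apply: measurable_funM => //; apply: measurableT_comp => //.
under eq_fun do rewrite mxE.
apply: measurable_sum => i; apply: measurable_funM; last first.
  by under eq_fun do rewrite mxE; exact: measurable_coord.
under eq_fun do rewrite mxE.
by apply: measurable_sum => j; apply: measurable_funM => //; exact: measurable_coord.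
Qed.

Lemma normal_density_ge0 x : 0 <= phi x.
Proof. by rewrite mulr_ge0 ?expR_ge0// invr_ge0 sqrtr_ge0. Qed.

Lemma normal_densityN x : phi (- x) = phi x.
Proof.
rewrite /normal_density; suff -> : - x *m invmx Sigma *m (- x)^T = x *m invmx Sigma *m x^T by [].
by rewrite linearN/= mulmxN !mulNmx opprK.
Qed.

Hypothesis Ssym : Sigma^T = Sigma.
Hypothesis Sunit : Sigma \in unitmx.
Variable a : 'rV[R]_s.
Let Z (x : 'rV[R]_s) := (x *m a^T) 0 0.
Let v := (a *m Sigma *m a^T) 0 0.

(** Completing the square: a translation along [a *m Sigma] multiplies the density by an
    exponential of the linear form [Z] alone.  The law of [Z] can be read off from these
    exponential tilts, without diagonalising [Sigma]. *)
Lemma normal_density_shift (t : R) (x : 'rV[R]_s) :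
  phi (x + t *: (a *m Sigma)) = phi x * expR (- t * Z x - t ^+ 2 * v / 2).
Proof.
rewrite /normal_density -[RHS]mulrA -expRD; congr (_ * _); congr expR.
have ub : (a *m Sigma *m invmx Sigma) = a by rewrite -mulmxA mulmxV ?mulmx1.
have q1 : ((t *: (a *m Sigma)) *m invmx Sigma *m (x + t *: (a *m Sigma))^T) 0 0
    = t * Z x + t ^+ 2 * v.
  rewrite -2!scalemxAl ub linearD/= mulmxDr scalerDr mxE.
  rewrite linearZ/= -scalemxAr scalerA trmx_mul Ssym mulmxA -expr2.
  rewrite [X in X + _]mxE [X in _ + X]mxE; congr (_ * _ + _).
  by rewrite /Z -{1}(trmxK a) -trmx_mul mxE.
have q2 : (x *m invmx Sigma *m (t *: (a *m Sigma))^T) 0 0 = t * Z x.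
  rewrite linearZ/= -scalemxAr mxE; congr (_ * _).
  by rewrite trmx_mul Ssym mulmxA -(mulmxA x) mulVmx ?mulmx1.
set b := t *: _ in q1 q2 *.
have -> : (x + b) *m invmx Sigma *m (x + b)^T = x *m invmx Sigma *m x^T
    + x *m invmx Sigma *m b^T + b *m invmx Sigma *m (x + b)^T.
  by rewrite -mulmxDr -linearD -!mulmxDl.
rewrite mxE q1 mxE q2.
by field.
Qed.

Local Notation mu := (lebesgue_rV R s).

Lemma normal_expectation_shift (t : R) (k : R -> R) :
  measurable_fun setT k -> (forall x, 0 <= k x) ->
  (\int[mu]_x (k (Z x) * phi x)%:E =
   \int[mu]_x (k (Z x + t * v) * expR (- t * Z x - t ^+ 2 * v / 2) * phi x)%:E)%E.
Proof.
move=> mk k0.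
rewrite (@ge0_integral_rV_affine _ _ (t *: (a *m Sigma)) 1) ?oner_neq0//; last 2 first.
- apply/measurable_EFinP; apply: measurable_funM; last exact: measurable_normal_density.
  by apply: measurableT_comp => //; exact: measurable_rV_linear.
- by move=> x; rewrite lee_fin mulr_ge0// normal_density_ge0.
rewrite normr1 -EFin_expe expr1n mul1e; apply: eq_integral => x _; congr EFin.
rewrite scale1r addrC normal_density_shift mulrA mulrAC; congr (k _ * _ * _).
by rewrite /Z mulmxDl -scalemxAl mxE [X in _ + X]mxE.
Qed.

Hypothesis mass1 : (\int[mu]_x (phi x)%:E = 1)%E.

(** The translated density has mass 1 as well. *)
Lemma normal_mgf (t : R) :
  (\int[mu]_x (expR (t * Z x) * phi x)%:E = (expR (t ^+ 2 * v / 2))%:E)%E.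
Proof.
have mphi := measurable_normal_density.
have mZ : measurable_fun setT (fun x => expR (t * Z x) * phi x).
  apply: measurable_funM => //; apply: measurableT_comp => //.
  by apply: measurable_funM => //; exact: measurable_rV_linear.
have := @normal_expectation_shift (- t) (cst 1) (measurable_cst _) (fun=> ler01).
under eq_integral do rewrite mul1r.
rewrite mass1.
under eq_integral do rewrite mul1r opprK sqrrN expRD mulrAC EFinM.
rewrite ge0_integralZr//; last 2 first.
- exact/measurable_EFinP.
- by move=> x _; rewrite lee_fin mulr_ge0 ?expR_ge0// normal_density_ge0.
set I := (\int[mu]_x _)%E => /(congr1 (fun y => y * (expR (t ^+ 2 * v / 2))%:E)%E).
by rewrite mul1e -muleA -EFinM -expRD addNr expR0 mule1 => ->.
Qed.

Let coshZ (x : 'rV[R]_s) := expR (Z x) + expR (- Z x).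

Let coshZ_ge2 x : 2 <= coshZ x.
Proof. by have := expR_ge1Dx (Z x); have := expR_ge1Dx (- Z x); rewrite /coshZ; lra. Qed.

Let integral_coshZ : (\int[mu]_x (coshZ x * phi x)%:E = (expR (v / 2) *+ 2)%:E)%E.
Proof.
have mphi := measurable_normal_density.
have m t : measurable_fun setT (fun x => expR (t * Z x) * phi x).
  apply: measurable_funM => //; apply: measurableT_comp => //.
  by apply: measurable_funM => //; exact: measurable_rV_linear.
have E t x : 0 <= expR (t * Z x) * phi x.
  by rewrite mulr_ge0 ?expR_ge0// normal_density_ge0.
have -> : (fun x => (coshZ x * phi x)%:E) =
    (fun x => (expR (1 * Z x) * phi x)%:E + (expR (- 1 * Z x) * phi x)%:E)%E.
  by apply/funext => x; rewrite -EFinD -mulrDl mul1r mulN1r.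
rewrite ge0_integralD//; last 4 first.
- by move=> x _; rewrite lee_fin.
- exact/measurable_EFinP.
- by move=> x _; rewrite lee_fin.
- exact/measurable_EFinP.
by rewrite !normal_mgf sqrrN expr1n mul1r -EFinD mulr2n.
Qed.

Let mcoshZ : measurable_fun setT (fun x => coshZ x * phi x).
Proof.
apply: measurable_funM; last exact: measurable_normal_density.
apply: measurable_funD; apply: measurableT_comp => //.
  exact: measurable_rV_linear.
by apply: measurableT_comp => //; exact: measurable_rV_linear.
Qed.

(** Positivity of the variance is forced by the total mass being 1, because
    exp Z + exp (- Z) >= 2 while its mean is 2 exp (v / 2). *)
Lemma normal_variance_ge0 : 0 <= v.
Proof.
have : (2%:E <= \int[mu]_x (coshZ x * phi x)%:E)%E.
  rewrite -[leLHS]mule1 -mass1 -ge0_integralZl//; last 2 first.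
  - by apply/measurable_EFinP; exact: measurable_normal_density.
  - by move=> x _; rewrite lee_fin normal_density_ge0.
  apply: ge0_le_integral => //.
  - by move=> x _; rewrite -EFinM lee_fin mulr_ge0// normal_density_ge0.
  - apply: measurable_funeM; apply/measurable_EFinP; exact: measurable_normal_density.
  - exact/measurable_EFinP.
  - by move=> x _; rewrite -EFinM lee_fin ler_wpM2r// normal_density_ge0.
rewrite integral_coshZ lee_fin (_ : 2 = 1 *+ 2 :> R)// lerMn2r/= -[leLHS]expR0 ler_expR.
by rewrite pmulr_lge0.
Qed.

(** When [v] vanishes, exp Z + exp (- Z) has mean 2, its minimum, so that Z = 0 almost
    everywhere. *)
Lemma normal_degenerate (h : R -> R) : v = 0 ->
  measurable_fun setT h -> (forall x, 0 <= h x) ->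
  (\int[mu]_x (h (Z x) * phi x)%:E = (h 0)%:E)%E.
Proof.
move=> v0 mh h0.
have mphi := measurable_normal_density.
pose D x := (coshZ x - 2) * phi x.
have mD : measurable_fun setT D.
  under [D]eq_fun do rewrite /D mulrBl.
  by apply: measurable_funB => //; exact: measurable_funM.
have D0 x : 0 <= D x by rewrite mulr_ge0 ?normal_density_ge0// subr_ge0.
have ID : (\int[mu]_x `|(D x)%:E| = 0)%E.
  have : (\int[mu]_x (coshZ x * phi x)%:E =
          \int[mu]_x (D x)%:E + 2%:E * \int[mu]_x (phi x)%:E)%E.
    rewrite -ge0_integralZl//; last 2 first.
    - exact/measurable_EFinP.
    - by move=> x _; rewrite lee_fin normal_density_ge0.
    rewrite -ge0_integralD//; last 4 first.
    - by move=> x _; rewrite lee_fin.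
    - exact/measurable_EFinP.
    - by move=> x _; rewrite -EFinM lee_fin mulr_ge0// normal_density_ge0.
    - by apply: measurable_funeM; exact/measurable_EFinP.
    by apply: eq_integral => x _; rewrite -EFinM -EFinD; congr EFin; rewrite /D; lra.
  rewrite integral_coshZ mass1 v0 mul0r expR0 mule1.
  under [X in _ -> X = _]eq_integral do rewrite gee0_abs ?lee_fin//.
  have : (0 <= \int[mu]_x (D x)%:E)%E by apply: integral_ge0 => x _; rewrite lee_fin.
  case: (\int[mu]_x (D x)%:E)%E => [r| |]//.
  by rewrite -EFinD => _ [] ?; congr EFin; lra.
transitivity (\int[mu]_x ((h 0)%:E * (phi x)%:E))%E; last first.
  rewrite ge0_integralZl ?mass1 ?mule1 ?lee_fin//.
  - exact/measurable_EFinP.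
  - by move=> x _; rewrite lee_fin normal_density_ge0.
apply: ae_eq_integral => //.
- apply/measurable_EFinP; apply: measurable_funM => //.
  by apply: measurableT_comp => //; exact: measurable_rV_linear.
- by apply: measurable_funeM; exact/measurable_EFinP.
have mED : measurable_fun setT (EFin \o D) by exact/measurable_EFinP.
have := (ae_eq_integral_abs mu measurableT mED).1 ID.
apply: filterS => x /(_ I) [] /eqP.
rewrite mulf_eq0 => /orP[|/eqP ->]; last by rewrite mulr0 mule0.
have [-> _|Zx] := eqVneq (Z x) 0; first by rewrite EFinM.
rewrite subr_eq0 => /eqP c2; exfalso.
have := expR_gt1Dx Zx; have : - Z x != 0 by rewrite oppr_eq0.
by move/expR_gt1Dx; move: c2; rewrite /coshZ; lra.
Qed.

(** Inserting the total mass and translating gives the integral of [g] over y as the double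
    integral of g (Z + y) phi.  Absorbing y into x by a translation along [a *m Sigma] replaces
    Z + y by Z at the price of an exponential tilt; when [g] carries the factor
    exp (- z^2 / (2 v)), integrating the tilt over y leaves a normal integral in y, of mass 1. *)
Lemma normal_projection (h : R -> R) : 0 < v ->
  measurable_fun setT h -> (forall x, 0 <= h x) ->
  (\int[mu]_x (h (Z x) * phi x)%:E =
   \int[lebesgue_measure]_y (h y * normal_pdf 0 (Num.sqrt v) y)%:E)%E.
Proof.
move=> v0 mh h0; set sg := Num.sqrt v.
have sg0 : sg != 0 by rewrite gt_eqF// sqrtr_gt0.
have sg2 : sg ^+ 2 = v by rewrite sqr_sqrtr// ltW.
have mphi := measurable_normal_density.
pose N := normal_pdf 0 sg.
have mN : measurable_fun setT N by exact: measurable_normal_pdf.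
have N0 y : 0 <= N y by exact: normal_pdf_ge0.
pose g y := h y * N y.
have mg : measurable_fun setT g by exact: measurable_funM.
have g0 y : 0 <= g y by rewrite mulr_ge0.
have mZ : measurable_fun setT Z by exact: measurable_rV_linear.
have tilt z y : N z * expR ((2 * y * z - y ^+ 2) / (2 * v)) = normal_pdf z sg y.
  rewrite /N !normal_pdfE// /normal_fun -[LHS]mulrA -expRD; congr (_ * _); congr expR.
  by rewrite sg2; field; rewrite gt_eqF.
(* the translation by y / v times a *m Sigma shifts Z by y and undoes the exponential *)
have untilt (y z : R) : expR ((2 * y * (z + y) - y ^+ 2) / (2 * v) +
    (- (y / v) * z - (y / v) ^+ 2 * v / 2)) = 1.
  by rewrite -[RHS]expR0; congr expR; field; exact: lt0r_neq0.
have mgsum : measurable_fun setT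
    (fun z : 'rV[R]_s * measurableTypeR R => g (Z z.1 + z.2) * phi z.1).
  apply: measurable_funM; last exact: measurableT_comp mphi measurable_fst.
  apply: measurableT_comp => //; apply: measurable_funD; last exact: measurable_snd.
  exact: measurableT_comp mZ measurable_fst.
have mtilt : measurable_fun setT (fun z : 'rV[R]_s * measurableTypeR R =>
    g (Z z.1) * expR ((2 * z.2 * Z z.1 - z.2 ^+ 2) / (2 * v)) * phi z.1).
  have mZ1 : measurable_fun setT (fun z : 'rV[R]_s * measurableTypeR R => Z z.1).
    exact: measurableT_comp mZ measurable_fst.
  have m2 : measurable_fun setT (fun z : 'rV[R]_s * measurableTypeR R => z.2 : R).
    exact: measurable_snd.
  apply: measurable_funM; last exact: measurableT_comp mphi measurable_fst.
  apply: measurable_funM; first exact: measurableT_comp mg mZ1.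
  apply: measurableT_comp => //; apply: measurable_funM => //.
  apply: measurable_funB; last exact: measurable_funX.
  by apply: measurable_funM => //; exact: measurable_funM.
symmetry.
transitivity (\int[mu]_x \int[lebesgue_measure]_y (g (Z x + y) * phi x)%:E)%E.
  rewrite -[LHS]mule1 -mass1 -ge0_integralZl//; last 3 first.
  - exact/measurable_EFinP.
  - by move=> x _; rewrite lee_fin normal_density_ge0.
  - by apply: integral_ge0 => y _; rewrite lee_fin g0.
  apply: eq_integral => x _.
  rewrite (@ge0_integral_affine _ (Z x) 1)//; last exact/measurable_EFinP.
  rewrite normr1 mul1e -ge0_integralZr; last 4 first.
  - exact: measurableT.
  - apply/measurable_EFinP; exact: measurableT_comp mg (measurable_affine (Z x) 1).
  - by move=> y _; rewrite lee_fin g0.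
  - by rewrite lee_fin normal_density_ge0.
  by apply: eq_integral => y _; rewrite mul1r -EFinM.
rewrite (fubini_tonelli (fun z : 'rV[R]_s * measurableTypeR R => (g (Z z.1 + z.2) * phi z.1)%:E))//; last 2 first.
- exact/measurable_EFinP.
- by move=> z; rewrite lee_fin mulr_ge0// normal_density_ge0.
transitivity (\int[lebesgue_measure]_y \int[mu]_x
    (g (Z x) * expR ((2 * y * Z x - y ^+ 2) / (2 * v)) * phi x)%:E)%E.
  apply: eq_integral => y _; symmetry.
  rewrite (@normal_expectation_shift (y / v)
    (fun z => g z * expR ((2 * y * z - y ^+ 2) / (2 * v)))); last 2 first.
  - apply: measurable_funM => //; apply: measurableT_comp => //.
    by apply: measurable_funM => //; apply: measurable_funB => //; exact: measurable_funM.
  - by move=> z; rewrite mulr_ge0 ?expR_ge0.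
  apply: eq_integral => x _; congr EFin; congr (_ * _).
  rewrite divfK ?gt_eqF// -[LHS]mulrA -expRD -[RHS]mulr1; congr (_ * _).
  exact: untilt.
rewrite -(fubini_tonelli (fun z : 'rV[R]_s * measurableTypeR R =>
    (g (Z z.1) * expR ((2 * z.2 * Z z.1 - z.2 ^+ 2) / (2 * v)) * phi z.1)%:E))//; last 2 first.
- exact/measurable_EFinP.
- by move=> z; rewrite lee_fin !mulr_ge0 ?expR_ge0// normal_density_ge0.
apply: eq_integral => x _.
under eq_integral do rewrite /= /g -(mulrA (h (Z x))) tilt mulrAC EFinM.
rewrite ge0_integralZl//; last 3 first.
- by apply/measurable_EFinP; exact: measurable_normal_pdf.
- by move=> y _; rewrite lee_fin normal_pdf_ge0.
- by rewrite lee_fin mulr_ge0// normal_density_ge0.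
by rewrite integral_normal_pdf mule1.
Qed.

End normal_density_facts.

Lemma ge0_integral_normal_prob (R : realType) (sg : R) (h : R -> R) :
  measurable_fun setT h -> (forall x, 0 <= h x) ->
  (\int[normal_prob 0 sg]_y (h y)%:E =
   \int[lebesgue_measure]_y (h y * normal_pdf 0 sg y)%:E)%E.
Proof.
move=> mh h0.
rewrite (@ge0_integral_density _ _ _ lebesgue_measure _ (normal_pdf 0 sg))//.
- exact: measurable_normal_pdf.
- by move=> x; exact: normal_pdf_ge0.
- exact/measurable_EFinP.
Qed.

(** The limit variance is allowed to vanish, in which case the law of the projection is a point
    mass; positive and negative parts are treated separately, so the two sides also agree when
    the integrals are infinite. *)
Lemma normal_expectation_projection (R : realType) s (Sigma : 'M[R]_s)
    (a : 'rV[R]_s) (g : R -> R) :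
  Sigma^T = Sigma -> Sigma \in unitmx ->
  (\int[lebesgue_rV R s]_x (normal_density Sigma x)%:E = 1)%E ->
  measurable_fun setT g ->
  mvnormal_expectation Sigma (fun x => g ((x *m a^T) 0 0)) =
  normal_expectation 0 ((a *m Sigma *m a^T) 0 0) g.
Proof.
move=> Ssym Su m1 mg; rewrite /mvnormal_expectation /normal_expectation.
set v := (a *m _ *m _) 0 0.
have v0 : 0 <= v by exact: normal_variance_ge0.
have mgp : measurable_fun setT g^\+ by exact: measurable_funrpos.
have mgn : measurable_fun setT g^\- by exact: measurable_funrneg.
have gp0 x : 0 <= g^\+ x by exact: funrpos_ge0.
have gn0 x : 0 <= g^\- x by exact: funrneg_ge0.
rewrite /Rintegral integralE.
have phi0 := normal_density_ge0 Sigma.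
have -> : ((fun x => (g ((x *m a^T) 0 0) * normal_density Sigma x)%:E)^\+)%E =
   (fun x => (g^\+ ((x *m a^T) 0 0) * normal_density Sigma x)%:E).
  apply/funext => x; rewrite funeposE /funrpos -EFin_max; congr EFin.
  by rewrite -[X in Num.max _ X = _](mul0r (normal_density Sigma x)) maxr_pMl.
have -> : ((fun x => (g ((x *m a^T) 0 0) * normal_density Sigma x)%:E)^\-)%E =
   (fun x => (g^\- ((x *m a^T) 0 0) * normal_density Sigma x)%:E).
  apply/funext => x; rewrite funenegE /funrneg -EFinN -EFin_max; congr EFin.
  by rewrite -[X in Num.max _ X = _](mul0r (normal_density Sigma x)) -mulNr maxr_pMl.
have [ve0|vn0] := eqVneq v 0.
  rewrite !(normal_degenerate _ _ _ ve0)//=.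
  by rewrite -[g in RHS]funrposBneg.
have vp : 0 < v by rewrite lt0r vn0.
rewrite !(normal_projection _ _ _ vp)// -!ge0_integral_normal_prob//.
rewrite [in RHS]integralE; congr (fine (_ - _)%E); apply: eq_integral => y _.
  by rewrite funeposE /funrpos EFin_max.
by rewrite funenegE /funrneg EFin_max.
Qed.

(** * Convergence in probability and tightness *)

(** Only one of the two points has to lie in the compact set, which is what the comparison of
    a tight variable with a perturbation of it requires. *)
Lemma compact_uniform_continuity (R : realType) (g : R -> R) (K : set R) (e : R) :
  continuous g -> compact K -> 0 < e ->
  exists2 d, 0 < d & forall x y, K x -> `|x - y| <= d -> `|g x - g y| <= e.
Proof.
move=> cg /compact_near_coveringP cK e0.
have := cK R (0^'+) (fun d x => forall y, `|x - y| <= d -> `|g x - g y| <= e) _.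
have step x : K x -> \forall x' \near x & i \near 0^'+, forall y : R, `|x' - y| <= i -> `|g x' - g y| <= e.
  move=> _; have e2 : 0 < e / 2 by rewrite divr_gt0.
  have /cvgrPdist_lt /(_ _ e2) /nbhs_ballP[r /= r0 Br] := cg x.
  near=> x' i => y xy.
  have bx : `|g x - g x'| < e / 2.
    apply: Br; rewrite /ball/=; near: x'; apply: nbhsx_ballx.
    by [].
  have by_ : `|g x - g y| < e / 2.
    apply: Br; rewrite /ball/=.
    have h1 : `|x - x'| < r / 2.
      by near: x'; apply: nbhsx_ballx; rewrite divr_gt0.
    have h2 : i < r / 2 by near: i; apply: nbhs_right_lt; rewrite divr_gt0.
    rewrite (_ : x - y = (x - x') + (x' - y)); last by lra.
    by apply: (le_lt_trans (ler_normD _ _)); rewrite [r]splitr ltrD// (le_lt_trans xy).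
  rewrite (_ : g x' - g y = (g x' - g x) + (g x - g y)); last by lra.
  apply: (le_trans (ler_normD _ _)); rewrite distrC [e]splitr.
  by apply: lerD; exact: ltW.
move=> /(_ _ step) [d /= d0 Hd].
exists (d / 2) => [|x y Kx xy]; first by rewrite divr_gt0.
apply: (Hd (d / 2)) => //=; last by rewrite divr_gt0.
by rewrite sub0r normrN gtr0_norm ?divr_gt0// ltr_pdivrMr// mulr_natr mulr2n ltrDl.
Unshelve. all: by end_near.
Qed.

Lemma probability_inhabited d (T : measurableType d) (R : realType) (P : probability T R) :
  exists w : T, True.
Proof.
apply: contrapT => no; have := probability_setT P.
rewrite (_ : setT = set0) ?measure0; last by apply/seteqP; split=> w // _; apply: no; exists w.
by move=> /eqP; rewrite eq_sym onee_eq0.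
Qed.

Section slutsky.
Context d (Om : measurableType d) (R : realType) (P : probability Om R).

Lemma bounded_integrable (f : Om -> R) (M : R) :
  measurable_fun setT f -> (forall w, `|f w| <= M) -> P.-integrable setT (EFin \o f).
Proof.
move=> mf fM; apply: measurable_bounded_integrable => //.
  by rewrite fin_num_fun_lty//; exact: fin_num_measure.
by exists M; split; [exact: num_real|move=> x Mx w _; exact/(le_trans (fM w))/ltW].
Qed.

Lemma Rintegral_indic_prob (A : set Om) : measurable A ->
  \int[P]_w \1_A w = fine (P A).
Proof. by move=> mA; rewrite /Rintegral integral_indic// setIT. Qed.

Lemma Rintegral_cst_prob (r : R) : \int[P]_w r = r.
Proof. by rewrite /Rintegral integral_cst//=; have := probability_setT P; move=> /= ->; rewrite mule1. Qed.

Definition tight (W : nat -> Om -> R) : Prop :=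
  forall e : R, 0 < e -> exists L : R, \forall N \near \oo,
    (P [set w | (L < `|W N w|)%R] <= e%:E)%E.

Lemma measurable_gt_norm (X : Om -> R) (e : R) : measurable_fun setT X ->
  measurable [set w | e < `|X w|].
Proof.
move=> mX.
rewrite (_ : [set w | _] = setT `&` (fun w => `|X w|) @^-1` `]e, +oo[).
  exact: (measurableT_comp (@normr_measurable R _) mX).
by rewrite setTI; apply/seteqP; split=> w /=; rewrite in_itv/= andbT.
Qed.

(** Outside the events where |W| is large or |X - W| is not small, which have small
    probability, uniform continuity of [g] on a compact interval makes the integrands close;
    on these events the difference is at most twice the bound of [g]. *)
Lemma slutsky (W X : nat -> Om -> R) (g : R -> R) (M : R) :
  (forall N, (0 < N)%N -> measurable_fun setT (W N)) ->
  (forall N, (0 < N)%N -> measurable_fun setT (X N)) ->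
  tight W -> cvg_in_probability0 P (fun N w => X N w - W N w) ->
  continuous g -> (forall x, `|g x| <= M) ->
  (fun N => \int[P]_w g (X N w) - \int[P]_w g (W N w)) @ \oo --> 0.
Proof.
move=> mW mX tW cX cg gM.
have M0 : 0 <= M by rewrite (le_trans _ (gM 0)).
apply/cvgr0Pnorm_le => e e0.
(* two exceptional events, each costing 2 M times its probability *)
pose e1 := e / (1 + 4 * M).
have e10 : 0 < e1 by rewrite divr_gt0// ltr_pwDl// mulr_ge0.
have [L tL] := tW _ e10.
have [dl dl0 ug] := compact_uniform_continuity cg (@segment_compact _ (- L) L) e10.
have cXd : \forall N \near \oo, (P [set w | (dl < `|X N w - W N w|)%R] <= e1%:E)%E.
  have /fine_cvgP[fX] := cX _ dl0.
  move=> /cvgr_le /(_ e1) /= cc; have {}cc := cc e10.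
  near=> N; rewrite -(@fineK _ (P _)) ?lee_fin; last by near: N.
  by near: N.
near=> N.
have N0 : (0 < N)%N by near: N; exists 1%N.
have PA : (P [set w | (L < `|W N w|)%R] <= e1%:E)%E by near: N.
have PB : (P [set w | (dl < `|X N w - W N w|)%R] <= e1%:E)%E by near: N.
have mXN := mX _ N0; have mWN := mW _ N0.
have mgX : measurable_fun setT (fun w => g (X N w)).
  exact: measurableT_comp (continuous_measurable_fun cg) mXN.
have mgW : measurable_fun setT (fun w => g (W N w)).
  exact: measurableT_comp (continuous_measurable_fun cg) mWN.
pose A := [set w | L < `|W N w|]; pose B := [set w | dl < `|X N w - W N w|].
have mA : measurable A by exact: measurable_gt_norm.
have mB : measurable B by apply: measurable_gt_norm; exact: measurable_funB.
have igX := bounded_integrable mgX (fun w => gM (X N w)).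
have igW := bounded_integrable mgW (fun w => gM (W N w)).
rewrite -RintegralB//.
have iB : P.-integrable setT (EFin \o (fun w => g (X N w) - g (W N w))).
  exact: (integrableB measurableT igX igW).
apply: (le_trans (le_normr_Rintegral _ iB)) => //.
pose h w : R := e1 + (2 * M * \1_A w + 2 * M * \1_B w).
have mh : measurable_fun setT h.
  by do 2 apply: measurable_funD => //; apply: measurable_funM.
have i1 (C : set Om) : measurable C -> P.-integrable setT (EFin \o (fun w => 2 * M * \1_C w)).
  move=> mC; apply: (@bounded_integrable _ (2 * M)); first exact: measurable_funM.
  move=> w; rewrite indicE; case: (_ \in _); rewrite ?mulr1 ?mulr0 ?normr0 ?mulr_ge0//.
  by rewrite ger0_norm// mulr_ge0.
have i0 (C : set Om) : measurable C -> P.-integrable setT (EFin \o (\1_C : Om -> R)).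
  move=> mC; apply: (@bounded_integrable _ 1) => // w.
  by rewrite indicE; case: (_ \in _); rewrite ?normr0 ?normr1.
have ie1 : P.-integrable setT (EFin \o (fun=> e1)).
  by apply: (@bounded_integrable _ e1) => // w; rewrite gtr0_norm.
have i2 : P.-integrable setT (EFin \o (fun w => 2 * M * \1_A w + 2 * M * \1_B w)).
  exact: (integrableD measurableT (i1 _ mA) (i1 _ mB)).
have ih : P.-integrable setT (EFin \o h) by exact: (integrableD measurableT ie1 i2).
apply: (@le_trans _ _ (\int[P]_w h w)).
  apply: le_Rintegral => //; first exact: integrable_norm.
  move=> w _; rewrite /h !indicE.
  have dM : `|g (X N w) - g (W N w)| <= 2 * M.
    by rewrite mulr_natl mulr2n (le_trans (ler_normB _ _))// lerD.
  have [Aw|nAw] := boolP (w \in A).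
    have : 0 <= 2 * M * (w \in B)%:R by rewrite !mulr_ge0.
    rewrite (_ : true%:R = 1 :> R)//.
    by move: (ltW e10) dM; lra.
  rewrite (_ : false%:R = 0 :> R)//.
  have [Bw|nBw] := boolP (w \in B).
    rewrite (_ : true%:R = 1 :> R)//.
    by move: (ltW e10) dM; lra.
  rewrite (_ : false%:R = 0 :> R)// !mulr0 !addr0 distrC; apply: ug.
    by move: nAw; rewrite notin_setE /A/= in_itv/= -ler_norml => /negP; rewrite -leNgt.
  by move: nBw; rewrite notin_setE /B/= distrC => /negP; rewrite -leNgt.
rewrite RintegralD// Rintegral_cst_prob RintegralD ?i1// !RintegralZl ?i0//.
rewrite !Rintegral_indic_prob//. 
have fA : fine (P A) <= e1 by rewrite -lee_fin fineK// fin_num_measure.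
have fB : fine (P B) <= e1 by rewrite -lee_fin fineK// fin_num_measure.
rewrite (@le_trans _ _ (e1 + (2 * M * e1 + 2 * M * e1)))//.
  by rewrite lerD2l lerD// ler_wpM2l ?mulr_ge0.
rewrite (_ : e1 + _ = e1 * (1 + 4 * M)); last by lra.
by rewrite /e1 divfK// gt_eqF// ltr_pwDl// mulr_ge0.
Unshelve. all: by end_near.
Qed.

Lemma cvg_in_probability0D (A B : nat -> Om -> R) :
  (forall N, (0 < N)%N -> measurable_fun setT (A N)) ->
  (forall N, (0 < N)%N -> measurable_fun setT (B N)) ->
  cvg_in_probability0 P A -> cvg_in_probability0 P B ->
  cvg_in_probability0 P (fun N w => A N w + B N w).
Proof.
move=> mA mB cA cB e e0.
have e2 : 0 < e / 2 by rewrite divr_gt0.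
have cAB : (fun N => P [set w | (e / 2 < `|A N w|)%R] + P [set w | (e / 2 < `|B N w|)%R])%E @ \oo --> 0%E.
  by rewrite -[X in _ --> X]adde0; apply: cvgeD => //; [exact: cA|exact: cB].
apply: (@squeeze_cvge _ _ _ _ (cst 0%E) _ _ _ _ (cvg_cst _) cAB).
near=> N; rewrite measure_ge0/=.
have N0 : (0 < N)%N by near: N; exists 1%N.
have m1 := measurable_gt_norm (e / 2) (mA _ N0).
have m2 := measurable_gt_norm (e / 2) (mB _ N0).
have m3 := measurable_gt_norm e (measurable_funD (mA _ N0) (mB _ N0)).
apply: (le_trans _ (measureU2 _ _ _)) => //.
apply: le_measure; rewrite ?inE//; first exact: measurableU.
move=> w /= AB; have [|nA] := ltP (e / 2) `|A N w|; [by left|right => /=].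
by have := ler_normD (A N w) (B N w); lra.
Unshelve. all: by end_near.
Qed.

(** Dominated convergence for the indicators of the events |Q| > e. *)
Lemma ae_cvg_in_probability (Q : nat -> Om -> R) :
  (forall N, (0 < N)%N -> measurable_fun setT (Q N)) ->
  {ae P, forall w, Q ^~ w @ \oo --> 0} -> cvg_in_probability0 P Q.
Proof.
move=> mQ aQ e e0.
pose f N w : \bar R := (\1_[set w | e < `|Q N.+1 w|] w)%:E.
have mf N : measurable_fun setT (f N).
  apply/measurable_EFinP; apply: measurable_indic; apply: measurable_gt_norm.
  exact: mQ.
have [] := @dominated_convergence _ _ _ P setT measurableT f (cst 0%E) (cst 1%E) mf.
- exact: measurable_cst.
- apply: filterS aQ => w Qw _.
  apply: cvg_near_cst; move/cvgr0Pnorm_le : Qw => /(_ _ e0) Qw.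
  have : \forall N \near \oo, `|Q N.+1 w| <= e 
    by case: Qw => k _ Qk; exists k => // N /= kN; apply: Qk; exact: leqW.
  apply: filterS => N QN; rewrite /f indicE memNset//=.
  by apply/negP; rewrite -leNgt.
- exact: finite_measure_integrable_cst.
- by apply: nearW => w N _; rewrite /f gee0_abs ?lee_fin indicE; case: (_ \in _); rewrite ?ler01 ?lexx.
move=> _ _; rewrite integral0 => cf.
rewrite -(cvg_shiftS _).
apply: cvg_trans cf; apply: near_eq_cvg; near=> N.
rewrite /= /f integral_indic ?setIT//; apply: measurable_gt_norm; exact: mQ.
Unshelve. all: by end_near.
Qed.

(** If |B| > e then |T| is large or |Q| exceeds a fixed positive threshold. *)
Lemma tight_mul_cvg_in_probability (Q T : nat -> Om -> R) (B : nat -> Om -> R) :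
  (forall N, (0 < N)%N -> measurable_fun setT (Q N)) ->
  (forall N, (0 < N)%N -> measurable_fun setT (T N)) ->
  (forall N, (0 < N)%N -> measurable_fun setT (B N)) ->
  (forall N w, `|B N w| <= `|Q N w| * `|T N w|) ->
  cvg_in_probability0 P Q -> tight T -> cvg_in_probability0 P B.
Proof.
move=> mQ mT mB BQT cQ tT e e0.
apply/fine_cvgP; split.
  by exists 1%N => // N N0; apply: fin_num_measure; apply: measurable_gt_norm; exact: mB.
apply/cvgr0Pnorm_le => r r0.
have r2 : 0 < r / 2 by rewrite divr_gt0.
have [L tL] := tT _ r2.
have L1 : 0 < `|L| + 1 by rewrite ltr_wpDl.
have eL : 0 < e / (`|L| + 1) by rewrite divr_gt0.
have /fine_cvgP[_ /cvgr0Pnorm_le /(_ _ r2) cq] := cQ _ eL.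
near=> N.
have N0 : (0 < N)%N by near: N; exists 1%N.
have cqN : `|fine (P [set w | e / (`|L| + 1) < `|Q N w|])| <= r / 2 by near: N.
have tLN : (P [set w | (L < `|T N w|)%R] <= (r / 2)%:E)%E by near: N.
have m1 := measurable_gt_norm L (mT _ N0).
have m2 := measurable_gt_norm (e / (`|L| + 1)) (mQ _ N0).
have m3 := measurable_gt_norm e (mB _ N0).
rewrite /= ger0_norm ?fine_ge0// -lee_fin fineK ?fin_num_measure//.
apply: (@le_trans _ _ (P ([set w | (L < `|T N w|)%R] `|` [set w | (e / (`|L| + 1) < `|Q N w|)%R]))).
  apply: le_measure; rewrite ?inE//; first exact: measurableU.
  move=> w /= eB; have [|nT] := ltP L `|T N w|; [by left|right => /=].
  rewrite ltr_pdivrMr//; apply: (lt_le_trans eB); apply: (le_trans (BQT _ _)).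
  by rewrite ler_wpM2l// (le_trans nT)// (le_trans (ler_norm _))// lerDl.
apply: (le_trans (measureU2 _ _ _)) => //.
rewrite [r]splitr EFinD leeD//.
have ff := fin_num_measure P _ m2.
by rewrite -(fineK ff) lee_fin (le_trans (ler_norm _)).
Unshelve. all: by end_near.
Qed.
End slutsky.

(** * Means of nearly affine functions under a nearly normal density *)

Lemma integrableZl_EFin d (T : measurableType d) (R : realType)
    (mu : {measure set T -> \bar R}) (D : set T) (c : R) (h : T -> R) :
  measurable D -> mu.-integrable D (EFin \o h) ->
  mu.-integrable D (EFin \o (fun x => c * h x)).
Proof. by move=> mD ih; exact: (integrableZl mD c ih). Qed.

Section moments.
Variables (R : realType) (s : nat).
Local Notation mu := (lebesgue_rV R s).
Implicit Types (x y g : 'rV[R]_s).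

Definition sqnorm x : R := \sum_i x 0 i ^+ 2.

Lemma sqnorm_ge0 x : 0 <= sqnorm x.
Proof. by apply: sumr_ge0 => i _; exact: sqr_ge0. Qed.

Lemma euclid_norm_sqr x : euclid_norm x ^+ 2 = sqnorm x.
Proof. by rewrite sqr_sqrtr// sqnorm_ge0. Qed.

Lemma sqnormD_le x y : sqnorm (x + y) <= 2 * sqnorm x + 2 * sqnorm y.
Proof.
rewrite /sqnorm !mulr_sumr -big_split/=; apply: ler_sum => i _; rewrite !mxE.
by have := sqr_ge0 (x 0 i - y 0 i); lra.
Qed.

Lemma sqr_coord_le x i : x 0 i ^+ 2 <= sqnorm x.
Proof.
by rewrite /sqnorm (bigD1 i)//= lerDl; apply: sumr_ge0 => j _; exact: sqr_ge0.
Qed.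

Lemma norm_coord_le x i : `|x 0 i| <= 1 + sqnorm x.
Proof.
have := sqr_coord_le x i; rewrite -real_normK ?num_real//.
by have := sqr_ge0 (`|x 0 i| - 1); have := normr_ge0 (x 0 i); nra.
Qed.

Lemma euclid_norm_le x : euclid_norm x <= 1 + sqnorm x.
Proof.
rewrite -euclid_norm_sqr; have := sqr_ge0 (euclid_norm x - 1).
by have := sqrtr_ge0 (sqnorm x); rewrite -/(euclid_norm x); nra.
Qed.

Lemma norm_linear_le g x : `|(x *m g^T) 0 0| <= (\sum_i `|g 0 i|) * (1 + sqnorm x).
Proof.
rewrite mxE mulr_suml (le_trans (ler_norm_sum _ _ _))// ler_sum// => i _.
by rewrite mxE normrM mulrC ler_wpM2l// norm_coord_le.
Qed.

Lemma measurable_sqnorm : measurable_fun setT sqnorm.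
Proof.
apply: measurable_sum => i; apply: measurable_funX; exact: measurable_coord.
Qed.

(** True also when the integral is infinite, since the real-valued integral is then 0 on both
    sides. *)
Lemma Rintegral_rV_affine (b : 'rV[R]_s) (r : R) (F : 'rV[R]_s -> R) : r != 0 ->
  measurable_fun setT F ->
  \int[mu]_x F x = `|r| ^+ s * \int[mu]_x F (b + r *: x).
Proof.
move=> r0 mF; rewrite /Rintegral [in LHS]integralE [in RHS]integralE.
have mF' : measurable_fun setT (fun x => (F x)%:E) by exact/measurable_EFinP.
rewrite (@ge0_integral_rV_affine _ _ b r)//; last exact: measurable_funepos.
rewrite (@ge0_integral_rV_affine _ _ b r (fun x => ((fun y => (F y)%:E)^\- x)%E))//; last exact: measurable_funeneg.
have -> : ((fun x => (F (b + r *: x))%:E)^\+ = fun x => (fun y => (F y)%:E)^\+ (b + r *: x)%R)%E.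
  by apply/funext => x; rewrite !funeposE.
have -> : ((fun x => (F (b + r *: x))%:E)^\- = fun x => (fun y => (F y)%:E)^\- (b + r *: x)%R)%E.
  by apply/funext => x; rewrite !funenegE.
have rp : 0 < `|r| ^+ s by rewrite exprn_gt0// normr_gt0.
rewrite -EFin_expe.
set A := integral _ _ _; set B := integral _ _ _.
have : (0 <= A)%E by apply: integral_ge0.
have : (0 <= B)%E by apply: integral_ge0.
case: A => [a| |]; case: B => [c| |]//= c0 a0.
- by rewrite -mulrBr.
- by rewrite gt0_muley ?lte_fin//= mulr0.
- by rewrite gt0_muley ?lte_fin//= mulr0.
- by rewrite gt0_muley ?lte_fin//= mulr0.
Qed.

Variable Sigma : 'M[R]_s.
Local Notation phi := (normal_density Sigma).

Lemma measurable_linear_mul g (k : 'rV[R]_s -> R) : measurable_fun setT k ->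
  measurable_fun setT (fun x => (x *m g^T) 0 0 * k x).
Proof. by move=> mk; apply: measurable_funM => //; exact: measurable_rV_linear. Qed.

Lemma integrable_moment_dominated (k h : 'rV[R]_s -> R) (C : R) :
  measurable_fun setT h -> 0 <= C ->
  (forall x, `|h x| <= C * ((1 + sqnorm x) * k x)) ->
  mu.-integrable setT (EFin \o (fun x => (1 + sqnorm x) * k x)) ->
  mu.-integrable setT (EFin \o h).
Proof.
move=> mh C0 hk ik.
apply: (le_integrable measurableT _ _ (integrableZl measurableT C ik)).
  exact/measurable_EFinP.
move=> x _ /=; rewrite lee_fin (le_trans (hk x))//.
exact: ler_norm.
Qed.

(** The density is even and the integrand odd; the moment hypothesis makes the integral
    converge. *)
Lemma Rintegral_normal_linear g :
  mu.-integrable setT (EFin \o (fun x => (1 + sqnorm x) * phi x)) ->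
  \int[mu]_x ((x *m g^T) 0 0 * phi x) = 0.
Proof.
move=> i2.
have mf := measurable_linear_mul g (measurable_normal_density Sigma).
have := @Rintegral_rV_affine 0 (-1) (fun x => (x *m g^T) 0 0 * phi x).
rewrite oppr_eq0 oner_eq0 => /(_ isT mf).
rewrite normrN1 expr1n mul1r.
under [X in _ = X -> _]eq_Rintegral do rewrite add0r scaleN1r normal_densityN mulNmx mxE -mulN1r -mulrA.
rewrite RintegralZl//; first by lra.
apply: (@integrable_moment_dominated phi _ (\sum_i `|g 0 i|)) => //.
  by apply: sumr_ge0.
move=> x; rewrite normrM mulrA (ger0_norm (normal_density_ge0 _ _)).
by rewrite ler_wpM2r ?normal_density_ge0// norm_linear_le.
Qed.

(** Here [k] plays the posterior density of the local parameter x, [u] the function to average in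
    that parameter and [r] the scale 1 / sqrt N.  The part of [u] linear in x averages to 0
    under [phi], so under [k] it contributes, after division by [r], at most [dl] times the
    coefficients of [g]; the remainder is then at most [e + C r] times the second moment of
    Y + x under [k], which is controlled by that of [phi] and by [dl]. *)
Lemma approximate_linear_mean (k u : 'rV[R]_s -> R) (u0 r e C dl m : R) (Y g : 'rV[R]_s) :
  0 < r -> 0 <= e -> 0 <= C ->
  measurable_fun setT k -> (forall x, 0 <= k x) -> \int[mu]_x k x = 1 ->
  mu.-integrable setT (EFin \o (fun x => (1 + sqnorm x) * phi x)) ->
  \int[mu]_x ((1 + sqnorm x) * phi x) <= m ->
  mu.-integrable setT (EFin \o (fun x => (1 + sqnorm x) * `|k x - phi x|)) ->
  \int[mu]_x ((1 + sqnorm x) * `|k x - phi x|) <= dl ->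
  measurable_fun setT (fun x => u x * k x) ->
  (forall x, k x != 0 -> `|u x - u0 - r * ((Y + x) *m g^T) 0 0| <=
     r * ((e + C * r) * (1 + sqnorm (Y + x)))) ->
  `|r^-1 * (\int[mu]_x (u x * k x) - u0) - (Y *m g^T) 0 0| <=
   (e + C * r) * (2 * (1 + sqnorm Y)) * (m + dl) + (\sum_i `|g 0 i|) * dl.
Proof.
move=> r0 e0 C0 mk k0 k1 iphi phim idl dlm muk Hu.
have mphi := measurable_normal_density Sigma.
have phi0 := normal_density_ge0 Sigma.
have q0 := sqnorm_ge0.
have ms : measurable_fun setT (fun x => 1 + sqnorm x).
  by apply: measurable_funD => //; exact: measurable_sqnorm.
have w0 x : 0 <= 1 + sqnorm x by rewrite addr_ge0.
have mw : measurable_fun setT (fun x => (1 + sqnorm x) * k x) by exact: measurable_funM.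
have kle x : (1 + sqnorm x) * k x <=
    (1 + sqnorm x) * phi x + (1 + sqnorm x) * `|k x - phi x|.
  by rewrite -mulrDr ler_wpM2l// -lerBlDl ler_norm.
have isum := integrableD measurableT iphi idl.
have ik : mu.-integrable setT (EFin \o (fun x => (1 + sqnorm x) * k x)).
  apply: (le_integrable measurableT _ _ isum); first exact/measurable_EFinP.
  move=> x _ /=; rewrite lee_fin ger0_norm ?mulr_ge0//.
  by rewrite (le_trans (kle x))// ler_norm.
have Ik : \int[mu]_x ((1 + sqnorm x) * k x) <= m + dl.
  apply: (le_trans _ (lerD phim dlm)); rewrite -RintegralD//.
  by apply: le_Rintegral => // x _; exact: kle.
have lin (h : 'rV[R]_s -> R) : measurable_fun setT h -> (forall x, `|h x| <= k x) -> mu.-integrable setT (EFin \o h).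
  move=> mh hk; apply: (@integrable_moment_dominated k _ 1) => // x.
  by rewrite mul1r (le_trans (hk x))// ler_peMl// lerDl.
have ikk : mu.-integrable setT (EFin \o k).
  by apply: lin => // x; rewrite ger0_norm.
pose G := \sum_i `|g 0 i|.
have G0 : 0 <= G by apply: sumr_ge0.
have il : mu.-integrable setT (EFin \o (fun x => (x *m g^T) 0 0 * k x)).
  apply: (@integrable_moment_dominated k _ G) => //; first exact: measurable_linear_mul.
  by move=> x; rewrite normrM mulrA (ger0_norm (k0 x)) ler_wpM2r// norm_linear_le.
pose D x := u x * k x - (u0 + r * (Y *m g^T) 0 0) * k x - r * ((x *m g^T) 0 0 * k x).
have mD : measurable_fun setT D.
  apply: measurable_funB; first by apply: measurable_funB => //; exact: measurable_funM.
  by apply: measurable_funM => //; exact: measurable_linear_mul.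
have DE x : `|D x| <= r * ((e + C * r) * (2 * (1 + sqnorm Y))) * ((1 + sqnorm x) * k x).
  have -> : D x = (u x - u0 - r * ((Y + x) *m g^T) 0 0) * k x.
    have -> : ((Y + x) *m g^T) 0 0 = (Y *m g^T) 0 0 + (x *m g^T) 0 0.
      by rewrite mulmxDl mxE.
    by rewrite /D; ring.
  have [->|kx] := eqVneq (k x) 0; first by rewrite !mulr0 normr0.
  rewrite normrM (ger0_norm (k0 x)) mulrA ler_wpM2r// (le_trans (Hu x kx))//.
  rewrite -!mulrA ler_wpM2l//; first exact: ltW.
  rewrite ler_wpM2l//; first by rewrite addr_ge0// mulr_ge0// ltW.
  have := sqnormD_le Y x; have := mulr_ge0 (q0 Y) (q0 x); have := q0 x; have := q0 Y.
  nra.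
have K0 : 0 <= r * ((e + C * r) * (2 * (1 + sqnorm Y))).
  by rewrite !mulr_ge0 ?addr_ge0 ?mulr_ge0// ltW.
have iD : mu.-integrable setT (EFin \o D).
  exact: (@integrable_moment_dominated k _ _ mD K0 DE).
have ic : mu.-integrable setT (EFin \o (fun x => (u0 + r * (Y *m g^T) 0 0) * k x)).
  exact: integrableZl_EFin.
have irl : mu.-integrable setT (EFin \o (fun x => r * ((x *m g^T) 0 0 * k x))).
  exact: integrableZl_EFin.
have iDc := integrableD measurableT iD ic.
have -> : \int[mu]_x (u x * k x) = \int[mu]_x D x + (u0 + r * (Y *m g^T) 0 0)
    + r * \int[mu]_x ((x *m g^T) 0 0 * k x).
  rewrite -RintegralZl// -[X in _ + X + _]mulr1 -k1 -RintegralZl// -RintegralD// -RintegralD//.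
  by apply: eq_Rintegral => x _; rewrite /D; lra.
have -> : \int[mu]_x ((x *m g^T) 0 0 * k x) = \int[mu]_x ((x *m g^T) 0 0 * (k x - phi x)).
  have ip : mu.-integrable setT (EFin \o (fun x => (x *m g^T) 0 0 * phi x)).
    apply: (@integrable_moment_dominated phi _ G) => //; first exact: measurable_linear_mul.
    by move=> x; rewrite normrM mulrA (ger0_norm (phi0 x)) ler_wpM2r// norm_linear_le.
  under [RHS]eq_Rintegral do rewrite mulrBr.
  by rewrite RintegralB// Rintegral_normal_linear// subr0.
set J := \int[mu]_x (_ * (k x - phi x)).
have J1 : `|J| <= G * dl.
  have mJ : measurable_fun setT (fun x => (x *m g^T) 0 0 * (k x - phi x)).
    by apply: measurable_linear_mul; exact: measurable_funB.
  have bJ x : `|(x *m g^T) 0 0 * (k x - phi x)| <= G * ((1 + sqnorm x) * `|k x - phi x|).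
    by rewrite normrM mulrA ler_wpM2r// norm_linear_le.
  have iJ := integrable_moment_dominated mJ G0 bJ idl.
  apply: (le_trans (le_normr_Rintegral _ iJ)) => //.
  apply: (le_trans _ (ler_wpM2l G0 dlm)); rewrite -RintegralZl//.
  apply: le_Rintegral => //; first exact: integrable_norm.
  exact: integrableZl_EFin.
have D1 : `|\int[mu]_x D x| <= r * ((e + C * r) * (2 * (1 + sqnorm Y))) * (m + dl).
  apply: (le_trans (le_normr_Rintegral _ iD)) => //.
  apply: (le_trans _ (ler_wpM2l K0 Ik)); rewrite -RintegralZl//.
  apply: le_Rintegral => //; first exact: integrable_norm.
  exact: integrableZl_EFin.
rewrite (_ : _ - _ = r^-1 * \int[mu]_x D x + J); last by field; rewrite gt_eqF.
rewrite (le_trans (ler_normD _ _))// lerD//.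
rewrite normrM gtr0_norm ?invr_gt0// ler_pdivrMl//.
by move: D1; rewrite !mulrA.
Qed.

End moments.

(** * Expansion of the posterior mean *)

Section local_expansion.
Variables (R : realType) (s : nat) (Sigma : 'M[R]_s).
Local Notation mu := (lebesgue_rV R s).
Local Notation phi := (normal_density Sigma).
Implicit Types (x y g th : 'rV[R]_s).

Lemma sqnormZ (r : R) x : sqnorm (r *: x) = r ^+ 2 * sqnorm x.
Proof.
by rewrite /sqnorm mulr_sumr; apply: eq_bigr => i _; rewrite mxE exprMn.
Qed.

Lemma euclid_normZ (r : R) x : 0 <= r -> euclid_norm (r *: x) = r * euclid_norm x.
Proof.
move=> r0; rewrite /euclid_norm -!/(sqnorm _) sqnormZ sqrtrM ?sqr_ge0//.
by rewrite sqrtr_sqr ger0_norm.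
Qed.

(** The density of the local parameter tau when th + r tau has density [rho]. *)
Definition rescaled (rho : 'rV[R]_s -> R) th (r : R) (tau : 'rV[R]_s) : R :=
  r ^+ s * rho (th + r *: tau).

Lemma measurable_rescaled rho th r : measurable_fun setT rho ->
  measurable_fun setT (rescaled rho th r).
Proof.
move=> mrho; apply: measurable_funM => //.
exact: measurableT_comp mrho (measurable_rV_affine _ _).
Qed.

(** Both sides are 0 when the integral is infinite. *)
Lemma Rintegral_rescaled rho th r : 0 < r -> measurable_fun setT rho ->
  \int[mu]_x rescaled rho th r x = \int[mu]_x rho x.
Proof.
move=> r0 mrho; rewrite [RHS](@Rintegral_rV_affine _ _ th r) ?gt_eqF//.
have mr := measurableT_comp mrho (measurable_rV_affine th r).
rewrite gtr0_norm// /rescaled /Rintegral.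
have rs : 0 < r ^+ s by exact: exprn_gt0.
set E := (\int[mu]_x (rho (th + r *: x))%:E)%E.
rewrite (_ : (\int[mu]_x _)%E = (r ^+ s)%:E * E)%E; last first.
  rewrite /E [in LHS]integralE [in RHS]integralE.
  have mE : measurable_fun setT (fun x => (rho (th + r *: x))%:E) by exact/measurable_EFinP.
  have -> : ((fun x => (r ^+ s * rho (th + r *: x))%:E)^\+ =
      fun x => (r ^+ s)%:E * (fun x => (rho (th + r *: x))%:E)^\+ x)%E.
    by apply/funext => x; rewrite !funeposE maxeMr ?lee_fin ?ltW// mule0 -EFinM.
  have -> : ((fun x => (r ^+ s * rho (th + r *: x))%:E)^\- =
      fun x => (r ^+ s)%:E * (fun x => (rho (th + r *: x))%:E)^\- x)%E.
    by apply/funext => x; rewrite !funenegE maxeMr ?lee_fin ?ltW// mule0 muleN -EFinM.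
  rewrite ge0_integralZl//; last 2 first.
  - exact: measurable_funepos.
  - by rewrite lee_fin ltW.
  rewrite ge0_integralZl//; last 2 first.
  - exact: measurable_funeneg.
  - by rewrite lee_fin ltW.
  set A := (\int[mu]_x _)%E; set B := (\int[mu]_x _)%E.
  have : (0 <= A)%E by apply: integral_ge0.
  have : (0 <= B)%E by apply: integral_ge0.
  case: A => [a| |]; case: B => [c| |]//= c0 a0.
  - by rewrite -!EFinM -!EFinB mulrBr.
  - by rewrite gt0_muley ?lte_fin//= gt0_muleNy ?lte_fin//.
  - by rewrite gt0_muley ?lte_fin//= gt0_muley ?lte_fin//.
  - by rewrite gt0_muley ?lte_fin//= gt0_muleNy ?lte_fin//.
case: E => [a| |]//=.
- by rewrite gt0_muley ?lte_fin//= mulr0.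
- by rewrite gt0_muleNy ?lte_fin//= mulr0.
Qed.

Hypothesis mass1 : (\int[mu]_x (phi x)%:E = 1)%E.

(** The weighted distance to a boundedly supported density is finite, and such a density has
    all moments, so the normal density has a second moment.  This avoids computing Gaussian
    moments for a matrix not known to be positive definite. *)
Lemma normal_second_moment (k : 'rV[R]_s -> R) (B : R) :
  measurable_fun setT k -> (forall x, 0 <= k x) -> mu.-integrable setT (EFin \o k) ->
  (forall x, k x != 0 -> sqnorm x <= B) ->
  (\int[mu]_x ((1 + sqnorm x) * `|k x - phi x|)%:E < +oo)%E ->
  mu.-integrable setT (EFin \o (fun x => (1 + sqnorm x) * phi x)).
Proof.
move=> mk k0 ik kB fin.
have mphi := measurable_normal_density Sigma.
have phi0 := normal_density_ge0 Sigma.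
have q0 := @sqnorm_ge0 R s.
have ms : measurable_fun setT (fun x => 1 + sqnorm x).
  by apply: measurable_funD => //; exact: measurable_sqnorm.
have id : mu.-integrable setT (EFin \o (fun x => (1 + sqnorm x) * `|k x - phi x|)).
  apply/integrableP; split.
    apply/measurable_EFinP; apply: measurable_funM => //.
    by apply: measurableT_comp => //; exact: measurable_funB.
  under eq_integral do rewrite /= ger0_norm ?mulr_ge0 ?addr_ge0//.
  exact: fin.
have ik' := integrableZl_EFin (1 + B) measurableT ik.
have isum := integrableD measurableT ik' id.
apply: (le_integrable measurableT _ _ isum).
  by apply/measurable_EFinP; exact: measurable_funM.
move=> x _ /=; rewrite lee_fin ger0_norm ?mulr_ge0 ?addr_ge0//.
apply: (le_trans _ (ler_norm _)).
have kx : (1 + sqnorm x) * k x <= (1 + B) * k x.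
  have [->|kx] := eqVneq (k x) 0; first by rewrite !mulr0.
  by rewrite ler_wpM2r// lerD2l kB.
apply: (le_trans _ (lerD kx (lexx _))); rewrite -mulrDr ler_wpM2l ?addr_ge0//.
by rewrite -lerBlDl distrC ler_norm.
Qed.

Variables (rho : nat -> 'rV[R]_s -> R) (th : nat -> 'rV[R]_s).
Variables (v : 'rV[R]_s -> R) (g ths : 'rV[R]_s) (Theta : set 'rV[R]_s).
Let r N : R := (Num.sqrt N%:R)^-1.
Let Y N : 'rV[R]_s := Num.sqrt N%:R *: (th N - ths).

(** A density close to [phi] in weighted L^1 cannot be the zero function, so the normalised
    alternative holds for large N and [approximate_linear_mean] applies at scale 1 / sqrt N.
    The quadratic term [C] of the expansion is multiplied by this scale and disappears, and the
    linear error [e] can be chosen small first. *)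
Lemma posterior_mean_expansion :
  (forall N, measurable_fun setT (rho N)) -> (forall N x, 0 <= rho N x) ->
  (forall N, (rho N = cst 0) \/ (\int[mu]_x rho N x = 1)) ->
  (forall N x, rho N x != 0 -> Theta x) ->
  (forall N, measurable_fun setT (fun x => v x * rho N x)) ->
  (forall e, 0 < e -> exists2 C, 0 <= C & forall x, Theta x ->
     `|v x - v ths - ((x - ths) *m g^T) 0 0| <=
     e * euclid_norm (x - ths) + C * euclid_norm (x - ths) ^+ 2) ->
  mu.-integrable setT (EFin \o (fun x => (1 + sqnorm x) * phi x)) ->
  (fun N => \int[mu]_x ((1 + sqnorm x) * `|rescaled (rho N) (th N) (r N) x - phi x|)%:E)%E
    @ \oo --> 0%E ->
  forall e, 0 < e -> \forall N \near \oo,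
    `|Num.sqrt N%:R * (\int[mu]_x (v x * rho N x) - v ths) - (Y N *m g^T) 0 0|
      <= e * (1 + sqnorm (Y N)).
Proof.
move=> mrho rho0 rho01 suppT mv diffv iphi cvd e e0.
have mphi := measurable_normal_density Sigma.
have phi0 := normal_density_ge0 Sigma.
have q0 := @sqnorm_ge0 R s.
set m := \int[mu]_x ((1 + sqnorm x) * phi x).
have m0 : 0 <= m by apply: Rintegral_ge0 => x _; rewrite mulr_ge0 ?addr_ge0.
pose e1 := e / (8 * (m + 1)).
have m10 : 0 < 8 * (m + 1) by rewrite mulr_gt0// ltr_wpDl.
have e10 : 0 < e1 by rewrite divr_gt0.
have [C C0 HC] := diffv _ e10.
pose G := \sum_i `|g 0 i|.
have G0 : 0 <= G by apply: sumr_ge0.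
(* the bound 1 / 2 excludes the zero density, whose distance to phi is at least 1 *)
pose dl := Num.min (1 / 2) (e / (2 * (G + 1))).
have G10 : 0 < 2 * (G + 1) by rewrite mulr_gt0// ltr_wpDl.
have dl0 : 0 < dl by rewrite lt_min !divr_gt0.
have cr : \forall N \near \oo, C * r N <= e1.
  have [k _ kN] : \forall N \near \oo, ((C / e1) ^+ 2 <= N%:R :> R) by exact: nbhs_infty_ger.
  exists (maxn 1 k) => // N /=; rewrite geq_max => /andP[N1 /kN /= CN].
  rewrite ler_pdivrMr ?sqrtr_gt0 ?ltr0n// mulrC -ler_pdivrMr//.
  have h : 0 <= C / e1 by rewrite divr_ge0// ltW.
  by rewrite -(ger0_norm h) -sqrtr_sqr ler_wsqrtr.
have ds : \forall N \near \oo,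
   (\int[mu]_x ((1 + sqnorm x) * `|rescaled (rho N) (th N) (r N) x - phi x|)%:E < dl%:E)%E.
  have /fine_cvgP[fd /cvgr0Pnorm_lt /(_ _ dl0) fd2] := cvd.
  near=> N; rewrite -[ltLHS]fineK ?lte_fin; last by near: N.
  by apply: (le_lt_trans (ler_norm _)); near: N.
near=> N.
have N1 : (0 < N)%N by near: N; exists 1%N.
have crN : C * r N <= e1 by near: N.
have dsN : (\int[mu]_x ((1 + sqnorm x) * `|rescaled (rho N) (th N) (r N) x - phi x|)%:E < dl%:E)%E by near: N.
have sN : 0 < Num.sqrt N%:R :> R by rewrite sqrtr_gt0 ltr0n.
have r0 : 0 < r N by rewrite invr_gt0.
pose k := rescaled (rho N) (th N) (r N).
have mk : measurable_fun setT k by exact: measurable_rescaled.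
have k0 x : 0 <= k x by rewrite mulr_ge0// exprn_ge0// ltW.
have idl : mu.-integrable setT (EFin \o (fun x => (1 + sqnorm x) * `|k x - phi x|)).
  apply/integrableP; split.
    apply/measurable_EFinP; apply: measurable_funM.
      by apply: measurable_funD => //; exact: measurable_sqnorm.
    by apply: measurableT_comp => //; exact: measurable_funB.
  under eq_integral do rewrite /= ger0_norm ?mulr_ge0 ?addr_ge0//.
  by rewrite (lt_trans dsN)// ltry.
have dlm : \int[mu]_x ((1 + sqnorm x) * `|k x - phi x|) <= dl.
  rewrite -lee_fin /Rintegral fineK; first exact: ltW.
  exact: integrable_fin_num.
have k1 : \int[mu]_x k x = 1.
  rewrite Rintegral_rescaled//; have [rN|//] := rho01 N.
  have : (1 <= \int[mu]_x ((1 + sqnorm x) * `|k x - phi x|)%:E)%E.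
    rewrite -mass1; apply: ge0_le_integral => //.
    - by move=> x _; rewrite lee_fin.
    - exact/measurable_EFinP.
    - by case/integrableP : idl.
    - move=> x _; rewrite lee_fin /k /rescaled rN mulr0 sub0r normrN ger0_norm//.
      by rewrite ler_peMl// lerDl.
  move=> /le_lt_trans /(_ dsN); rewrite lte_fin lt_min => /andP[+ _].
  by lra.
have := @approximate_linear_mean R s Sigma k (fun x => v (th N + r N *: x)) (v ths) (r N) e1 C dl m (Y N) g.
have scal x : v (th N + r N *: x) * k x = rescaled (fun y => v y * rho N y) (th N) (r N) x.
  by rewrite /k /rescaled mulrCA.
have -> : \int[mu]_x (v (th N + r N *: x) * k x) = \int[mu]_x (v x * rho N x).
  by under eq_Rintegral do rewrite scal; rewrite Rintegral_rescaled.
move=> /(_ r0 (ltW e10) C0 mk k0 k1 iphi (lexx _) idl dlm).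
rewrite {1}/r invrK => aux.
apply: (le_trans (aux _ _)).
- by under eq_fun do rewrite scal; exact: measurable_rescaled.
- move=> x kx.
  have Tx : Theta (th N + r N *: x).
    by apply: (suppT N); apply: contra_neq kx => kx; rewrite /k /rescaled kx mulr0.
  have dE : th N + r N *: x - ths = r N *: (Y N + x).
    rewrite scalerDr /Y scalerA /r mulVf ?scale1r ?gt_eqF//.
    by rewrite addrAC.
  have := HC _ Tx; rewrite dE -scalemxAl mxE => /le_trans; apply.
  rewrite euclid_normZ ?(ltW r0)// exprMn euclid_norm_sqr.
  set z := Y N + x; have nz := euclid_norm_le z; have nz0 : 0 <= euclid_norm z by exact: sqrtr_ge0.
  rewrite mulrCA (_ : C * _ = r N * (C * r N * sqnorm z)); last by ring.
  rewrite -mulrDr ler_wpM2l ?(ltW r0)// mulrDl.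
  by rewrite lerD ?ler_wpM2l ?(ltW e10)// ?mulr_ge0 ?(ltW r0)// lerDr.
have h1 : (e1 + C * r N) * (m + dl) <= e / 4.
  have -> : e / 4 = (e1 + e1) * (m + 1).
    by rewrite /e1; field; rewrite gt_eqF// ltr_wpDl.
  apply: ler_pM.
  - exact: addr_ge0 (ltW e10) (mulr_ge0 C0 (ltW r0)).
  - exact: addr_ge0 m0 (ltW dl0).
  - by rewrite lerD2l.
  - by rewrite lerD2l /dl ge_min ler_pdivrMr// mul1r ler1n.
have h2 : G * dl <= e / 2.
  apply: (@le_trans _ _ ((G + 1) * (e / (2 * (G + 1))))).
    by rewrite ler_pM ?(ltW dl0)// ?lerDl// /dl ge_min lexx orbT.
  have G1 : G + 1 != 0 by rewrite gt_eqF// ltr_wpDl.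
  by rewrite (_ : (G + 1) * (e / (2 * (G + 1))) = e / 2)//; field.
have Yq := q0 (Y N); move: h1 h2; rewrite -/G.
set A := (e1 + C * r N); move=> h1 h2.
have h3 : A * (2 * (1 + sqnorm (Y N))) * (m + dl) <= (e / 2) * (1 + sqnorm (Y N)).
  rewrite (_ : A * _ * _ = (A * (m + dl)) * 2 * (1 + sqnorm (Y N))); last by ring.
  by rewrite ler_wpM2r ?addr_ge0//; lra.
have : 0 <= e / 2 * sqnorm (Y N) by rewrite mulr_ge0// divr_ge0// ltW.
lra.
Unshelve. all: by end_near.
Qed.

End local_expansion.

(** * Pointwise consequences of a bound on the score *)

Section directional.
Variables (R : realType) (s : nat).
Implicit Types (f : 'rV[R]_s -> R) (th v : 'rV[R]_s).

Lemma norm_le_euclid_norm v : `|v| <= euclid_norm v.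
Proof.
rewrite [leLHS]mx_normrE; apply: bigmax_le; first exact: sqrtr_ge0.
move=> [i j] _ /=; rewrite ord1 -sqrtr_sqr ler_wsqrtr//.
exact: sqr_coord_le.
Qed.

Lemma coord_le_euclid_norm v i : `|v 0 i| <= euclid_norm v.
Proof. by rewrite -sqrtr_sqr ler_wsqrtr// sqr_coord_le. Qed.

Lemma inner_le_euclid_norm v w :
  `|(v *m w^T) 0 0| <= s%:R * (euclid_norm v * euclid_norm w).
Proof.
rewrite mxE (le_trans (ler_norm_sum _ _ _))//.
apply: (@le_trans _ _ (\sum_(i < s) euclid_norm v * euclid_norm w)).
  by apply: ler_sum => i _; rewrite mxE normrM ler_pM// coord_le_euclid_norm.
by rewrite sumr_const card_ord mulr_natl.
Qed.

Lemma diff_gradient f th v : differentiable f th ->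
  'd f th v = (v *m (gradient f th)^T) 0 0.
Proof.
move=> df; rewrite {1}(row_sum_delta v) linear_sum/= mxE; apply: eq_bigr => i _.
by rewrite linearZ/= -deriveE// !mxE.
Qed.

Lemma gradient_ln f th : differentiable f th -> 0 < f th ->
  gradient (fun t => ln (f t)) th = (f th)^-1 *: gradient f th.
Proof.
move=> df f0; apply/rowP => j; rewrite !mxE.
have lnf := is_derive1_ln f0.
have dl : differentiable (@ln R) (f th).
  by apply/derivable1_diffP; apply: ex_derive; exact: lnf.
have dc : differentiable (@ln R \o f) th by exact: differentiable_comp.
rewrite (_ : (fun t => ln (f t)) = @ln R \o f)// deriveE// diff_comp//=.
rewrite diff1E// derive1E -deriveE//; have [_ ->] := lnf.
by rewrite mulrC.
Qed.

Lemma is_derive_line f th v (t : R) : differentiable f (th + t *: v) ->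
  is_derive t 1 (fun t => f (th + t *: v)) ('d f (th + t *: v) v).
Proof.
move=> df.
have E : (fun h : R => h^-1 *: ((f \o shift (th + t *: v)) (h *: v) - f (th + t *: v))) =
   (fun h => h^-1 *: (((fun t => f (th + t *: v)) \o shift t) (h *: (1 : R)) - f (th + t *: v))).
  apply/funext => h; congr (_ *: (f _ - _)).
  by rewrite /shift/= scalerDl [h *: 1]mulr1 addrCA.
have dv := @diff_derivable _ _ _ _ _ v df.
apply: DeriveDef.
  by move: dv; rewrite /derivable E.
by rewrite -deriveE// /derive E.
Qed.

Lemma mvt01 (p dp : R -> R) :
  (forall t : R, 0 <= t <= 1 -> is_derive t 1 p (dp t)) ->
  exists2 t : R, 0 <= t <= 1 & p 1 - p 0 = dp t.
Proof.
move=> hp.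
have [t| |t t01 ->] := @MVT_segment R p dp 0 1 ler01; last by exists t; rewrite ?subr0 ?mulr1.
  by rewrite in_itv/= => /andP[t0 t1]; apply: hp; rewrite !ltW.
apply: continuous_in_subspaceT => t; rewrite inE/= in_itv/= => t01.
apply: differentiable_continuous; apply/derivable1_diffP.
by have [] := hp _ t01.
Qed.

Variables (f : 'rV[R]_s -> R) (ths : 'rV[R]_s) (rho g0 : R).
Let sc th := gradient (fun t => ln (f t)) th.
Hypothesis hf : forall th, euclid_norm (th - ths) <= rho ->
  [/\ differentiable f th, 0 < f th & euclid_norm (sc th) ^+ 2 * f th <= g0].

Let seg v (t : R) : euclid_norm v <= rho -> 0 <= t <= 1 ->
  euclid_norm (ths + t *: v - ths) <= rho.
Proof.
move=> vr /andP[t0 t1]; rewrite addrC addKr euclid_normZ// (le_trans _ vr)//.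
by rewrite ler_piMl// sqrtr_ge0.
Qed.

Lemma diff_score th v : euclid_norm (th - ths) <= rho ->
  'd f th v = f th * (v *m (sc th)^T) 0 0.
Proof.
move=> /hf[df f0 _]; rewrite diff_gradient// /sc gradient_ln//.
by rewrite linearZ/= -scalemxAr [in RHS]mxE mulrA divff ?mul1r// gt_eqF.
Qed.

Let score_bound th v : euclid_norm (th - ths) <= rho ->
  `|(v *m (sc th)^T) 0 0| * Num.sqrt (f th) <= s%:R * Num.sqrt g0 * euclid_norm v.
Proof.
move=> thr; have [_ f0 sg] := hf thr.
apply: (@le_trans _ _ (s%:R * (euclid_norm v * euclid_norm (sc th)) * Num.sqrt (f th))).
  by rewrite ler_wpM2r ?sqrtr_ge0// inner_le_euclid_norm.
have ns : euclid_norm (sc th) * Num.sqrt (f th) <= Num.sqrt g0.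
  rewrite -[X in X * _]ger0_norm ?sqrtr_ge0// -sqrtr_sqr -sqrtrM ?sqr_ge0//.
  by rewrite ler_wsqrtr.
have -> : s%:R * (euclid_norm v * euclid_norm (sc th)) * Num.sqrt (f th) =
    s%:R * euclid_norm v * (euclid_norm (sc th) * Num.sqrt (f th)) by ring.
by rewrite [leRHS]mulrAC ler_wpM2l// mulr_ge0// sqrtr_ge0.
Qed.

(** The derivative of sqrt f along v is half of (v . score) sqrt f, and |score|^2 f is bounded
    uniformly on the ball. *)
Lemma sqrt_density_lipschitz v : euclid_norm v <= rho ->
  `|Num.sqrt (f (ths + v)) - Num.sqrt (f ths)| <= s%:R / 2 * Num.sqrt g0 * euclid_norm v.
Proof.
move=> vr.
pose dp t := (2 * Num.sqrt (f (ths + t *: v)))^-1 * 'd f (ths + t *: v) v.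
have [t t01|t t01] := @mvt01 (fun t => Num.sqrt (f (ths + t *: v))) dp.
  have [df f0 _] := hf (seg vr t01).
  apply: (@is_derive1_comp _ Num.sqrt (fun t => f (ths + t *: v))).
    exact: is_derive1_sqrt.
  exact: is_derive_line.
rewrite scale1r scale0r addr0 => ->.
have tr := seg vr t01; have [_ f0 _] := hf tr.
rewrite /dp diff_score// normrM ger0_norm ?invr_ge0 ?mulr_ge0 ?sqrtr_ge0//.
rewrite normrM (gtr0_norm f0) -{2}(sqr_sqrtr (ltW f0)).
have sb := score_bound v tr; set w := `|_| in sb *; set q := Num.sqrt (f _) in sb *.
have q0 : 0 < q by rewrite sqrtr_gt0.
rewrite (_ : _ * _ = (w * q) / 2); last by field; rewrite gt_eqF.
have -> : s%:R / 2 * Num.sqrt g0 * euclid_norm v = s%:R * Num.sqrt g0 * euclid_norm v / 2 by ring.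
by rewrite ler_pM2r// invr_gt0.
Qed.

(** Obtained from |df v| = f |v . score| <= |v| s (|score|^2 f + f) / 2 by inserting
    the bound [g0] on |score|^2 f and the bound on f that [sqrt_density_lipschitz]
    provides.  Apart from constants it involves only [f ths] and [g0], which are integrable in the
    observation. *)
Definition score_envelope := s%:R / 2 * (g0 + 2 * f ths + s%:R ^+ 2 / 2 * rho ^+ 2 * g0).

Let f_bound v : euclid_norm v <= rho -> f (ths + v) <=
  2 * f ths + s%:R ^+ 2 / 2 * rho ^+ 2 * g0.
Proof.
move=> vr; have n0 : 0 <= euclid_norm v by exact: sqrtr_ge0.
have [_ f0 _] : [/\ differentiable f (ths + v), 0 < f (ths + v) & euclid_norm (sc (ths + v)) ^+ 2 * f (ths + v) <= g0].
  by apply: hf; rewrite addrC addKr.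
have r0 : 0 <= rho by exact: le_trans vr.
have [_ fs0 gs] : [/\ differentiable f ths, 0 < f ths & euclid_norm (sc ths) ^+ 2 * f ths <= g0].
  by apply: hf; rewrite subrr /euclid_norm big1 ?sqrtr0// => i _; rewrite mxE expr0n.
have g00 : 0 <= g0 by rewrite (le_trans _ gs)// mulr_ge0 ?sqr_ge0// ltW.
have := sqrt_density_lipschitz vr.
rewrite -{2}(sqr_sqrtr (ltW f0)) -{2}(sqr_sqrtr (ltW fs0)) -{2}(sqr_sqrtr g00).
set a := Num.sqrt (f _); set b := Num.sqrt (f ths); set c := Num.sqrt g0; set n := euclid_norm v.
have c0 : 0 <= c by exact: sqrtr_ge0.
move=> ab; have {}ab : `|a - b| <= s%:R / 2 * c * rho.
  by rewrite (le_trans ab)// ler_wpM2l// mulr_ge0// divr_ge0.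
have : (a - b) ^+ 2 <= (s%:R / 2 * c * rho) ^+ 2.
  by rewrite -(real_normK (num_real (a - b))) lerXn2r// nnegrE (le_trans _ ab).
have := sqr_ge0 (a - 2 * b).
rewrite !expr2; lra.
Qed.

Lemma diff_le_envelope th v : euclid_norm (th - ths) <= rho ->
  `|'d f th v| <= euclid_norm v * score_envelope.
Proof.
move=> thr; have [_ f0 sg] := hf thr.
rewrite diff_score// normrM (gtr0_norm f0).
have fb := f_bound thr; rewrite addrC subrK in fb.
have nv : 0 <= euclid_norm v by exact: sqrtr_ge0.
apply: (@le_trans _ _ (f th * (s%:R * (euclid_norm v * euclid_norm (sc th))))).
  by rewrite ler_wpM2l ?(ltW f0)// inner_le_euclid_norm.
have -> : f th * (s%:R * (euclid_norm v * euclid_norm (sc th))) =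
  euclid_norm v * (s%:R / 2 * (2 * euclid_norm (sc th) * f th)) by field.
rewrite ler_wpM2l// ler_wpM2l ?divr_ge0//.
have : 0 <= (euclid_norm (sc th) - 1) ^+ 2 * f th by rewrite mulr_ge0 ?sqr_ge0// ltW.
by move: fb sg; rewrite !expr2; lra.
Qed.

Lemma density_lipschitz v : euclid_norm v <= rho ->
  `|f (ths + v) - f ths| <= euclid_norm v * score_envelope.
Proof.
move=> vr.
have [t t01|t t01] := @mvt01 (fun t => f (ths + t *: v)) (fun t => 'd f (ths + t *: v) v).
  by have [df _ _] := hf (seg vr t01); exact: is_derive_line.
by rewrite scale1r scale0r addr0 => ->; exact/diff_le_envelope/seg.
Qed.

Definition score_remainder th := f th - f ths - ((th - ths) *m (sc ths)^T) 0 0 * f ths.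

Let rho0 th : euclid_norm (th - ths) <= rho -> euclid_norm (ths - ths) <= rho.
Proof.
move=> thr; apply: le_trans thr.
by rewrite subrr /euclid_norm big1 ?sqrtr0 ?sqrtr_ge0// => i _; rewrite mxE expr0n.
Qed.

Lemma score_remainder_le th : euclid_norm (th - ths) <= rho ->
  `|score_remainder th| <= 2 * score_envelope * euclid_norm (th - ths).
Proof.
move=> thr.
have E : ths + (th - ths) = th by rewrite addrC subrK.
have d1 := density_lipschitz thr; rewrite E in d1.
have d2 := diff_le_envelope (th - ths) (rho0 thr); rewrite diff_score ?(rho0 thr)// in d2.
rewrite /score_remainder (le_trans (ler_normB _ _))//.
by move: d1 d2; rewrite [_ * f ths]mulrC; lra.
Qed.

(** This is differentiability of f at [ths], written with the score. *)
Lemma score_remainder_small e : 0 <= rho -> 0 < e -> exists2 dl, 0 < dl &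
  forall th, euclid_norm (th - ths) < dl -> `|score_remainder th| <= e * euclid_norm (th - ths).
Proof.
move=> r0 e0.
have tr : euclid_norm (ths - ths) <= rho.
  by rewrite subrr /euclid_norm big1 ?sqrtr0// => i _; rewrite mxE expr0n.
have [df f0 _] := hf tr.
have /eqaddoP /(_ _ e0) /nbhs_ballP[dl /= dl0 Hd] := diff_locally df.
exists dl => // th thd.
have bd : ball (0 : 'rV[R]_s) dl (th - ths).
  rewrite -ball_normE /ball_/= sub0r normrN.
  exact: le_lt_trans (norm_le_euclid_norm _) thd.
have := Hd _ bd; rewrite !fctE /= subrK diff_score// opprD addrA.
rewrite /score_remainder [_ * f ths]mulrC => /le_trans; apply.
by rewrite ler_wpM2l ?(ltW e0)// norm_le_euclid_norm.
Qed.

End directional.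

(** * Differentiability of the densities in the mean *)

(** Dominated convergence works along sequences; this turns its conclusions into statements
    about neighbourhoods. *)
Lemma eps_of_sequences (R : realType) (s : nat) (A : set 'rV[R]_s) (ths : 'rV[R]_s)
    (Phi : 'rV[R]_s -> R) :
  (forall u : nat -> 'rV[R]_s, (forall k, A (u k)) ->
    (fun k => euclid_norm (u k - ths)) @ \oo --> (0 : R) ->
    (fun k => Phi (u k)) @ \oo --> (0 : R)) ->
  forall e, 0 < e -> exists2 dl, 0 < dl &
    forall th, A th -> euclid_norm (th - ths) < dl -> Phi th < e.
Proof.
move=> hu e e0; apply: contrapT => /forall2NP hn.
have ex k : exists th, [/\ A th, euclid_norm (th - ths) < k.+1%:R^-1 & e <= Phi th].
  have [|] := hn k.+1%:R^-1; first by rewrite invr_gt0 ltr0n.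
  move=> /existsNP[th /not_implyP[Ath /not_implyP[thk /negP]]].
  by rewrite -leNgt => ?; exists th.
have [u Hu] := choice ex.
have Au k : A (u k) by have [] := Hu k.
have cu : (fun k => euclid_norm (u k - ths)) @ \oo --> (0 : R).
  apply: (@squeeze_cvgr _ _ _ _ (cst 0) (fun k => k.+1%:R^-1 : R)).
  - apply: nearW => k; have [_ uk _] := Hu k.
    by rewrite /= sqrtr_ge0 ltW.
  - exact: cvg_cst.
  - exact: cvg_harmonic.
have /cvgr0Pnorm_lt /(_ _ e0) [k _ /(_ k (leqnn k))/=] := hu u Au cu.
have [_ _ Phik] := Hu k.
by move=> /(le_lt_trans (ler_norm _)); rewrite ltNge Phik.
Qed.

Section integrable_EFin.
Context d (T : measurableType d) (R : realType) (mu : {measure set T -> \bar R}).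
Variables (D : set T) (mD : measurable D).
Implicit Types h k : T -> R.

Lemma integrableD_EFin h k :
  mu.-integrable D (EFin \o h) -> mu.-integrable D (EFin \o k) ->
  mu.-integrable D (EFin \o (fun x => h x + k x)).
Proof. by move=> ih ik; exact: (integrableD mD ih ik). Qed.

Lemma integrableB_EFin h k :
  mu.-integrable D (EFin \o h) -> mu.-integrable D (EFin \o k) ->
  mu.-integrable D (EFin \o (fun x => h x - k x)).
Proof. by move=> ih ik; exact: (integrableB mD ih ik). Qed.

Lemma le_integrable_EFin h k :
  measurable_fun D h -> (forall x, D x -> `|h x| <= k x) ->
  mu.-integrable D (EFin \o k) -> mu.-integrable D (EFin \o h).
Proof.
move=> mh hk; apply: (le_integrable mD); first exact/measurable_EFinP.
by move=> x Dx /=; rewrite lee_fin (le_trans (hk x Dx))// ler_norm.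
Qed.

Lemma integrable_mul_bounded h k (M : R) :
  measurable_fun D h -> (forall x, D x -> `|h x| <= M) ->
  mu.-integrable D (EFin \o k) -> mu.-integrable D (EFin \o (fun x => h x * k x)).
Proof.
move=> mh hM ik; have /integrableP[/measurable_EFinP mk _] := ik.
apply: (@le_integrable_EFin _ (fun x => M * `|k x|)).
- exact: measurable_funM.
- by move=> x Dx; rewrite normrM ler_wpM2r// hM.
- by apply: integrableZl_EFin => //; exact: integrable_norm.
Qed.

Lemma Rintegral_mul_bounded h k (M : R) :
  measurable_fun D h -> (forall x, D x -> `|h x| <= M) ->
  mu.-integrable D (EFin \o k) ->
  `|\int[mu]_(x in D) (h x * k x)| <= M * \int[mu]_(x in D) `|k x|.
Proof.
move=> mh hM ik.
have ihk := integrable_mul_bounded mh hM ik.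
have ink := integrable_norm ik.
apply: (le_trans (le_normr_Rintegral mD ihk)).
rewrite -RintegralZl//; apply: le_Rintegral => //.
- exact: integrable_norm.
- exact: integrableZl_EFin.
- by move=> x Dx; rewrite normrM ler_wpM2r// hM.
Qed.

End integrable_EFin.

Lemma integrable_unit_mass d (T : measurableType d) (R : realType)
    (mu : {measure set T -> \bar R}) (D : set T) (h : T -> R) :
  measurable_fun D h -> (forall x, D x -> 0 <= h x) ->
  (\int[mu]_(x in D) (h x)%:E = 1)%E -> mu.-integrable D (EFin \o h).
Proof.
move=> mh h0 h1; apply/integrableP; split; first exact/measurable_EFinP.
rewrite (eq_integral (fun x => (h x)%:E)) ?h1 ?ltry// => x /[!inE] Dx.
by rewrite /= ger0_norm ?h0.
Qed.

Section scheffe.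
Context d (T : measurableType d) (R : realType) (mu : {measure set T -> \bar R}).
Variables (D : set T) (mD : measurable D).

(** |f_k - f| = 2 (f - f_k)^+ + (f_k - f), where the last term integrates to 0 and the positive
    part is dominated by f. *)
Lemma scheffe (f_ : nat -> T -> R) (f : T -> R) :
  (forall k, measurable_fun D (f_ k)) -> measurable_fun D f ->
  (forall k x, D x -> 0 <= f_ k x) -> (forall x, D x -> 0 <= f x) ->
  (forall k, \int[mu]_(x in D) (f_ k x)%:E = 1)%E -> (\int[mu]_(x in D) (f x)%:E = 1)%E ->
  (forall x, D x -> f_ ^~ x @ \oo --> f x) ->
  (fun k => \int[mu]_(x in D) `|f_ k x - f x|) @ \oo --> (0 : R).
Proof.
move=> mf_ mf f_0 f0 If_ If cf.
have if_ k : mu.-integrable D (EFin \o f_ k).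
  by apply: integrable_unit_mass => // x; exact: f_0.
have iff : mu.-integrable D (EFin \o f) by exact: integrable_unit_mass.
pose p k x := Num.max (f x - f_ k x) 0.
have mp k : measurable_fun D (p k).
  by apply: measurable_maxr => //; exact: measurable_funB.
have p0 k x : 0 <= p k x by rewrite le_max lexx orbT.
have pf k x : D x -> p k x <= f x.
  by move=> Dx; rewrite ge_max f0// andbT lerBlDr lerDl f_0.
have ip k : mu.-integrable D (EFin \o p k).
  apply: (le_integrable mD _ _ iff); first exact/measurable_EFinP.
  by move=> x Dx /=; rewrite lee_fin !ger0_norm ?pf// f0.
have [_ _] : [/\ mu.-integrable D (cst 0%E),
    [sequence \int[mu]_(x in D) (`|(p k x)%:E - 0|)]_k @ \oo --> 0%E &
    [sequence \int[mu]_(x in D) (p k x)%:E]_k @ \oo --> \int[mu]_(x in D) (cst 0 x : \bar R)]%E.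
  apply: (@dominated_convergence _ _ _ mu D mD _ (cst 0%E) (EFin \o f)) => //.
  - by move=> k; exact/measurable_EFinP.
  - apply: nearW => x Dx; apply: cvg_EFin; first exact: nearW.
    apply/cvgr0Pnorm_le => e e0; have /cvgrPdist_le /(_ _ e0) := cf x Dx.
    apply: filterS => k h; rewrite /= ger0_norm ?p0//; apply: le_trans h.
    by rewrite /p ge_max ler_norm normr_ge0.
  - by apply: nearW => x k Dx /=; rewrite lee_fin ger0_norm ?pf.
rewrite integral0 => /fine_cvgP[_ cp].
have E k : \int[mu]_(x in D) `|f_ k x - f x| = 2 * \int[mu]_(x in D) p k x.
  have -> : \int[mu]_(x in D) `|f_ k x - f x| = \int[mu]_(x in D) (2 * p k x + (f_ k x - f x)).
    apply: eq_Rintegral => x _; rewrite /p.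
    by case: (leP (f x) (f_ k x)) => h; [rewrite ger0_norm ?subr_ge0// max_r ?subr_le0//|rewrite ltr0_norm ?subr_lt0// max_l ?subr_ge0 ?(ltW h)//]; ring.
  have i2 := integrableZl_EFin 2 mD (ip k).
  rewrite RintegralD//; last exact: integrableB_EFin.
  rewrite RintegralZl// RintegralB// {2 3}/Rintegral If_ If/= subrr addr0//.
under eq_fun do rewrite E.
rewrite -(mulr0 (2 : R)); apply: cvgMr; exact: cp.
Qed.
End scheffe.

Section score_L1.
Context d (T : measurableType d) (R : realType) (mu : {measure set T -> \bar R}).
Variables (D : set T) (mD : measurable D) (s : nat).
Variables (F : T -> 'rV[R]_s -> R) (ths : 'rV[R]_s) (rho : R) (g : T -> R).
Let sc x th := gradient (fun t => ln (F x t)) th.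
Hypothesis rho0 : 0 < rho.
Hypothesis hF : forall x, D x -> forall th, euclid_norm (th - ths) <= rho ->
  [/\ differentiable (F x) th, 0 < F x th & euclid_norm (sc x th) ^+ 2 * F x th <= g x].
Hypothesis iF : forall th, euclid_norm (th - ths) <= rho ->
  mu.-integrable D (fun x => (F x th)%:E).
Hypothesis ig : mu.-integrable D (fun x => (g x)%:E).

Let norm0 : euclid_norm (ths - ths) <= rho.
Proof.
by rewrite subrr /euclid_norm big1 ?sqrtr0 ?(ltW rho0)// => i _; rewrite mxE expr0n.
Qed.

Let mF th : euclid_norm (th - ths) <= rho -> measurable_fun D (F ^~ th).
Proof. by move=> /iF /integrableP[/measurable_EFinP]. Qed.

Lemma euclid_norm_delta (i : 'I_s) : euclid_norm (delta_mx 0 i : 'rV[R]_s) = 1.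
Proof.
rewrite /euclid_norm (bigD1 i)//= big1 ?addr0.
  by rewrite mxE !eqxx expr1n sqrtr1.
by move=> j ji; rewrite mxE eqxx (negbTE ji) expr0n.
Qed.

(** The score times the density is the limit of difference quotients of the densities. *)
Lemma measurable_score_density i : measurable_fun D (fun x => sc x ths 0 i * F x ths).
Proof.
(* steps along a coordinate axis that stay in the ball *)
pose r k : R := rho / k.+1%:R.
have r0 k : 0 < r k by rewrite divr_gt0.
have rr k : r k <= rho by rewrite ler_pdivrMr// ler_peMr ?ler1n// ltW.
pose e_ : 'rV[R]_s := delta_mx 0 i.
have nrk k : euclid_norm (ths + r k *: e_ - ths) = r k.
  by rewrite addrC addKr euclid_normZ ?(ltW (r0 k))// euclid_norm_delta mulr1.
apply: (@measurable_fun_cvg _ _ _ _ (fun k x => (F x (ths + r k *: e_) - F x ths) / r k)).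
  move=> k; apply: measurable_funM => //; apply: measurable_funB; apply: mF => //.
  by rewrite nrk.
move=> x Dx; apply/cvgrPdist_le => e e0.
have [dl dl0 Hd] := score_remainder_small (hF Dx) (ltW rho0) e0.
have cr : r @ \oo --> (0 : R).
  rewrite -(mulr0 rho); apply: cvgMr; exact: cvg_harmonic.
have /cvgr0Pnorm_lt /(_ _ dl0) := cr.
apply: filterS => k; rewrite gtr0_norm// => rk.
have := Hd (ths + r k *: e_); rewrite nrk => /(_ rk).
have dE : ths + r k *: e_ - ths = r k *: e_ by rewrite addrC addKr.
rewrite /score_remainder dE -scalemxAl mxE.
have -> : (e_ *m (gradient (fun t => ln (F x t)) ths)^T) 0 0 = sc x ths 0 i.
  by rewrite -rowE !mxE.
move=> h; rewrite -(@ler_pM2r _ (r k))//; apply: le_trans h.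
set A := _ - _; rewrite (_ : `|A| * r k = `|- (A * r k)|); last first.
  by rewrite normrN normrM (gtr0_norm (r0 k)).
by rewrite le_eqVlt; apply/orP; left; apply/eqP; congr `|_|; rewrite /A; field; rewrite gt_eqF.
Qed.

Let env x := score_envelope (F x) ths rho (g x).

Let ienv : mu.-integrable D (fun x => (env x)%:E).
Proof.
have h1 := integrableZl_EFin 2 mD (iF norm0).
have h2 := integrableZl_EFin (s%:R ^+ 2 / 2 * rho ^+ 2) mD ig.
exact: integrableZl_EFin mD (integrableD_EFin mD (integrableD_EFin mD ig h1) h2).
Qed.

Let env0 x : D x -> 0 <= env x.
Proof.
move=> Dx; have [_ F0 gx] := hF Dx norm0.
have g0 : 0 <= g x by rewrite (le_trans _ gx)// mulr_ge0 ?sqr_ge0// ltW.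
rewrite /env /score_envelope mulr_ge0 ?divr_ge0// addr_ge0 ?addr_ge0//.
  by rewrite mulr_ge0// ltW.
by rewrite !mulr_ge0 ?sqr_ge0// ltW.
Qed.

Lemma integrable_score_density i :
  mu.-integrable D (fun x => (sc x ths 0 i * F x ths)%:E).
Proof.
apply: (@le_integrable_EFin _ _ _ _ _ mD _ env _ _ ienv).
  exact: measurable_score_density.
move=> x Dx; have := diff_le_envelope (hF Dx) (delta_mx 0 i) norm0.
rewrite euclid_norm_delta mul1r (diff_score (hF Dx))// mulrC.
by rewrite -rowE !mxE.
Qed.

Lemma integrable_score_linear (v : 'rV[R]_s) :
  mu.-integrable D (fun x => ((v *m (sc x ths)^T) 0 0 * F x ths)%:E).
Proof.
rewrite (_ : (fun x => _) = (fun x => \sum_i (v 0 i * (sc x ths 0 i * F x ths))%:E)%E).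
  apply: integrable_sum => // i _; exact: integrableZl_EFin (integrable_score_density i).
apply/funext => x; rewrite sumEFin mxE mulr_suml; congr EFin; apply: eq_bigr => i _.
by rewrite mxE mulrA.
Qed.

Lemma density_L1_lipschitz : exists2 K, 0 <= K & forall th, euclid_norm (th - ths) <= rho ->
  \int[mu]_(x in D) `|F x th - F x ths| <= K * euclid_norm (th - ths).
Proof.
exists (\int[mu]_(x in D) env x).
  by apply: Rintegral_ge0 => x Dx; exact: env0.
move=> th thr; rewrite mulrC -RintegralZl//.
apply: le_Rintegral => //.
- apply: (@integrable_norm _ _ _ _ _ (fun x => F x th - F x ths)).
  by apply: integrableB_EFin => //; exact: iF.
- exact: integrableZl_EFin.
move=> x Dx; have := density_lipschitz (hF Dx) thr.
by rewrite (_ : ths + (th - ths) = th)// addrC subrK.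
Qed.

(** Along a sequence tending to [ths], the remainder divided by the distance tends to 0
    pointwise and is dominated by twice [score_envelope]. *)
Lemma density_L1_differentiable e : 0 < e -> exists2 dl, 0 < dl &
  forall th, euclid_norm (th - ths) < dl ->
  \int[mu]_(x in D) `|F x th - F x ths - ((th - ths) *m (sc x ths)^T) 0 0 * F x ths|
    <= e * euclid_norm (th - ths).
Proof.
move=> e0.
pose rem x th := score_remainder (F x) ths th.
pose Phi th := (\int[mu]_(x in D) `|rem x th|) / euclid_norm (th - ths).
have irem th : euclid_norm (th - ths) <= rho -> mu.-integrable D (EFin \o (rem ^~ th)).
  move=> thr; apply: (integrableB_EFin mD); last exact: integrable_score_linear.
  by apply: (integrableB_EFin mD); exact: iF.
have n0 th : 0 <= euclid_norm (th - ths) by exact: sqrtr_ge0.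
have Phi0 (u : nat -> 'rV[R]_s) : (forall k, euclid_norm (u k - ths) <= rho) ->
    (fun k => euclid_norm (u k - ths)) @ \oo --> (0 : R) ->
    (fun k => Phi (u k)) @ \oo --> (0 : R).
  move=> ur cu.
  pose h k x := `|rem x (u k)| / euclid_norm (u k - ths).
  have mh k : measurable_fun D (EFin \o h k).
    apply/measurable_EFinP; apply: measurable_funM => //; apply: measurableT_comp => //.
    by have /integrableP[/measurable_EFinP] := irem _ (ur k).
  have hE k : (\int[mu]_(x in D) h k x) = Phi (u k).
    by rewrite /h /Phi RintegralZr//; exact: integrable_norm (irem _ (ur k)).
  have [_ _] : [/\ mu.-integrable D (cst 0%E),
    [sequence \int[mu]_(x in D) (`|(h k x)%:E - 0|)]_k @ \oo --> 0%E &
    [sequence \int[mu]_(x in D) (h k x)%:E]_k @ \oo --> \int[mu]_(x in D) (cst 0 x : \bar R)]%E.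
    apply: (@dominated_convergence _ _ _ mu D mD _ (cst 0%E) (fun x => (2 * env x)%:E)) => //.
    - apply: nearW => x Dx; apply: cvg_EFin; first exact: nearW.
      apply/cvgr0Pnorm_le => e1 e10.
      have [dl dl0 Hd] := score_remainder_small (hF Dx) (ltW rho0) e10.
      have /cvgr0Pnorm_lt /(_ _ dl0) := cu; apply: filterS => k.
      rewrite ger0_norm// => ud; rewrite /= /h normrM normr_id (@ger0_norm _ (euclid_norm _)^-1) ?invr_ge0 ?n0//.
      have := Hd _ ud; have := n0 (u k); rewrite le_eqVlt => /orP[/eqP <- _|up].
        by rewrite invr0 mulr0 ltW.
      by rewrite ler_pdivrMr.
    - exact: integrableZl_EFin.
    - apply: nearW => x k Dx /=; rewrite lee_fin.
      rewrite /h normrM normr_id (@ger0_norm _ (euclid_norm _)^-1) ?invr_ge0 ?n0//.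
      have := score_remainder_le (hF Dx) (ur k).
      have := n0 (u k); rewrite le_eqVlt => /orP[/eqP <- _|up].
        by rewrite invr0 mulr0 mulr_ge0// env0.
      by rewrite ler_pdivrMr.
  rewrite integral0 => /fine_cvgP[_ cp].
  by under eq_fun do rewrite -hE; exact: cp.
have [dl dl0 Hd] := eps_of_sequences (A := [set th | euclid_norm (th - ths) <= rho]) Phi0 e0.
exists (Num.min dl rho) => [|th]; first by rewrite lt_min dl0.
rewrite lt_min => /andP[thd thr].
have := Hd th (ltW thr) thd; have := n0 th; rewrite le_eqVlt => /orP[/eqP th0 _|up]; last first.
  by rewrite ltr_pdivrMr// => /ltW.
have -> : th = ths.
  apply/eqP; rewrite -subr_eq0 -normr_eq0 eq_le normr_ge0 andbT.
  by rewrite (le_trans (norm_le_euclid_norm _))// -th0.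
rewrite (_ : Rintegral _ _ _ = 0) ?mulr_ge0 ?(ltW e0)//.
rewrite (@eq_Rintegral _ _ _ mu D (cst 0)); last first.
  by move=> x _; rewrite !subrr mul0mx mxE mul0r subr0 normr0.
by rewrite /Rintegral integral0.
Qed.
End score_L1.

(** * Measurable extensions *)

Section finite_measure_pack.
Context d (T : measurableType d) (R : realType) (m : {measure set T -> \bar R}).

(** Product measures take as argument measures packed with their finiteness, which the marginals
    of a pushforward only have as a property. *)
Lemma finite_measure_of (fm : fin_num_fun m) :
  exists m' : {finite_measure set T -> \bar R}, forall A, m' A = m A.
Proof.
have sg : sigma_finite setT m.
  by apply: fin_num_fun_sigma_finite => //; rewrite measure0.
pose H1 := isFinite.Build _ _ _ _ fm.
pose H2 := isSFinite.Build _ _ _ _ (sfinite_measure_sigma_finite sg).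
pose H3 := isSigmaFinite.Build _ _ _ _ sg.
by exists (HB.pack_for (FiniteMeasure.type T R) (Measure.sort m) H1 H2 H3).
Qed.
End finite_measure_pack.

(** Value functions and policies are measurable only for the trace sigma-algebra on a state
    space that need not be measurable.  Choosing Borel sets that cut out the rational sublevel
    sets on [X], the extension is the infimum of the rationals whose set contains the point. *)
Lemma trace_measurable_extension d (T : measurableType d) (R : realType) (X : set T) (f : T -> R) :
  @trace_measurable _ _ _ (measurableTypeR R) X f ->
  exists2 f', measurable_fun setT f' & forall x, X x -> f' x = f x.
Proof.
move=> tf.
have ex (q : rat) : exists B, measurable B /\ X `&` f @^-1` `]-oo, ratr q[ = X `&` B.
  by have [B mB E] := tf `]-oo, ratr q[%classic (measurable_itv _); exists B.
have [B HB] := choice ex.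
(* enumerates the rationals; those above f on X are kept, the others read +oo *)
pose h (k : nat) (x : T) : \bar R := if unpickle k is Some q then
  (if x \in B q then (ratr q)%:E else +oo%E) else +oo%E.
have mh k : measurable_fun setT (h k).
  rewrite /h; case: (unpickle k) => [q|]; last exact: measurable_cst.
  apply: measurable_fun_ifT; [|exact: measurable_cst|exact: measurable_cst].
  apply: (measurable_fun_bool true); rewrite setTI (_ : _ @^-1` _ = B q).
    by have [] := HB q.
  by apply/seteqP; split=> x /= => [/set_mem|/mem_set].
exists (fun x => fine (einfs (h ^~ x) 0)).
  by apply: measurableT_comp => //; exact: measurable_fun_einfs.
move=> x Xx; rewrite (_ : einfs _ _ = (f x)%:E)//; apply/eqP; rewrite eq_le; apply/andP; split.
  apply/lee_addgt0Pr => e e0.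
  have /rat_in_itvoo[q] : f x < f x + e by rewrite ltrDl.
  rewrite in_itv/= => /andP[fq qe].
  apply: (@le_trans _ _ (ratr q)%:E); last by rewrite -EFinD lee_fin ltW.
  apply: ereal_inf_lbound; exists (pickle q) => //=.
  rewrite /h pickleK mem_set//.
  have [_ E] := HB q; suff [] : (X `&` B q) x by [].
  by rewrite -E; split => //=; rewrite in_itv.
apply: le_ereal_inf_tmp => _ [k _ <-]; rewrite /h.
case: (unpickle k) => [q|]; last by rewrite leey.
case: ifPn => [/set_mem Bx|_]; last by rewrite leey.
have [_ E] := HB q; have : (X `&` B q) x by [].
by rewrite -E => -[_] /=; rewrite in_itv/= lee_fin => /ltW.
Qed.

Lemma trace_measurable_rV_extension d (T : measurableType d) (R : realType) m (X : set T)
    (f : T -> 'rV[R]_m) :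
  trace_measurable X f ->
  exists2 f', measurable_fun setT f' & forall x, X x -> f' x = f x.
Proof.
move=> tf.
have ex (i : 'I_m) : exists f' : T -> R, measurable_fun setT f' /\ forall x, X x -> f' x = f x 0 i.
  have [|f' mf' f'E] := @trace_measurable_extension _ T R X (fun x => f x 0 i); last by exists f'.
  move=> Y mY; have mY' : measurable ((fun v : 'rV[R]_m => v 0 i) @^-1` Y).
    by rewrite -[X in measurable X]setTI; exact: (@measurable_coord R m i).
  by have [B mB E] := tf _ mY'; exists B.
have [f' Hf'] := choice ex.
exists (fun x => \row_i f' i x).
  apply/measurable_fun_rVP => i.
  by under eq_fun do rewrite mxE; have [] := Hf' i.
by move=> x Xx; apply/rowP => i; rewrite mxE; have [_ ->] := Hf' i.
Qed.

(** * Conditioning the data process on its past *)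

Section process.
Variables (R : realType) (d : nat) (H : finType).
Variables (Xi : set 'rV[R]_d) (varpi : H -> H -> R) (h1 : H) (g : 'rV[R]_d -> H -> R).
Variables (disp : measure_display) (Om : measurableType disp) (P : probability Om R).
Variables (xi : nat -> Om -> 'rV[R]_d) (eta : nat -> Om -> H).
Hypothesis proc : is_data_process Xi varpi h1 g P xi eta.
Hypothesis mXi : measurable Xi.
Hypothesis gdens : forall h, is_density Xi (g ^~ h).
Hypothesis varpi0 : forall h k, 0 <= varpi h k.
Local Notation leb := (lebesgue_rV R d).

Definition histories t : set (set Om) := [set A | exists h B,
  (forall i, measurable (B i)) /\ A = history xi eta t h B].

Definition past t : set (set Om) := <<s histories t >>.

Lemma measurable_state t h : measurable [set w | eta t w = h].
Proof. exact: process_eta_measurable proc t h. Qed.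

Lemma measurable_histories t : histories t `<=` measurable.
Proof.
move=> _ [h [B [mB ->]]].
rewrite (_ : history _ _ _ _ _ = \bigcap_(i in `I_t) ([set w | eta i w = h i] `&` xi i @^-1` B i)).
  apply: fin_bigcap_measurable => [|i _]; first exact: finite_II.
  apply: measurableI; first exact: measurable_state.
  by rewrite -[X in measurable X]setTI; exact: (process_xi_measurable proc).
by apply/seteqP; split=> w /= hw i; exact: hw.
Qed.

Lemma measurable_past t : past t `<=` measurable.
Proof.
by apply: smallest_sub; [exact: sigma_algebra_measurable|exact: measurable_histories].
Qed.

Lemma histories_setI t : setI_closed (histories t).
Proof.
move=> _ _ [h [B [mB ->]]] [h' [B' [mB' ->]]].
have [/forallP hh|/forallPn[i hi]] := boolP [forall i : 'I_t, h i == h' i].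
  exists h, (fun i => B i `&` B' i); split; first by move=> i; exact: measurableI.
  apply/seteqP; split=> w /=.
    by move=> [A A'] i it; have [-> ?] := A i it; have [_ ?] := A' i it.
  move=> A; split=> i it; have [-> [? ?]] := A i it; split=> //.
  exact/eqP/(hh (Ordinal it)).
exists h, (fun=> set0); split=> //.
apply/seteqP; split=> w /= => [[A A']|A].
  have [E _] := A i (ltn_ord i); have [E' _] := A' i (ltn_ord i).
  by move: hi; rewrite -E -E' eqxx.
by have [_ []] := A i (ltn_ord i).
Qed.

Let cover t (k : nat) : set Om :=
  if unpickle k is Some p then
    history xi eta t (fun i => nth h1 (p : seq H) i) (fun=> setT)
  else history xi eta t (fun=> h1) (fun=> set0).

(** The histories form a pi-system that generates the past; the countably many state sequences,
    with no constraint on the observations, give histories that cover the space. *)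
Lemma past_measure_unique t (m1 m2 : {measure set Om -> \bar R}) :
  (forall h B, (forall i, measurable (B i)) ->
    m1 (history xi eta t h B) = m2 (history xi eta t h B)) ->
  (m1 setT < +oo)%E ->
  forall D, past t D -> m1 D = m2 D.
Proof.
move=> m12 m1fin D pD.
apply: (@g_sigma_algebra_measure_unique _ _ _ (histories t) (@measurable_histories t) (cover t)) => //.
- move=> k; rewrite /cover; case: unpickle => [p|].
    by exists (nth h1 p), (fun=> setT).
  by exists (fun=> h1), (fun=> set0).
- apply/seteqP; split=> // w _.
  (* the state sequence actually followed up to time t *)
  pose p := [seq eta i w | i <- iota 0 t].
  exists (pickle p) => //; rewrite /cover pickleK => i it /=; split=> //.
  by rewrite (nth_map 0%N) ?size_iota// nth_iota.
- exact: histories_setI.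
- by move=> _ [h [B [mB ->]]]; exact: m12.
- move=> k; apply: le_lt_trans m1fin; apply: le_measure; rewrite ?inE//.
  apply: measurable_histories; rewrite /cover; case: unpickle => [p|].
    by exists (nth h1 p), (fun=> setT).
  by exists (fun=> h1), (fun=> set0).
Qed.

(** Both sides are finite measures of [D] that agree on the histories. *)
Lemma emission_past t D k (B : set 'rV[R]_d) : past t D -> measurable B ->
  (P (D `&` ([set w | eta t w = k] `&` xi t @^-1` B)) =
   (\int[leb]_(x in Xi `&` B) (g x k)%:E) * P (D `&` [set w | eta t w = k]))%E.
Proof.
move=> pD mB.
have mS := measurable_state t k.
have mxB : measurable (xi t @^-1` B).
  by rewrite -[X in measurable X]setTI; exact: (process_xi_measurable proc).
have I0 : (0 <= \int[leb]_(x in Xi `&` B) (g x k)%:E)%E.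
  by apply: integral_ge0 => x [Xx _]; rewrite lee_fin; have [_ ->] := gdens k.
have I1 : (\int[leb]_(x in Xi `&` B) (g x k)%:E <= 1)%E.
  have [mg g0 <-] := gdens k.
  apply: ge0_subset_integral => //; first exact: measurableI.
  exact/measurable_EFinP.
have fI : (\int[leb]_(x in Xi `&` B) (g x k)%:E)%E \is a fin_num.
  by rewrite ge0_fin_numE// (le_lt_trans I1)// ltry.
pose c := NngNum (fine_ge0 I0).
pose m1 : {measure set Om -> \bar R} := mrestr P (measurableI _ _ mS mxB).
pose m2 : {measure set Om -> \bar R} := mscale c (mrestr P mS).
have m2E A : m2 A = (\int[leb]_(x in Xi `&` B) (g x k)%:E * P (A `&` [set w | eta t w = k]))%E.
  by rewrite [LHS](_ : _ = (fine (\int[leb]_(x in Xi `&` B) (g x k)%:E))%:E * P (A `&` [set w | eta t w = k]))%E// fineK.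
rewrite -m2E -[LHS]/(m1 D).
apply: past_measure_unique pD.
  move=> h A mA; rewrite m2E -[LHS]/(P (_ `&` _)) setIA.
  exact: (process_emission proc).
rewrite -[X in (X < _)%E]/(P (_ `&` _)).
by apply: le_lt_trans (probability_le1 P _) _; rewrite ?ltry//; apply: measurableI => //; exact: measurableI.
Qed.

(** Both sides are finite measures of [D] that agree on the histories; a history reaching time
    [t] fixes the state at that time, and contributes only if that state is [h]. *)
Lemma transition_past t D h k : past t.+1 D ->
  (P (D `&` ([set w | eta t w = h] `&` [set w | eta t.+1 w = k])) =
   (varpi h k)%:E * P (D `&` [set w | eta t w = h]))%E.
Proof.
move=> pD.
have mS := measurable_state t h; have mS' := measurable_state t.+1 k.
pose c := NngNum (varpi0 h k).
pose m1 : {measure set Om -> \bar R} := mrestr P (measurableI _ _ mS mS').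
pose m2 : {measure set Om -> \bar R} := mscale c (mrestr P mS).
rewrite -[LHS]/(m1 D) -[RHS]/(m2 D).
apply: past_measure_unique pD.
  move=> h' A mA.
  rewrite -[LHS]/(P (_ `&` _)) -[RHS]/((varpi h k)%:E * P (_ `&` _))%E setIA.
  have [hh|hh] := eqVneq (h' t) h; last first.
    rewrite (_ : _ `&` [set w | eta t w = h] = set0) ?set0I ?measure0 ?mule0//.
    apply/seteqP; split=> // w [/= /(_ t (ltnSn _))[-> _]] E.
    by move: hh; rewrite E eqxx.
  rewrite (_ : _ `&` [set w | eta t w = h] = history xi eta t.+1 h' A); last first.
    by apply/seteqP; split=> w /= => [[]//|Aw]; split=> //; have [-> _] := Aw _ (ltnSn t).
  by rewrite (process_transition proc)// hh.
rewrite -[X in (X < _)%E]/(P (_ `&` _)).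
by apply: le_lt_trans (probability_le1 P _) _; rewrite ?ltry//; apply: measurableI => //; exact: measurableI.
Qed.

(** The event is the union, over the countably many state sequences, of histories that
    constrain a single observation. *)
Lemma past_event i t k (B : set 'rV[R]_d) : (i < t)%N -> measurable B ->
  past t ([set w | eta i w = k] `&` xi i @^-1` B).
Proof.
move=> it mB.
pose C (n : nat) : set Om := if unpickle n is Some p then
    history xi eta t (fun j => nth h1 (p : seq H) j)
      (fun j => if j == i then (if nth h1 (p : seq H) i == k then B else set0) else setT)
  else history xi eta t (fun=> h1) (fun=> set0).
have -> : [set w | eta i w = k] `&` xi i @^-1` B = \bigcup_n C n.
  apply/seteqP; split=> w.
    move=> [/= ek xB]; pose p := [seq eta i w | i <- iota 0 t].
    have pE j : (j < t)%N -> nth h1 p j = eta j w.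
      by move=> jt; rewrite (nth_map 0%N) ?size_iota// nth_iota.
    exists (pickle p) => //; rewrite /C pickleK => j jt /=; rewrite !pE//; split=> //.
    by case: eqP => // ->; rewrite ek eqxx.
  move=> [n _]; rewrite /C; case: (unpickle n) => [p|] /(_ i it) []//.
  by rewrite eqxx => E; case: eqP => // <- xB; split.
apply: (@bigcupT_measurable _ (g_sigma_algebraType (histories t))) => n.
apply: sub_sigma_algebra; rewrite /C; case: (unpickle n) => [p|].
  eexists; eexists; split; last by [].
  by move=> j /=; case: eqP => // _; case: eqP.
by exists (fun=> h1), (fun=> set0).
Qed.

Notation pastT t := (g_sigma_algebraType (histories t)).
Notation past_measurable t Z := (measurable_fun [set: pastT t] (Z : pastT t -> _)).

Lemma past_le t t' : (t <= t')%N -> past t `<=` past t'.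
Proof.
move=> tt'; apply: smallest_sub; first exact: smallest_sigma_algebra.
move=> _ [h [B [mB ->]]].
rewrite (_ : history _ _ _ _ _ = \bigcap_(i in `I_t) ([set w | eta i w = h i] `&` xi i @^-1` B i)).
  apply: (@fin_bigcap_measurable _ (pastT t')) => [|i it]; first exact: finite_II.
  by apply: past_event => //; exact: leq_trans tt'.
by apply/seteqP; split=> w /= hw i; exact: hw.
Qed.

Lemma past_measurable_le t t' d' (T' : measurableType d') (Z : Om -> T') : (t <= t')%N ->
  past_measurable t Z -> past_measurable t' Z.
Proof. by move=> tt' mZ _ Y mY; apply: (past_le tt'); exact: mZ. Qed.

Lemma past_measurable_fun t d' (T' : measurableType d') (Z : Om -> T') :
  past_measurable t Z -> measurable_fun setT Z.
Proof. by move=> mZ _ Y mY; apply: (@measurable_past t); exact: mZ. Qed.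

Lemma past_measurable_xi t : past_measurable t.+1 (xi t).
Proof.
move=> _ Y mY; rewrite setTI.
rewrite (_ : _ @^-1` _ = \bigcup_(k in [set: H]) ([set w | eta t w = k] `&` xi t @^-1` Y)).
  apply: (@fin_bigcup_measurable _ (pastT t.+1)) => [|k _]; first exact: finite_finset.
  exact: past_event.
by apply/seteqP; split=> w /= => [Yw|[k _ []]//]; exists (eta t w).
Qed.

Lemma past_state t k : past t.+1 [set w | eta t w = k].
Proof. by have := @past_event t t.+1 k setT (ltnSn t) measurableT; rewrite preimage_setT setIT. Qed.

Lemma past_measurable_dispatch t d' (T' : measurableType d') (Z : H -> Om -> T') :
  (forall k, past_measurable t.+1 (Z k)) -> past_measurable t.+1 (fun w => Z (eta t w) w).
Proof.
move=> mZ _ Y mY; rewrite setTI.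
rewrite (_ : _ @^-1` _ = \bigcup_(k in [set: H]) ([set w | eta t w = k] `&` Z k @^-1` Y)).
  apply: (@fin_bigcup_measurable _ (pastT t.+1)) => [|k _]; first exact: finite_finset.
  apply: (@measurableI _ (pastT t.+1)); first exact: past_state.
  by rewrite -[X in measurable X]setTI; exact: (mZ k).
by apply/seteqP; split=> w /= => [Yw|[k _ [-> ]]//]; exists (eta t w).
Qed.

Lemma measurable_dispatch t d' (T' : measurableType d') (Z : H -> Om -> T') :
  (forall k, measurable_fun setT (Z k)) -> measurable_fun setT (fun w => Z (eta t w) w).
Proof.
move=> mZ _ Y mY; rewrite setTI.
rewrite (_ : _ @^-1` _ = \bigcup_(k in [set: H]) ([set w | eta t w = k] `&` Z k @^-1` Y)).
  apply: fin_bigcup_measurable => [|k _]; first exact: finite_finset.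
  apply: measurableI; first exact: measurable_state.
  by rewrite -[X in measurable X]setTI; exact: (mZ k).
by apply/seteqP; split=> w /= => [Yw|[k _ [-> ]]//]; exists (eta t w).
Qed.

Local Open Scope ereal_scope.

Let S t k := [set w | eta t w = k].
Let gX k : 'rV[R]_d -> R := (g ^~ k) \_ Xi.
Let gX0 k y : (0 <= gX k y)%R.
Proof.
by rewrite /gX patchE; case: ifPn => // /set_mem Xy; have [_ ->] := gdens k.
Qed.
Let mgX k : measurable_fun setT (gX k).
Proof. have [mg _ _] := gdens k; exact: (measurable_restrictT (g ^~ k) mXi).1 mg. Qed.

(** On the event that the state at time [t] is [k], the pair formed by a variable of the past
    and the observation has a product law; Tonelli integrates the observation out. *)
Lemma ge0_emission_integral t k d' (T' : measurableType d') (Z : Om -> T')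
    (phi : T' * 'rV[R]_d -> \bar R) :
  past_measurable t Z -> measurable_fun setT phi -> (forall z, 0 <= phi z) ->
  \int[P]_w (phi (Z w, xi t w) * (\1_(S t k) w)%:E) =
  \int[P]_w ((\int[leb]_(y in Xi) (phi (Z w, y) * (g y k)%:E)) * (\1_(S t k) w)%:E).
Proof.
move=> pZ mphi phi0.
have mZ := past_measurable_fun pZ.
have mS : measurable (S t k) by exact: measurable_state.
have mxi : measurable_fun setT (xi t) by exact: (process_xi_measurable proc).
have m1S : measurable_fun setT (\1_(S t k) : Om -> R) by exact: measurable_indic.
have S0 w : (0 <= \1_(S t k) w :> R)%R by rewrite indicE.
pose Pk : {measure set Om -> \bar R} := measure_of_density P m1S S0.
pose nuk : {measure set 'rV[R]_d -> \bar R} := measure_of_density leb (mgX k) (gX0 k).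
have PkE A : measurable A -> Pk A = P (A `&` S t k).
  by move=> mA; rewrite [LHS](_ : _ = \int[P]_(x in A) (\1_(S t k) x)%:E)// integral_indic// setIC.
have nukE B : measurable B -> nuk B = \int[leb]_(x in Xi `&` B) (g x k)%:E.
  move=> mB; rewrite [LHS](_ : _ = \int[leb]_(x in B) (gX k x)%:E)//.
  rewrite setIC integral_mkcondr; apply: eq_integral => x _.
  by rewrite /gX !patchE; case: ifP.
have mpair : measurable_fun setT (fun w => (Z w, xi t w)) by exact: measurable_fun_pair.
(* joint law of (Z, xi t) on the event that the state is k *)
pose M := image_measure Pk mpair.
pose m1 := image_measure Pk mZ.
have fPk : fin_num_fun Pk.
  move=> A mA; rewrite PkE// fin_num_measure//; exact: measurableI.
have fm1 : fin_num_fun m1.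
  move=> A mA; rewrite -[X in X \is a _]/(Pk (Z @^-1` A)); apply: fPk.
  by rewrite -[X in measurable X]setTI; exact: (mZ).
have fnuk : fin_num_fun nuk.
  move=> B mB; rewrite nukE// ge0_fin_numE; last first.
    by apply: integral_ge0 => x [Xx _]; rewrite lee_fin; have [_ ->] := gdens k.
  have [mg g0 g1] := gdens k.
  apply: (@le_lt_trans _ _ 1); last exact: ltry.
  rewrite -g1; apply: ge0_subset_integral => //; first exact: measurableI.
  exact/measurable_EFinP.
have [m1' m1'E] := finite_measure_of fm1.
have [nuk' nuk'E] := finite_measure_of fnuk.
have prodE A : measurable A -> (m1' \x nuk') A = M A.
  apply: product_measure_unique => A1 B mA mB.
  have mZA : measurable (Z @^-1` A1) by rewrite -[X in measurable X]setTI; exact: (mZ).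
  have mxB : measurable (xi t @^-1` B) by rewrite -[X in measurable X]setTI; exact: mxi.
  rewrite -[LHS]/(Pk ((Z @^-1` A1) `&` (xi t @^-1` B))) PkE; last exact: measurableI.
  transitivity (nuk B * m1 A1); last by rewrite muleC; congr (_ * _); [exact: esym (m1'E _)|exact: esym (nuk'E _)].
  rewrite -[m1 A1]/(Pk (Z @^-1` A1)) PkE// nukE// -emission_past//.
    by rewrite -setIA [_ `&` S t k]setIC.
  by rewrite -[Z @^-1` A1]setTI; exact: pZ.
pose G z := \int[leb]_(y in Xi) (phi (z, y) * (g y k)%:E).
have GE z : \int[nuk']_y phi (z, y) = G z.
  rewrite (eq_measure_integral nuk); last by move=> A mA _; exact: (nuk'E A).
  rewrite (@ge0_integral_density _ _ _ leb nuk (gX k))//; last first.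
    by apply: measurableT_comp mphi _; exact: measurable_pair1.
  rewrite /G [RHS]integral_mkcond; apply: eq_integral => y _.
  by rewrite /gX !patchE; case: ifP => // _; rewrite mule0.
have mG : measurable_fun setT G.
  rewrite (_ : G = fun z => \int[nuk']_y phi (z, y)); last by apply/funext => z; rewrite GE.
  exact: (measurable_fun_fubini_tonelli_F phi).
have G0 z : 0 <= G z.
  by apply: integral_ge0 => y Xy; apply: mule_ge0 => //; rewrite lee_fin; have [_ ->] := gdens k.
have PkI (f : Om -> \bar R) : measurable_fun setT f -> (forall w, 0 <= f w) ->
    \int[Pk]_w f w = \int[P]_w (f w * (\1_(S t k) w)%:E).
  by move=> mf f0; exact: (@ge0_integral_density _ _ _ P Pk _ m1S S0 (fun A mA => erefl)).
rewrite -(PkI _ (measurableT_comp mphi mpair) (fun w => phi0 _)).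
rewrite -[RHS](PkI _ (measurableT_comp mG mZ) (fun w => G0 _)).
transitivity (\int[M]_z phi z).
  by rewrite (ge0_integral_pushforward mpair).
rewrite (eq_measure_integral (m1' \x nuk')); last by move=> A mA _; exact: esym (prodE _ mA).
rewrite fubini_tonelli1//.
rewrite (eq_measure_integral m1); last by move=> A mA _; exact: (m1'E A).
rewrite (ge0_integral_pushforward mZ)//.
- by rewrite preimage_setT; apply: eq_integral => w _; rewrite /= -GE.
- exact: (measurable_fun_fubini_tonelli_F phi).
- by move=> z _; exact: integral_ge0.
Qed.

End process.

(** * Conditional expectations of signed functions *)

Section Rintegral_tools.
Context d (T : measurableType d) (R : realType) (mu : {measure set T -> \bar R}).

Lemma EFin_Rintegral (D : set T) (f : T -> R) : measurable D ->
  mu.-integrable D (EFin \o f) -> (\int[mu]_(x in D) (f x)%:E = (\int[mu]_(x in D) f x)%:E)%E.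
Proof. by move=> mD i; rewrite /Rintegral fineK//; exact: integrable_fin_num. Qed.

Lemma Rintegral_sum (D : set T) (I : Type) (r : seq I) (f : I -> T -> R) : measurable D ->
  (forall i, mu.-integrable D (EFin \o f i)) ->
  \int[mu]_(x in D) (\sum_(i <- r) f i x) = \sum_(i <- r) \int[mu]_(x in D) f i x.
Proof.
move=> mD fi; rewrite /Rintegral.
under eq_integral do rewrite -sumEFin.
rewrite (@integral_sum _ _ _ mu D mD _ (fun i x => (f i x)%:E))//.
under eq_bigr do rewrite EFin_Rintegral//.
by rewrite sumEFin.
Qed.

Lemma integrable_sum_EFin (D : set T) (I : Type) (r : seq I) (f : I -> T -> R) : measurable D ->
  (forall i, mu.-integrable D (EFin \o f i)) ->
  mu.-integrable D (EFin \o (fun x => \sum_(i <- r) f i x)).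
Proof.
move=> mD fi; rewrite (_ : EFin \o _ = fun x => (\sum_(i <- r) (f i x)%:E)%E).
  by apply: integrable_sum => // i _; exact: fi.
by apply/funext => x; rewrite /= sumEFin.
Qed.

End Rintegral_tools.

Section parametric.
Context d1 d2 (T1 : measurableType d1) (T2 : measurableType d2) (R : realType).
Variable mu : {sigma_finite_measure set T2 -> \bar R}.

Lemma measurable_Rintegral_param (psi : T1 * T2 -> R) : measurable_fun setT psi ->
  measurable_fun setT (fun z => \int[mu]_y psi (z, y)).
Proof.
move=> mpsi.
pose ep : T1 * T2 -> \bar R := ((fun z => (psi z)%:E)^\+)%E.
pose en : T1 * T2 -> \bar R := ((fun z => (psi z)%:E)^\-)%E.
have me : measurable_fun setT (fun z => (psi z)%:E) by exact/measurable_EFinP.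
rewrite (_ : (fun z => _) = fun z => fine (\int[mu]_y ep (z, y) - \int[mu]_y en (z, y))%E).
  apply: measurableT_comp => //; apply: emeasurable_funB.
    apply: (measurable_fun_fubini_tonelli_F ep); first exact: measurable_funepos.
    by move=> z; exact: funepos_ge0.
  apply: (measurable_fun_fubini_tonelli_F en); first exact: measurable_funeneg.
  by move=> z; exact: funeneg_ge0.
apply/funext => z; rewrite /Rintegral integralE; congr (fine (_ - _)%E).
  by apply: eq_integral => y _; rewrite /ep !funeposE.
by apply: eq_integral => y _; rewrite /en !funenegE.
Qed.

End parametric.

Section markov_expectation.
Variables (R : realType) (d : nat) (H : finType).
Variables (Xi : set 'rV[R]_d) (varpi : H -> H -> R) (h1 : H) (g : 'rV[R]_d -> H -> R).
Variables (disp : measure_display) (Om : measurableType disp) (P : probability Om R).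
Variables (xi : nat -> Om -> 'rV[R]_d) (eta : nat -> Om -> H).
Hypothesis proc : is_data_process Xi varpi h1 g P xi eta.
Hypothesis mXi : measurable Xi.
Hypothesis gdens : forall h, is_density Xi (g ^~ h).
Hypothesis varpi0 : forall h k, 0 <= varpi h k.
Local Notation leb := (lebesgue_rV R d).
Local Notation S t k := [set w | eta t w = k].
Local Notation pastT t := (g_sigma_algebraType (histories xi eta t)).
Local Notation past_measurable t Z := (measurable_fun [set: pastT t] (Z : pastT t -> _)).

Let mS t k : measurable (S t k). Proof. exact: (measurable_state proc). Qed.
Let m1S t k : measurable_fun setT (\1_(S t k) : Om -> R).
Proof. exact: measurable_indic. Qed.
Let S0 t k w : 0 <= \1_(S t k) w :> R. Proof. by rewrite indicE. Qed.
Let S1 t k w : \1_(S t k) w <= 1 :> R. Proof. by rewrite indicE lern1 leq_b1. Qed.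
Let mxi t : measurable_fun setT (xi t). Proof. exact: (process_xi_measurable proc). Qed.

Section emission.
Variables (t : nat) (k : H) (d' : measure_display) (T' : measurableType d') (Z : Om -> T').
Variables (phi : T' * 'rV[R]_d -> R) (A : Om -> R) (e : 'rV[R]_d -> R).
Hypothesis pZ : past_measurable t Z.
Hypothesis mphi : measurable_fun setT phi.
Hypothesis iA : P.-integrable setT (EFin \o A).
Hypothesis ie : leb.-integrable Xi (EFin \o (fun y => e y * g y k)).
Hypothesis phi_le : forall w y, Xi y -> `|phi (Z w, y)| <= A w * e y.

Let mZ := past_measurable_fun proc pZ.

Lemma integrable_emission_inner w : leb.-integrable Xi (EFin \o (fun y => phi (Z w, y) * g y k)).
Proof.
have [mg g0 _] := gdens k.
apply: (@le_integrable_EFin _ _ _ _ _ mXi _ (fun y => A w * (e y * g y k))).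
- apply: measurable_funM => //; apply: measurable_funTS.
  by apply: measurableT_comp mphi _; exact: measurable_pair1.
- move=> y Xy; rewrite normrM mulrA (ger0_norm (g0 y Xy)).
  by rewrite ler_wpM2r ?g0 ?phi_le.
- exact: integrableZl_EFin.
Qed.

Let measurable_outer : measurable_fun setT (fun w => \int[leb]_(y in Xi) (phi (Z w, y) * g y k)).
Proof.
have [mg g0 _] := gdens k.
have mgX : measurable_fun setT ((g ^~ k) \_ Xi) by exact: (measurable_restrictT (g ^~ k) mXi).1.
rewrite (_ : (fun w => _) = (fun z => \int[leb]_y (phi (z, y) * ((g ^~ k) \_ Xi) y)) \o Z).
  apply: measurableT_comp mZ.
  apply: (measurable_Rintegral_param _ (psi := fun z => phi z * ((g ^~ k) \_ Xi) z.2)).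
  by apply: measurable_funM => //; exact: measurableT_comp mgX measurable_snd.
apply/funext => w; rewrite Rintegral_mkcond; apply: eq_Rintegral => y _.
by rewrite !patchE; case: ifP; rewrite ?mulr0.
Qed.

Lemma integrable_emission :
  P.-integrable setT (EFin \o (fun w => (\int[leb]_(y in Xi) (phi (Z w, y) * g y k)) * \1_(S t k) w)).
Proof.
have [mg g0 _] := gdens k.
apply: (@le_integrable_EFin _ _ _ _ _ measurableT _ (fun w => (\int[leb]_(y in Xi) (e y * g y k)) * A w)).
- exact: measurable_funM.
- move=> w _; rewrite normrM [in leRHS]mulrC -[leRHS]mulr1 (ger0_norm (S0 _ _ _)).
  apply: ler_pM => //; rewrite -RintegralZl//.
  apply: (le_trans (le_normr_Rintegral mXi (integrable_emission_inner w))).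
  apply: le_Rintegral => //; first exact: integrable_norm (integrable_emission_inner w).
    exact: integrableZl_EFin.
  move=> y Xy; rewrite normrM mulrA (ger0_norm (g0 y Xy)).
  by rewrite ler_wpM2r ?g0 ?phi_le.
- exact: integrableZl_EFin.
Qed.

Lemma ge0_emission_Rintegral : (forall z, 0 <= phi z) ->
  (\int[P]_w (phi (Z w, xi t w) * \1_(S t k) w)%:E =
   \int[P]_w ((\int[leb]_(y in Xi) (phi (Z w, y) * g y k)) * \1_(S t k) w)%:E)%E.
Proof.
move=> phi0.
have mephi : measurable_fun setT (EFin \o phi) by exact/measurable_EFinP.
have ephi0 z : (0 <= (EFin \o phi) z)%E by rewrite lee_fin.
have aux := ge0_emission_integral proc mXi gdens k pZ mephi ephi0.
under eq_integral do rewrite EFinM.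
rewrite [LHS]aux; apply: eq_integral => w _; rewrite EFinM; congr (_ * _)%E.
by rewrite -EFin_Rintegral//; exact: integrable_emission_inner.
Qed.

End emission.

Section emission_signed.
Variables (t : nat) (k : H) (d' : measure_display) (T' : measurableType d') (Z : Om -> T').
Variables (phi : T' * 'rV[R]_d -> R) (A : Om -> R) (e : 'rV[R]_d -> R).
Hypothesis pZ : past_measurable t Z.
Hypothesis mphi : measurable_fun setT phi.
Hypothesis iA : P.-integrable setT (EFin \o A).
Hypothesis ie : leb.-integrable Xi (EFin \o (fun y => e y * g y k)).
Hypothesis phi_le : forall w y, Xi y -> `|phi (Z w, y)| <= A w * e y.

Let mZ := past_measurable_fun proc pZ.
Let inner psi w := \int[leb]_(y in Xi) (psi (Z w, y) * g y k).

Let ge0_case (psi : T' * 'rV[R]_d -> R) : measurable_fun setT psi ->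
  (forall z, 0 <= psi z <= `|phi z|) ->
  [/\ forall w, leb.-integrable Xi (EFin \o (fun y => psi (Z w, y) * g y k)),
     P.-integrable setT (EFin \o (fun w => psi (Z w, xi t w) * \1_(S t k) w)),
     P.-integrable setT (EFin \o (fun w => inner psi w * \1_(S t k) w)) &
     \int[P]_w (psi (Z w, xi t w) * \1_(S t k) w) = \int[P]_w (inner psi w * \1_(S t k) w)].
Proof.
move=> mpsi psi01.
have psi0 z : 0 <= psi z by have /andP[] := psi01 z.
have psi_le w y : Xi y -> `|psi (Z w, y)| <= A w * e y.
  move=> Xy; rewrite ger0_norm//; have /andP[_ h] := psi01 (Z w, y).
  by rewrite (le_trans h)// phi_le.
have I1 := integrable_emission_inner mpsi ie psi_le.
have I2 := integrable_emission pZ mpsi iA ie psi_le.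
have E := ge0_emission_Rintegral pZ mpsi ie psi_le psi0.
split=> //; last by rewrite /Rintegral E.
apply/integrableP; split.
  apply/measurable_EFinP; apply: measurable_funM => //.
  by apply: measurableT_comp mpsi _; exact: measurable_fun_pair.
under eq_integral do rewrite /= ger0_norm ?mulr_ge0//.
by rewrite E EFin_Rintegral// ltry.
Qed.

(** The product bound on [phi] makes both sides integrable, so the nonnegative case applies to
    the positive and negative parts. *)
Lemma emission_Rintegral :
  [/\ P.-integrable setT (EFin \o (fun w => phi (Z w, xi t w) * \1_(S t k) w)),
     P.-integrable setT (EFin \o (fun w => inner phi w * \1_(S t k) w)) &
     \int[P]_w (phi (Z w, xi t w) * \1_(S t k) w) = \int[P]_w (inner phi w * \1_(S t k) w)].
Proof.
have mp : measurable_fun setT (phi^\+) by exact: measurable_funrpos.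
have mn : measurable_fun setT (phi^\-) by exact: measurable_funrneg.
have [|Ip ip ip' Ep] := ge0_case mp.
  by move=> z; rewrite funrpos_ge0 /funrpos ge_max ler_norm normr_ge0.
have [|In in_ in' En] := ge0_case mn.
  by move=> z; rewrite funrneg_ge0 /funrneg ge_max normr_ge0 andbT -normrN ler_norm.
have dE z : phi z = phi^\+ z - phi^\- z by rewrite -[LHS](congr1 (@^~ z) (funrposBneg phi)).
have E1 : (fun w => phi (Z w, xi t w) * \1_(S t k) w) =
   fun w => phi^\+ (Z w, xi t w) * \1_(S t k) w - phi^\- (Z w, xi t w) * \1_(S t k) w.
  by apply/funext => w; rewrite dE mulrBl.
split.
- by rewrite E1; exact: integrableB_EFin.
- exact: integrable_emission pZ mphi iA ie phi_le.
rewrite E1 RintegralB// Ep En -RintegralB//; apply: eq_Rintegral => w _.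
rewrite -mulrBl; congr (_ * _); rewrite /inner.
rewrite -RintegralB//; apply: eq_Rintegral => y _.
by rewrite [in RHS]dE mulrBl.
Qed.

End emission_signed.

Section transition.
Variables (t : nat) (zeta : Om -> R).
Hypothesis pz : past_measurable t.+1 zeta.

Let mz : measurable_fun setT zeta. Proof. exact: (past_measurable_fun proc pz). Qed.

Let ge0_transition (f : R -> R) h k : measurable_fun setT f -> (forall x, 0 <= f x) ->
  (\int[P]_w (f (zeta w) * (\1_(S t h) w * \1_(S t.+1 k) w))%:E =
   (varpi h k)%:E * \int[P]_w (f (zeta w) * \1_(S t h) w)%:E)%E.
Proof.
move=> mf f0.
have mSS : measurable (S t h `&` S t.+1 k) by apply: measurableI.
have m1SS : measurable_fun setT (\1_(S t h `&` S t.+1 k) : Om -> R) by exact: measurable_indic.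
have SS0 w : 0 <= \1_(S t h `&` S t.+1 k) w :> R by rewrite indicE.
pose m1 : {measure set Om -> \bar R} := measure_of_density P m1SS SS0.
pose m2 : {measure set Om -> \bar R} := measure_of_density P (m1S t h) (S0 t h).
have mfz : measurable_fun setT (fun w => (f (zeta w))%:E).
  by apply/measurable_EFinP; exact: measurableT_comp mf mz.
have fz0 w : (0 <= (f (zeta w))%:E)%E by rewrite lee_fin.
have m1I : (\int[m1]_w (f (zeta w))%:E = \int[P]_w (f (zeta w) * (\1_(S t h) w * \1_(S t.+1 k) w))%:E)%E.
  rewrite (@ge0_integral_density _ _ _ P m1 _ m1SS SS0 (fun A mA => erefl) _ mfz fz0).
  by apply: eq_integral => w _; rewrite indicI.
have m2I : (\int[m2]_w (f (zeta w))%:E = \int[P]_w (f (zeta w) * \1_(S t h) w)%:E)%E.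
  exact: (@ge0_integral_density _ _ _ P m2 _ (m1S t h) (S0 t h) (fun A mA => erefl) _ mfz fz0).
rewrite -m1I -m2I.
have mef : measurable_fun setT (fun x => (f x)%:E) by exact/measurable_EFinP.
have push (m : {measure set Om -> \bar R}) :
    (\int[m]_w (f (zeta w))%:E = \int[image_measure m (mz : measurable_fun (setT : set Om) (zeta : Om -> measurableTypeR R))]_x (f x)%:E)%E.
  have := @ge0_integral_pushforward _ _ Om (measurableTypeR R) R zeta mz m setT (fun x => (f x)%:E) measurableT mef.
  by move=> ->; [rewrite preimage_setT|move=> x _; rewrite lee_fin].
rewrite !push.
pose c := NngNum (varpi0 h k).
transitivity (\int[mscale c (image_measure m2 (mz : measurable_fun (setT : set Om) (zeta : Om -> measurableTypeR R)))]_x (f x)%:E)%E; last first.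
  by rewrite ge0_integral_mscale// => x _; rewrite lee_fin.
apply: eq_measure_integral => A mA _.
have mzA : measurable (zeta @^-1` A) by rewrite -[X in measurable X]setTI; exact: (mz).
rewrite -[LHS]/(m1 (zeta @^-1` A)) -[RHS]/((varpi h k)%:E * m2 (zeta @^-1` A))%E.
have m1E : m1 (zeta @^-1` A) = P (zeta @^-1` A `&` (S t h `&` S t.+1 k)).
  by rewrite [LHS](_ : _ = \int[P]_(x in zeta @^-1` A) (\1_(S t h `&` S t.+1 k) x)%:E)%E// integral_indic// setIC.
have m2E : m2 (zeta @^-1` A) = P (zeta @^-1` A `&` S t h).
  by rewrite [LHS](_ : _ = \int[P]_(x in zeta @^-1` A) (\1_(S t h) x)%:E)%E// integral_indic// setIC.
rewrite m1E m2E; apply: (transition_past proc varpi0).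
by rewrite -[zeta @^-1` A]setTI; exact: pz.
Qed.

Lemma transition_Rintegral h k : P.-integrable setT (EFin \o zeta) ->
  \int[P]_w (zeta w * (\1_(S t h) w * \1_(S t.+1 k) w)) =
  varpi h k * \int[P]_w (zeta w * \1_(S t h) w).
Proof.
move=> iz.
have mul1 (f : Om -> R) (u : Om -> R) : measurable_fun setT u -> (forall w, 0 <= u w <= 1) ->
    P.-integrable setT (EFin \o f) -> P.-integrable setT (EFin \o (fun w => f w * u w)).
  move=> mu u01 if_; rewrite (_ : (fun w => f w * u w) = (fun w => u w * f w)).
    apply: (@integrable_mul_bounded _ _ _ _ _ measurableT u f 1) => // w _.
    by have /andP[? ?] := u01 w; rewrite ger0_norm.
  by apply/funext => w; rewrite mulrC.
pose zp w := Num.max (zeta w) 0; pose zn w := Num.max (- zeta w) 0.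
have mzp : measurable_fun setT zp by apply: measurable_maxr.
have mzn : measurable_fun setT zn by apply: measurable_maxr => //; exact: measurableT_comp.
have izp : P.-integrable setT (EFin \o zp).
  apply: (@le_integrable_EFin _ _ _ _ _ measurableT _ (fun w => `|zeta w|)) => //.
    by move=> w _; rewrite ger0_norm /zp ?ge_max ?ler_norm ?normr_ge0// le_max lexx orbT.
  exact: integrable_norm.
have izn : P.-integrable setT (EFin \o zn).
  apply: (@le_integrable_EFin _ _ _ _ _ measurableT _ (fun w => `|zeta w|)) => //.
    by move=> w _; rewrite -(normrN (zeta w)) ger0_norm /zn ?ge_max ?ler_norm ?normr_ge0// le_max lexx orbT.
  exact: integrable_norm.
have zE w : zeta w = zp w - zn w.
  by rewrite /zp /zn; case: (leP (zeta w) 0) => z0; case: (leP (- zeta w) 0) => z1; lra.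
pose u w : R := \1_(S t h) w * \1_(S t.+1 k) w.
have mu : measurable_fun setT u by exact: measurable_funM.
have u01 w : 0 <= u w <= 1 by rewrite mulr_ge0//= mulr_ile1.
have s01 w : 0 <= (\1_(S t h) w : R) <= 1 by rewrite S0 S1.
have Ep : \int[P]_w (zp w * u w) = varpi h k * \int[P]_w (zp w * \1_(S t h) w).
  have ip := mul1 _ _ (m1S t h) s01 izp.
  rewrite {1}/Rintegral (@ge0_transition (fun x => Num.max x 0) h k).
  - by rewrite EFin_Rintegral.
  - exact: measurable_maxr.
  - by move=> x; rewrite le_max lexx orbT.
have En : \int[P]_w (zn w * u w) = varpi h k * \int[P]_w (zn w * \1_(S t h) w).
  have ip := mul1 _ _ (m1S t h) s01 izn.
  rewrite {1}/Rintegral (@ge0_transition (fun x => Num.max (- x) 0) h k).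
  - by rewrite EFin_Rintegral.
  - by apply: measurable_maxr => //; exact: measurableT_comp.
  - by move=> x; rewrite le_max lexx orbT.
transitivity (\int[P]_w (zp w * u w - zn w * u w)).
  by apply: eq_Rintegral => w _; rewrite zE mulrBl.
rewrite RintegralB//; [|exact: mul1|exact: mul1].
rewrite Ep En -mulrBr -RintegralB//; [|exact: mul1|exact: mul1].
by congr (_ * _); apply: eq_Rintegral => w _; rewrite [in RHS]zE mulrBl.
Qed.

End transition.

Lemma sum_state_indic t w : \sum_(k : H) \1_(S t k) w = 1 :> R.
Proof.
rewrite (bigD1 (eta t w))//= indicE mem_set// big1 ?addr0// => k kw.
by rewrite indicE memNset// => /= E; move: kw; rewrite E eqxx.
Qed.

Lemma Rintegral_state_split t (f : Om -> R) :
  P.-integrable setT (EFin \o f) ->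
  \int[P]_w f w = \sum_(k : H) \int[P]_w (f w * \1_(S t k) w).
Proof.
move=> iff; rewrite -Rintegral_sum//; last first.
  move=> k; rewrite (_ : (fun w => f w * _) = (fun w => \1_(S t k) w * f w)).
    apply: (@integrable_mul_bounded _ _ _ _ _ measurableT _ f 1) => // w _.
    by rewrite ger0_norm.
  by apply/funext => w; rewrite mulrC.
by apply: eq_Rintegral => w _; rewrite -mulr_sumr sum_state_indic mulr1.
Qed.

End markov_expectation.

(** * Bellman equation of a fixed policy *)

(** The supremum of |v| satisfies S <= a + gamma S. *)
Lemma contraction_sup_bound (R : realType) (T : Type) (D : set T) (v : T -> R) (a gamma : R) :
  gamma < 1 -> (exists B, forall x, D x -> `|v x| <= B) ->
  (forall B, (forall x, D x -> `|v x| <= B) -> forall x, D x -> `|v x| <= a + gamma * B) ->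
  forall x, D x -> `|v x| <= a / (1 - gamma).
Proof.
move=> g1 [B vB] contr x Dx.
pose E := [set `|v y| | y in D].
have hsE : has_sup E.
  by split; [exists `|v x|; exists x|exists B => _ [y Dy <-]; exact: vB].
have vS y : D y -> `|v y| <= sup E by move=> Dy; apply: sup_upper_bound => //; exists y.
have SS : sup E <= a + gamma * sup E.
  apply: ge_sup; first by exists `|v x|; exists x.
  by move=> _ [y Dy <-]; exact: contr.
have g1' : 0 < 1 - gamma by rewrite subr_gt0.
rewrite ler_pdivlMr//; apply: (le_trans (ler_wpM2r (ltW g1') (vS _ Dx))).
by rewrite mulrBr mulr1 lerBlDr [sup E * _]mulrC.
Qed.

Section control_facts.
Variables (R : realType) (n m d : nat) (H : finType).
Variables (gamma : R) (varpi : H -> H -> R) (X : set 'rV[R]_n) (U : set 'rV[R]_m).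
Variables (c : 'rV[R]_n -> 'rV[R]_m -> 'rV[R]_d -> R).
Variables (F : 'rV[R]_n -> 'rV[R]_m -> 'rV[R]_d -> 'rV[R]_n).
Variables (Xi : set 'rV[R]_d) (M : R).
Hypothesis mXi : measurable Xi.
Hypothesis gamma01 : 0 < gamma < 1.
Hypothesis kern : stochastic_kernel varpi.
Hypothesis mc : measurable_fun setT
    (fun z : 'rV[R]_n * 'rV[R]_m * 'rV[R]_d => c z.1.1 z.1.2 z.2).
Hypothesis cM : forall x u y, X x -> U u -> Xi y -> `|c x u y| <= M.
Hypothesis mF : measurable_fun setT
    (fun z : 'rV[R]_n * 'rV[R]_m * 'rV[R]_d => F z.1.1 z.1.2 z.2).
Hypothesis FX : forall x u y, X x -> U u -> Xi y -> X (F x u y).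
Local Notation leb := (lebesgue_rV R d).
Local Notation stage := (stage_value gamma varpi c F).
Implicit Types (V : 'rV[R]_n -> H -> R) (q : 'rV[R]_d -> H -> R).

Definition bounded_by (B : R) V := forall x h, X x -> `|V x h| <= B.

Lemma stage_value_ext V V' x h u y : X x -> U u -> Xi y ->
  (forall z k, X z -> V z k = V' z k) -> stage V x h u y = stage V' x h u y.
Proof.
move=> Xx Uu Xy E; rewrite /stage_value; congr (_ + _ * _).
by apply: eq_bigr => k _; rewrite E//; exact: FX.
Qed.

Lemma kernel_average_le h (w : H -> R) B : (forall k, `|w k| <= B) ->
  `|\sum_k varpi h k * w k| <= B.
Proof.
move=> wB; have [v0 v1] := kern.
rewrite (le_trans (ler_norm_sum _ _ _))// -[leRHS]mul1r -(v1 h) mulr_suml.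
by apply: ler_sum => k _; rewrite normrM (ger0_norm (v0 _ _)) ler_wpM2l.
Qed.

Lemma stage_value_le V B x h u y : bounded_by B V -> X x -> U u -> Xi y ->
  `|stage V x h u y| <= M + gamma * B.
Proof.
move=> VB Xx Uu Xy; have /andP[g0 g1] := gamma01.
rewrite (le_trans (ler_normD _ _))// lerD ?cM// normrM (gtr0_norm g0).
by rewrite ler_wpM2l ?(ltW g0)// kernel_average_le// => k; exact/VB/FX.
Qed.

Lemma stage_valueB_le V V' B x h u y :
  bounded_by B (fun z k => V z k - V' z k) -> X x -> U u -> Xi y ->
  `|stage V x h u y - stage V' x h u y| <= gamma * B.
Proof.
move=> VB Xx Uu Xy; have /andP[g0 g1] := gamma01.
rewrite /stage_value addrAC opprD addrA subrr add0r addrC -mulrBr -sumrB normrM (gtr0_norm g0).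
rewrite ler_wpM2l ?(ltW g0)//; under eq_bigr do rewrite -mulrBr.
by apply: kernel_average_le => k; exact/VB/FX.
Qed.

Lemma borel_extension V : (forall h, trace_measurable X (V ^~ h : _ -> measurableTypeR R)) ->
  exists V', (forall h, measurable_fun setT (V' ^~ h)) /\
    forall x h, X x -> V' x h = V x h.
Proof.
move=> tV.
have ex h : exists v : 'rV[R]_n -> R, measurable_fun setT v /\ forall x, X x -> v x = V x h.
  by have [v mv vE] := trace_measurable_extension (tV h); exists v.
have [v Hv] := choice ex.
exists (fun x h => v h x); split=> [h|x h Xx]; first by have [] := Hv h.
by have [_ ->] := Hv h.
Qed.

Lemma measurable_stage_value V h : (forall k, measurable_fun setT (V ^~ k)) ->
  measurable_fun setT (fun z : 'rV[R]_n * 'rV[R]_m * 'rV[R]_d => stage V z.1.1 h z.1.2 z.2).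
Proof.
move=> mV; apply: measurable_funD => //; apply: measurable_funM => //.
apply: measurable_sum => k; apply: measurable_funM => //.
exact: measurableT_comp (mV k) mF.
Qed.

Lemma measurable_stage_value_noise V x h u : X x -> U u ->
  (forall k, trace_measurable X (V ^~ k : _ -> measurableTypeR R)) ->
  measurable_fun Xi (stage V x h u).
Proof.
move=> Xx Uu /borel_extension[V' [mV' V'E]].
apply: (eq_measurable_fun (stage V' x h u)).
  by move=> y /set_mem Xy; exact: stage_value_ext.
apply: measurable_funTS.
exact: measurableT_comp (measurable_stage_value h mV') (measurable_pair1 (x, u)).
Qed.

Section solutions.
Variable pi : 'rV[R]_n -> H -> 'rV[R]_m.
Hypothesis piU : forall x h, X x -> U (pi x h).

Definition solves q V := bounded_measurable X V /\
  forall x h, X x -> V x h = policy_bellman gamma varpi c F (density_expectation Xi q) pi V x h.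

Definition value_bound := M / (1 - gamma).

Lemma density_expectation_le q h (Y : 'rV[R]_d -> R) B : is_density Xi (q ^~ h) ->
  measurable_fun Xi Y -> (forall y, Xi y -> `|Y y| <= B) ->
  `|density_expectation Xi q h Y| <= B.
Proof.
move=> [mq q0 q1] mY YB; have iq := integrable_unit_mass mq q0 q1.
rewrite (le_trans (Rintegral_mul_bounded mXi mY YB iq))//.
rewrite (@eq_Rintegral _ _ _ leb Xi (q ^~ h)); last first.
  by move=> y /set_mem Xy; rewrite ger0_norm// q0.
by rewrite /Rintegral q1/= mulr1.
Qed.

Lemma solution_le q V : (forall h, is_density Xi (q ^~ h)) -> solves q V ->
  bounded_by value_bound V.
Proof.
move=> dq [[tV [B VB]] eqV]; have /andP[g0 g1] := gamma01.
suff h : forall z : 'rV[R]_n * H, X z.1 -> `|V z.1 z.2| <= M / (1 - gamma).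
  by move=> x k Xx; exact: (h (x, k)).
apply: contraction_sup_bound => //; first by exists B => z; exact: VB.
move=> C VC [x k] /= Xx; rewrite eqV//; apply: density_expectation_le => //.
  by apply: measurable_stage_value_noise => //; exact: piU.
move=> y Xy; apply: stage_value_le => //; last exact: piU.
by move=> z l; exact: (VC (z, l)).
Qed.

Lemma value_bound_ge0 x (h : H) : X x -> (exists y, Xi y) -> 0 <= value_bound.
Proof.
move=> Xx [y Xy]; have /andP[g0 g1] := gamma01.
apply: divr_ge0; last by rewrite subr_ge0 ltW.
exact: le_trans (normr_ge0 _) (cM Xx (piU h Xx) Xy).
Qed.

Lemma value_boundE : M + gamma * value_bound = value_bound.
Proof.
by have /andP[g0 g1] := gamma01; rewrite /value_bound; field; rewrite subr_eq0 gt_eqF.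
Qed.

Let psi V x h := stage V x h (pi x h).

Lemma measurable_policy_stage V x h : X x -> bounded_measurable X V ->
  measurable_fun Xi (psi V x h).
Proof. by move=> Xx [tV _]; apply: measurable_stage_value_noise => //; exact: piU. Qed.

Lemma policy_stage_le V x h y : bounded_by value_bound V -> X x -> Xi y ->
  `|psi V x h y| <= value_bound.
Proof.
by move=> VB Xx Xy; rewrite -value_boundE; apply: stage_value_le => //; exact: piU.
Qed.

(** Difference of the two Bellman equations.  The first term carries the first-order change of
    the density, the second is of second order, and the third propagates the difference of the
    values to the next step. *)
Lemma solutionB_decomposition q q' V V' x h :
  (forall h, is_density Xi (q ^~ h)) -> (forall h, is_density Xi (q' ^~ h)) ->
  solves q V -> solves q' V' -> X x ->
  V x h - V' x h = \int[leb]_(y in Xi) (psi V' x h y * (q y h - q' y h))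
    + \int[leb]_(y in Xi) ((psi V x h y - psi V' x h y) * (q y h - q' y h))
    + \int[leb]_(y in Xi) ((psi V x h y - psi V' x h y) * q' y h).
Proof.
move=> dq dq' sV sV' Xx.
have [bV eV] := sV; have [bV' eV'] := sV'.
have vb := solution_le dq sV; have vb' := solution_le dq' sV'.
have [mq q0 q1] := dq h; have [mq' q0' q1'] := dq' h.
have iq := integrable_unit_mass mq q0 q1; have iq' := integrable_unit_mass mq' q0' q1'.
have mp := measurable_policy_stage h Xx bV; have mp' := measurable_policy_stage h Xx bV'.
have bp y (Xy : Xi y) := policy_stage_le h vb Xx Xy.
have bp' y (Xy : Xi y) := policy_stage_le h vb' Xx Xy.
have iD := integrableB_EFin mXi iq iq'.
have mD := measurable_funB mp mp'.
have bD y : Xi y -> `|psi V x h y - psi V' x h y| <= value_bound + value_bound.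
  by move=> Xy; rewrite (le_trans (ler_normB _ _))// lerD ?bp ?bp'.
rewrite -RintegralD//; [|exact: integrable_mul_bounded bp' iD|exact: integrable_mul_bounded bD iD].
rewrite -RintegralD//; last 2 first.
- apply: integrableD_EFin => //; [exact: integrable_mul_bounded bp' iD|exact: integrable_mul_bounded bD iD].
- exact: integrable_mul_bounded bD iq'.
rewrite eV// eV'// /policy_bellman /action_value /density_expectation -RintegralB//; last 2 first.
- exact: integrable_mul_bounded bp iq.
- exact: integrable_mul_bounded bp' iq'.
by apply: eq_Rintegral => y _; rewrite /psi; ring.
Qed.

(** The difference of two values solves an affine equation with contraction factor [gamma]
    whose inhomogeneity is bounded by the L^1 distance of the densities. *)
Lemma solutionB_le q q' V V' L :
  (forall h, is_density Xi (q ^~ h)) -> (forall h, is_density Xi (q' ^~ h)) ->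
  solves q V -> solves q' V' -> 0 <= L -> 0 <= value_bound ->
  (forall h, \int[leb]_(y in Xi) `|q y h - q' y h| <= L) ->
  bounded_by (value_bound * L / (1 - gamma)) (fun x h => V x h - V' x h).
Proof.
move=> dq dq' sV sV' L0 vb0 qL; have /andP[g0 g1] := gamma01.
have [bV eV] := sV; have [bV' eV'] := sV'.
have vb := solution_le dq sV; have vb' := solution_le dq' sV'.
suff h : forall z : 'rV[R]_n * H, X z.1 -> `|V z.1 z.2 - V' z.1 z.2| <= value_bound * L / (1 - gamma).
  by move=> x k Xx; exact: (h (x, k)).
apply: contraction_sup_bound => //.
  exists (value_bound + value_bound) => z Xz.
  by rewrite (le_trans (ler_normB _ _))// lerD ?vb ?vb'.
move=> C VC [x h] /= Xx; rewrite (solutionB_decomposition h dq dq' sV sV' Xx).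
have [mq q0 q1] := dq h; have [mq' q0' q1'] := dq' h.
have iq := integrable_unit_mass mq q0 q1; have iq' := integrable_unit_mass mq' q0' q1'.
have mp := measurable_policy_stage h Xx bV; have mp' := measurable_policy_stage h Xx bV'.
have bp y (Xy : Xi y) := policy_stage_le h vb Xx Xy.
have bp' y (Xy : Xi y) := policy_stage_le h vb' Xx Xy.
have iD := integrableB_EFin mXi iq iq'.
have mD := measurable_funB mp mp'.
have bD y : Xi y -> `|psi V x h y - psi V' x h y| <= gamma * C.
  by move=> Xy; apply: stage_valueB_le => //; [move=> z k; exact: (VC (z, k))|exact: piU].
rewrite -RintegralD//; [|exact: integrable_mul_bounded bp' iD|exact: integrable_mul_bounded bD iD].
rewrite (@eq_Rintegral _ _ _ leb Xi (fun y => psi V x h y * (q y h - q' y h))); last first.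
  by move=> y _; ring.
rewrite (le_trans (ler_normD _ _))// lerD//.
  rewrite (le_trans (Rintegral_mul_bounded mXi mp bp iD))// ler_wpM2l//.
exact: (@density_expectation_le q' h (fun y => psi V x h y - psi V' x h y)).
Qed.

End solutions.
End control_facts.

(** * The controlled process *)

Section controlled_process.
Variables (R : realType) (n m d : nat) (H : finType).
Variables (gamma : R) (varpi : H -> H -> R) (X : set 'rV[R]_n) (U : set 'rV[R]_m).
Variables (c : 'rV[R]_n -> 'rV[R]_m -> 'rV[R]_d -> R).
Variables (F : 'rV[R]_n -> 'rV[R]_m -> 'rV[R]_d -> 'rV[R]_n).
Variables (Xi : set 'rV[R]_d) (M : R).
Hypothesis mXi : measurable Xi.
Hypothesis gamma01 : 0 < gamma < 1.
Hypothesis kern : stochastic_kernel varpi.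
Hypothesis mc : measurable_fun setT
    (fun z : 'rV[R]_n * 'rV[R]_m * 'rV[R]_d => c z.1.1 z.1.2 z.2).
Hypothesis cM : forall x u y, X x -> U u -> Xi y -> `|c x u y| <= M.
Hypothesis mF : measurable_fun setT
    (fun z : 'rV[R]_n * 'rV[R]_m * 'rV[R]_d => F z.1.1 z.1.2 z.2).
Hypothesis FX : forall x u y, X x -> U u -> Xi y -> X (F x u y).
Variable pi : 'rV[R]_n -> H -> 'rV[R]_m.
Hypothesis policy : is_policy X U pi.
Variables (x1 : 'rV[R]_n) (h1 : H) (g : 'rV[R]_d -> H -> R).
Hypothesis Xx1 : X x1.
Hypothesis gdens : forall h, is_density Xi (g ^~ h).
Variables (disp : measure_display) (Om : measurableType disp) (P : probability Om R).
Variables (xi : nat -> Om -> 'rV[R]_d) (eta : nat -> Om -> H).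
Hypothesis proc : is_data_process Xi varpi h1 g P xi eta.
Local Notation leb := (lebesgue_rV R d).
Local Notation stage := (stage_value gamma varpi c F).
Local Notation S t k := [set w | eta t w = k].
Local Notation pastT t := (g_sigma_algebraType (histories xi eta t)).
Local Notation past_measurable t Z := (measurable_fun [set: pastT t] (Z : pastT t -> _)).
Implicit Types (V : 'rV[R]_n -> H -> R).

Definition state (t : nat) (w : Om) : 'rV[R]_n :=
  trajectory F pi x1 (xi ^~ w) (eta ^~ w) t.

Definition stage_cost t w := c (state t w) (pi (state t w) (eta t w)) (xi t w).

Let piU x h : X x -> U (pi x h). Proof. exact: policy.1. Qed.
Let varpi0 h k : 0 <= varpi h k. Proof. exact: kern.1. Qed.
Let Xixi t w : Xi (xi t w). Proof. exact: (process_xi_support proc). Qed.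

Lemma stateX t w : X (state t w).
Proof.
elim: t => [//|t IH]; rewrite /state /=; apply: FX => //; exact: piU.
Qed.

Lemma borel_policy : exists pi' : H -> 'rV[R]_n -> 'rV[R]_m,
  (forall k, measurable_fun setT (pi' k)) /\ forall x k, X x -> pi' k x = pi x k.
Proof.
have ex k : exists p, measurable_fun setT p /\ forall x, X x -> p x = pi x k.
  by have [p mp pE] := trace_measurable_rV_extension (policy.2 k); exists p.
have [p Hp] := choice ex.
by exists p; split=> [k|x k Xx]; [have [] := Hp k|have [_ ->] := Hp k].
Qed.

Let mpast_xi t : past_measurable t.+1 (xi t).
Proof. exact: (past_measurable_xi h1). Qed.

Lemma past_state_measurable t : past_measurable t (state t).
Proof.
have [pi' [mpi' pi'E]] := borel_policy.
elim: t => [|t IH]; first exact: measurable_cst.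
pose Z k w := F (state t w) (pi' k (state t w)) (xi t w).
have -> : state t.+1 = fun w => Z (eta t w) w.
  by apply/funext => w; rewrite /Z pi'E//; exact: stateX.
apply: (past_measurable_dispatch h1 (Z := Z)) => k.
have mx := past_measurable_le h1 (leqnSn t) IH.
have mu := measurableT_comp (mpi' k) mx.
exact: measurableT_comp mF (measurable_fun_pair (measurable_fun_pair mx mu) (@mpast_xi t)).
Qed.

Lemma past_stage_cost t : past_measurable t.+1 (stage_cost t).
Proof.
have [pi' [mpi' pi'E]] := borel_policy.
pose Z k w := c (state t w) (pi' k (state t w)) (xi t w).
have -> : stage_cost t = fun w => Z (eta t w) w.
  by apply/funext => w; rewrite /Z pi'E//; exact: stateX.
apply: (past_measurable_dispatch h1 (Z := Z)) => k.
have mx := past_measurable_le h1 (leqnSn t) (past_state_measurable (t := t)).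
have mu := measurableT_comp (mpi' k) mx.
exact: measurableT_comp mc (measurable_fun_pair (measurable_fun_pair mx mu) (@mpast_xi t)).
Qed.

Lemma stage_cost_le t w : `|stage_cost t w| <= M.
Proof. by apply: cM => //; [exact: stateX|exact/piU/stateX]. Qed.

Lemma past_value V t k : bounded_measurable X V -> past_measurable t (fun w => V (state t w) k).
Proof.
move=> [/borel_extension[V' [mV' V'E]] _].
rewrite (_ : (fun w => _) = (fun w => V' (state t w) k)).
  exact: measurableT_comp (mV' k) (past_state_measurable (t := t)).
by apply/funext => w; rewrite V'E//; exact: stateX.
Qed.

Let integrable_indic_mul (f : Om -> R) t k : P.-integrable setT (EFin \o f) ->
  P.-integrable setT (EFin \o (fun w => f w * \1_(S t k) w)).
Proof.
move=> iff; rewrite (_ : (fun w => f w * _) = (fun w => \1_(S t k) w * f w)).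
  apply: (@integrable_mul_bounded _ _ _ _ _ measurableT _ f 1) => //.
    by apply: measurable_indic; exact: (measurable_state proc).
  by move=> w _; rewrite ger0_norm ?indicE// lern1 leq_b1.
by apply/funext => w; rewrite mulrC.
Qed.

Let split_state t (f : Om -> R) : f = fun w => \sum_(k : H) f w * \1_(S t k) w.
Proof. by apply/funext => w; rewrite -mulr_sumr sum_state_indic mulr1. Qed.

Let eq_on_state t k (f f' : Om -> R) : (forall w, eta t w = k -> f w = f' w) ->
  (fun w => f w * \1_(S t k) w) = (fun w => f' w * \1_(S t k) w).
Proof.
move=> ff'; apply/funext => w; rewrite indicE.
have [/set_mem /= /ff' ->//|_] := boolP (w \in S t k).
by rewrite (_ : false%:R = 0 :> R)// !mulr0.
Qed.

Let psi V x h y := stage V x h (pi x h) y.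

(** Conditionally on the past and the current state, the observation has density [g].  The
    weight [rho] is 1 or a score, and [zeta] a constant or a sum of past scores. *)
Lemma emission_policy V B t (zeta : Om -> R) (rho : 'rV[R]_d -> H -> R) :
  bounded_measurable X V -> bounded_by X B V ->
  past_measurable t zeta -> P.-integrable setT (EFin \o zeta) ->
  (forall k, measurable_fun Xi (rho ^~ k)) ->
  (forall k, leb.-integrable Xi (EFin \o (fun y => `|rho y k| * g y k))) ->
  let inner x k := \int[leb]_(y in Xi) (psi V x k y * rho y k * g y k) in
  [/\ P.-integrable setT (EFin \o (fun w => zeta w * (psi V (state t w) (eta t w) (xi t w) * rho (xi t w) (eta t w)))),
      P.-integrable setT (EFin \o (fun w => zeta w * inner (state t w) (eta t w))) &
      \int[P]_w (zeta w * (psi V (state t w) (eta t w) (xi t w) * rho (xi t w) (eta t w)))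
      = \int[P]_w (zeta w * inner (state t w) (eta t w))].
Proof.
move=> bV VB pz iz mrho irho inner.
have [pi' [mpi' pi'E]] := borel_policy.
have [tV _] := bV; have [V' [mV' V'E]] := borel_extension tV.
pose rho' k : 'rV[R]_d -> R := (rho ^~ k) \_ Xi.
have mrho' k : measurable_fun setT (rho' k) by exact: (measurable_restrictT (rho ^~ k) mXi).1.
(* a Borel version of the integrand, as a function of the past variables (state, action, zeta) and of the observation *)
pose phi k (z : 'rV[R]_n * 'rV[R]_m * R * 'rV[R]_d) : R :=
  z.1.2 * (stage V' z.1.1.1 k z.1.1.2 z.2 * rho' k z.2).
have mphi k : measurable_fun setT (phi k).
  apply: measurable_funM; first exact: measurableT_comp measurable_snd measurable_fst.
  apply: measurable_funM; last exact: measurableT_comp (mrho' k) measurable_snd.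
  have m3 : measurable_fun setT (fun z : 'rV[R]_n * 'rV[R]_m * R * 'rV[R]_d => (z.1.1, z.2)).
    apply: measurable_fun_pair measurable_snd.
    exact: measurableT_comp measurable_fst measurable_fst.
  exact: measurableT_comp (measurable_stage_value gamma varpi mc mF k mV') m3.
pose Z k w := (state t w, pi' k (state t w), zeta w).
have pZ k : past_measurable t (Z k).
  apply: measurable_fun_pair pz.
  apply: measurable_fun_pair (past_state_measurable (t := t)) _.
  exact: measurableT_comp (mpi' k) (past_state_measurable (t := t)).
have sX w : X (state t w) by exact: (stateX t w).
have sle k w y (Xy : Xi y) := stage_value_le gamma01 kern cM FX k VB (sX w) (piU k (sX w)) Xy.
have phiE k w y : Xi y -> phi k (Z k w, y) = zeta w * (psi V (state t w) k y * rho y k).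
  move=> Xy; rewrite /phi /Z /= /rho' patchE mem_set// pi'E//.
  congr (_ * (_ * _)); exact: (stage_value_ext gamma varpi c FX k (sX w) (piU k (sX w)) Xy V'E).
have phi_le k w y : Xi y -> `|phi k (Z k w, y)| <= (M + gamma * B) * `|zeta w| * `|rho y k|.
  move=> Xy; rewrite phiE// !normrM mulrCA mulrA ler_wpM2r// ler_wpM2r//.
  exact: sle.
have iA : P.-integrable setT (EFin \o (fun w => (M + gamma * B) * `|zeta w|)).
  by apply: integrableZl_EFin => //; exact: integrable_norm.
have em k := emission_Rintegral proc mXi gdens (pZ k) (mphi k) iA (irho k) (phi_le k).
pose f w := zeta w * (psi V (state t w) (eta t w) (xi t w) * rho (xi t w) (eta t w)).
pose h w := zeta w * inner (state t w) (eta t w).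
have fE k : (fun w => f w * \1_(S t k) w) = fun w => phi k (Z k w, xi t w) * \1_(S t k) w.
  by apply: eq_on_state => w ek; rewrite phiE// /f ek.
have hE k : (fun w => h w * \1_(S t k) w) = fun w => (\int[leb]_(y in Xi) (phi k (Z k w, y) * g y k)) * \1_(S t k) w.
  apply: eq_on_state => w ek; rewrite /h ek /inner -RintegralZl//.
    by apply: eq_Rintegral => y /set_mem Xy; rewrite phiE// !mulrA.
  have [mg g0 _] := gdens k.
  apply: (@le_integrable_EFin _ _ _ _ _ mXi _ (fun y => (M + gamma * B) * (`|rho y k| * g y k))).
  - apply: measurable_funM => //; apply: measurable_funM => //.
    exact: (measurable_policy_stage gamma varpi mc mF FX piU k (sX w) bV).
  - move=> y Xy; rewrite !normrM (ger0_norm (g0 y Xy)) -mulrA ler_wpM2r ?mulr_ge0 ?g0//.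
    exact: sle.
  - exact: integrableZl_EFin.
have if_ : P.-integrable setT (EFin \o f).
  rewrite (split_state t f); apply: integrable_sum_EFin => // k.
  by rewrite fE; have [] := em k.
have ih : P.-integrable setT (EFin \o h).
  rewrite (split_state t h); apply: integrable_sum_EFin => // k.
  by rewrite hE; have [] := em k.
split=> //.
rewrite -[LHS]/(\int[P]_w f w) -[RHS]/(\int[P]_w h w).
rewrite (Rintegral_state_split proc t if_) (Rintegral_state_split proc t ih).
apply: eq_bigr => k _; have [_ _] := em k.
by rewrite fE hE.
Qed.

(** Conditionally on the past and the current observation, the next state of the chain has law
    [varpi], so the stage value is the cost plus the discounted value one step later. *)
Lemma transition_policy V B t (zeta : Om -> R) :
  bounded_measurable X V -> bounded_by X B V ->
  past_measurable t.+1 zeta -> P.-integrable setT (EFin \o zeta) ->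
  [/\ P.-integrable setT (EFin \o (fun w => zeta w * stage_cost t w)),
      P.-integrable setT (EFin \o (fun w => zeta w * V (state t.+1 w) (eta t.+1 w))) &
      \int[P]_w (zeta w * psi V (state t w) (eta t w) (xi t w)) =
      \int[P]_w (zeta w * stage_cost t w)
      + gamma * \int[P]_w (zeta w * V (state t.+1 w) (eta t.+1 w))].
Proof.
move=> bV VB pz iz.
have bounded_mul (u : Om -> R) C : measurable_fun setT u -> (forall w, `|u w| <= C) ->
    P.-integrable setT (EFin \o (fun w => zeta w * u w)).
  move=> mu uC; rewrite (_ : (fun w => _) = fun w => u w * zeta w).
    by apply: (@integrable_mul_bounded _ _ _ _ _ measurableT u zeta C).
  by apply/funext => w; rewrite mulrC.
have mcost := past_measurable_fun proc (past_stage_cost (t := t)).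
have icost := bounded_mul _ _ mcost (stage_cost_le t).
have mVk k := past_measurable_fun proc (past_value (t := t.+1) k bV).
have mVn : measurable_fun setT (fun w => V (state t.+1 w) (eta t.+1 w)).
  exact: (measurable_dispatch proc t.+1 (Z := fun k w => V (state t.+1 w) k)).
have VnB w k : `|V (state t.+1 w) k| <= B by apply: VB; exact: stateX.
have iVn : P.-integrable setT (EFin \o (fun w => zeta w * V (state t.+1 w) (eta t.+1 w))).
  by apply: (bounded_mul _ B).
have iVk k := bounded_mul _ B (mVk k) (VnB ^~ k).
have pVk k : past_measurable t.+1 (fun w => zeta w * V (state t.+1 w) k).
  by apply: measurable_funM pz _; exact: past_value.
split=> //.
have psiE w : psi V (state t w) (eta t w) (xi t w) = stage_cost t w
    + gamma * \sum_k varpi (eta t w) k * V (state t.+1 w) k by [].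
pose f w := \sum_k varpi (eta t w) k * V (state t.+1 w) k.
have mf : measurable_fun setT f.
  apply: (measurable_dispatch proc t (Z := fun h w => \sum_k varpi h k * V (state t.+1 w) k)) => h.
  by apply: measurable_sum => k; apply: measurable_funM.
have izf : P.-integrable setT (EFin \o (fun w => zeta w * f w)).
  by apply: (bounded_mul _ B) => // w; apply: kernel_average_le.
transitivity (\int[P]_w (zeta w * stage_cost t w + gamma * (zeta w * f w))).
  by apply: eq_Rintegral => w _; rewrite psiE mulrDr mulrCA.
rewrite RintegralD//; last exact: integrableZl_EFin.
rewrite RintegralZl//; congr (_ + _ * _).
rewrite (Rintegral_state_split proc t izf) (Rintegral_state_split proc t.+1 iVn).
transitivity (\sum_(h : H) \sum_(k : H) varpi h k * \int[P]_w (zeta w * V (state t.+1 w) k * \1_(S t h) w)).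
  apply: eq_bigr => h _.
  transitivity (\sum_(k : H) \int[P]_w (varpi h k * (zeta w * V (state t.+1 w) k * \1_(S t h) w))); last first.
    by apply: eq_bigr => k _; rewrite RintegralZl//; exact: integrable_indic_mul.
  rewrite -Rintegral_sum//; last first.
    by move=> k; apply: integrableZl_EFin => //; exact: integrable_indic_mul.
  rewrite (@eq_on_state t h _ (fun w => \sum_k varpi h k * (zeta w * V (state t.+1 w) k))); last first.
    by move=> w ek; rewrite /f ek mulr_sumr; apply: eq_bigr => k _; rewrite mulrCA.
  apply: eq_Rintegral => w _; rewrite mulr_suml.
  by apply: eq_bigr => k _; rewrite -[LHS]mulrA.
rewrite exchange_big/=; apply: eq_bigr => k _.
rewrite [in RHS](@eq_on_state t.+1 k _ (fun w => zeta w * V (state t.+1 w) k)); last by move=> w ->.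
rewrite (Rintegral_state_split proc t (integrable_indic_mul t.+1 k (iVk k))).
apply: eq_bigr => h _.
rewrite -(transition_Rintegral proc varpi0 (pVk k) h k (iVk k)).
by apply: eq_Rintegral => w _; rewrite -!mulrA; congr (_ * (_ * _)); rewrite mulrC.
Qed.

End controlled_process.

(** * Discounted sums *)

Lemma measurable_fun_inv_ge0 d (T : measurableType d) (R : realType) (D : set T) (h : T -> R) :
  (forall x, D x -> 0 <= h x) -> measurable_fun D h -> measurable_fun D (fun x => (h x)^-1).
Proof.
move=> h0 mh; apply: (eq_measurable_fun (fun x => h x `^ (-1))).
  by move=> x /set_mem Dx; rewrite powR_inv1// h0.
exact: measurableT_comp (measurable_powR _) mh.
Qed.

Section discounting.
Variables (R : realType) (gamma : R).
Hypothesis gamma01 : 0 < gamma < 1.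

(** The sum times (1 - gamma)^2 telescopes. *)
Lemma sum_discount_le T : \sum_(0 <= t < T) t.+1%:R * gamma ^+ t <= (1 - gamma) ^- 2.
Proof.
have /andP[g0 g1] := gamma01; have g1' : 0 < 1 - gamma by rewrite subr_gt0.
rewrite -[leRHS]mul1r ler_pdivlMr ?exprn_gt0//.
(* the defect subtracted from 1 is nonnegative *)
suff -> : (\sum_(0 <= t < T) t.+1%:R * gamma ^+ t) * (1 - gamma) ^+ 2
    = 1 - gamma ^+ T * (1 + T%:R * (1 - gamma)).
  rewrite gerBl mulr_ge0 ?exprn_ge0 ?(ltW g0)// addr_ge0// mulr_ge0//; exact: ltW.
elim: T => [|T IH]; first by rewrite big_nil expr0; ring.
rewrite big_nat_recr//= mulrDl IH (exprS gamma T) -!natr1; ring.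
Qed.

Lemma cvg_discount0 : (fun t => gamma ^+ t * t%:R) @ \oo --> 0.
Proof.
have /andP[g0 g1] := gamma01.
have : cvgn (series (fun t => t.+1%:R * gamma ^+ t)).
  apply: nondecreasing_is_cvgn.
    apply/nondecreasing_seqP => k; rewrite /series/= big_nat_recr//= lerDl.
    by rewrite mulr_ge0// exprn_ge0// ltW.
  by exists ((1 - gamma) ^- 2) => _ [k _ <-]; exact: sum_discount_le.
move=> /cvg_series_cvg_0 h.
apply: (@squeeze_cvgr _ _ _ _ (fun _ => 0) (fun t => t.+1%:R * gamma ^+ t)) => //; last exact: cvg_cst.
apply: nearW => t; rewrite mulr_ge0 ?exprn_ge0 ?(ltW g0)//= mulrC ler_wpM2r ?exprn_ge0 ?(ltW g0)//.
by rewrite ler_nat.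
Qed.

Lemma cvg_discounted_series (b : nat -> R) B : (forall t, `|b t| <= B) ->
  cvgn (series (fun t => gamma ^+ t * b t)).
Proof.
move=> bB; have /andP[g0 g1] := gamma01.
have B0 : 0 <= B by exact: le_trans (bB 0%N).
apply: normed_cvg; apply: (@series_le_cvg _ _ (geometric B gamma)).
- by move=> n; exact: normr_ge0.
- by move=> n; rewrite /= mulr_ge0// exprn_ge0// ltW.
- by move=> n; rewrite /= normrM ger0_norm ?exprn_ge0 ?(ltW g0)// mulrC ler_wpM2r ?exprn_ge0 ?(ltW g0).
- by apply: is_cvg_geometric_series; rewrite gtr0_norm.
Qed.

(** Unrolling T steps leaves a geometric sum of the errors and the tail gamma^T a_T, which
    tends to 0 because [a] grows at most linearly. *)
Lemma discounted_recursion (a b : nat -> R) e C l : (forall t, `|a t| <= C * t.+1%:R) ->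
  (forall t, `|a t - b t - gamma * a t.+1| <= e) ->
  series (fun t => gamma ^+ t * b t) @ \oo --> l -> `|a 0%N - l| <= e / (1 - gamma).
Proof.
move=> aC rec cl; have /andP[g0 g1] := gamma01; have g1' : 0 < 1 - gamma by rewrite subr_gt0.
have C0 : 0 <= C by have := aC 0%N; rewrite mulr1; exact: le_trans.
have step T : `|a 0%N - series (fun t => gamma ^+ t * b t) T - gamma ^+ T * a T| <= e / (1 - gamma) * (1 - gamma ^+ T).
  elim: T => [|T IH]; first by rewrite /series/= big_nil expr0 mul1r subr0 !subrr mulr0 normr0.
  rewrite (_ : a 0%N - _ - _ = (a 0%N - series (fun t => gamma ^+ t * b t) T - gamma ^+ T * a T)
     + gamma ^+ T * (a T - b T - gamma * a T.+1)); last first.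
    by rewrite /series/= big_nat_recr//= exprS; ring.
  rewrite (le_trans (ler_normD _ _))//.
  rewrite (_ : e / (1 - gamma) * (1 - gamma ^+ T.+1) = e / (1 - gamma) * (1 - gamma ^+ T) + gamma ^+ T * e); last first.
    by rewrite exprS; field; rewrite gt_eqF.
  by rewrite lerD// normrM ger0_norm ?exprn_ge0 ?(ltW g0)// ler_wpM2l ?exprn_ge0 ?(ltW g0).
have c0 : (fun T => gamma ^+ T * a T) @ \oo --> 0.
  apply/norm_cvg0P.
  apply: (@squeeze_cvgr _ _ _ _ (fun _ => 0) (fun t => C * (gamma ^+ t * t%:R) + C * gamma ^+ t)).
  - apply: nearW => t; rewrite normr_ge0/= normrM ger0_norm ?exprn_ge0 ?(ltW g0)//.
    apply: (le_trans (ler_wpM2l _ (aC t))); first by rewrite exprn_ge0// ltW.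
    by rewrite -natr1 le_eqVlt; apply/orP; left; apply/eqP; ring.
  - exact: cvg_cst.
  - rewrite -[X in _ --> X](addr0 0) -{1}(mulr0 C); apply: cvgD.
      by apply: cvgMr; exact: cvg_discount0.
    by apply: cvg_geometric; rewrite gtr0_norm.
have cv : (fun T => `|a 0%N - series (fun t => gamma ^+ t * b t) T - gamma ^+ T * a T|) @ \oo --> `|a 0%N - l|.
  rewrite -(subr0 (a 0%N - l)); apply: cvg_norm.
  by apply: cvgB => //; apply: cvgB => //; exact: cvg_cst.
apply: (cvgr_to_le cv); apply: nearW => T; apply: (le_trans (step T)).
have e0 : 0 <= e by exact: le_trans (rec 0%N).
by rewrite ler_piMr ?divr_ge0 ?(ltW g1')// gerBl exprn_ge0// ltW.
Qed.
End discounting.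

Section summable_series.
Context d (T : measurableType d) (R : realType) (mu : {measure set T -> \bar R}).
Variable u : nat -> T -> R.
Hypothesis mu_ : forall t, measurable_fun setT (u t).
Local Notation S n w := (series (u ^~ w) n).

Let mS n : measurable_fun setT (fun w => S n w).
Proof.
rewrite (_ : (fun w => _) = fun w => \sum_(t < n) u t w).
  exact: measurable_sum.
by apply/funext => w; rewrite /series/= big_mkord.
Qed.

(** By completeness, convergence is the Cauchy property, a countable condition. *)
Lemma measurable_cvg_series : measurable [set w | cvgn (series (u ^~ w))].
Proof.
pose A k N i := [set w | `|S (N + i)%N w - S N w| < k.+1%:R^-1].
rewrite (_ : [set w | _] = \bigcap_k \bigcup_N \bigcap_i A k N i).
  apply: bigcapT_measurable => k; apply: bigcupT_measurable => N; apply: bigcapT_measurable => i.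
  rewrite -[X in measurable X]setTI; apply: measurable_fun_ltr => //=.
  by apply: measurableT_comp => //; apply: measurable_funB.
apply/seteqP; split=> [w /= cw k _|w /= Aw].
  have k2 : 0 < k.+1%:R^-1 / 2 :> R by rewrite divr_gt0// invr_gt0.
  have /cvgrPdist_lt/(_ _ k2)[N _ HN] := cw.
  exists N => // i _ /=.
  rewrite /A/= -(subrKA (limn (series (u ^~ w)))) [ltRHS]splitr.
  rewrite (le_lt_trans (ler_normD _ _))// ltrD//; last by apply: HN => /=.
  by rewrite distrC; apply: HN => /=; exact: leq_addr.
apply/cauchy_cvgP; apply: cauchy_exP => e e0.
have [k ke] : exists k, k.+1%:R^-1 < e.
  have [k _ /(_ _ (leqnn k)) /= ke] := near_infty_natSinv_lt (PosNum e0); by exists k.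
have [N _ HN] := Aw k I; exists (S N w); exists N => // j /= Nj.
rewrite -ball_normE/= distrC; apply: lt_trans ke.
by have := HN (j - N)%N I; rewrite /A/= subnKC.
Qed.

(** The limit of a divergent real series is by convention 0, so it is measurable off the set of
    convergence too. *)
Lemma measurable_limn_series : measurable_fun setT (fun w => limn (series (u ^~ w))).
Proof.
pose C := [set w | cvgn (series (u ^~ w))].
have mC : measurable C := measurable_cvg_series.
rewrite (_ : (fun w => _) = (fun w => limn (series (u ^~ w))) \_ C); last first.
  apply/funext => w; rewrite patchE; case: ifPn => // /negP nC.
  by rewrite dvgP// => ?; apply: nC; exact/mem_set.
apply/(measurable_restrictT _ mC).1.
apply: (@measurable_fun_cvg _ _ _ _ (fun n w => S n w)); last by move=> w; exact.
by move=> n; exact: measurable_funTS.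
Qed.

Hypothesis iu : forall t, mu.-integrable setT (EFin \o u t).

(** The bound makes the sum of the absolute values integrable; it is finite almost everywhere,
    where the series converges, and dominates the partial sums. *)
Lemma cvg_Rintegral_series K : (forall n, \sum_(0 <= t < n) \int[mu]_w `|u t w| <= K) ->
  (fun n => \sum_(0 <= t < n) \int[mu]_w u t w) @ \oo --> \int[mu]_w limn (series (u ^~ w)).
Proof.
move=> uK.
pose D w : \bar R := (\sum_(0 <= t <oo) `|u t w|%:E)%E.
have D0 w : (0 <= D w)%E by apply: nneseries_ge0 => t _ _; rewrite lee_fin.
have mn t : measurable_fun setT (fun w => `|u t w|%:E).
  by apply/measurable_EFinP; exact: measurableT_comp.
have mD : measurable_fun setT D.
  by apply: ge0_emeasurable_sum => // t w _ _; rewrite lee_fin.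
have iD : mu.-integrable setT D.
  apply/integrableP; split=> //.
  under eq_integral => w _ do rewrite gee0_abs//.
  rewrite integral_nneseries//.
  rewrite (@le_lt_trans _ _ K%:E) ?ltry//; apply: lime_le.
    by apply: is_cvg_nneseries => t _ _; apply: integral_ge0 => w _; rewrite lee_fin.
  apply: nearW => k; apply: le_trans (_ : (\sum_(0 <= t < k) \int[mu]_w `|u t w|)%:E <= _)%E; last by rewrite lee_fin.
  rewrite -sumEFin le_eqVlt; apply/orP; left; apply/eqP; apply: eq_bigr => t _.
  by rewrite EFin_Rintegral//; exact: integrable_norm (iu t).
have le_D w n : (\sum_(0 <= t < n) `|u t w|%:E <= D w)%E.
  by apply: nneseries_lim_ge => t _ _; rewrite lee_fin.
have [|||||iL _] := @dominated_convergence _ _ _ mu setT measurableT (fun n w => (S n w)%:E)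
    (fun w => (limn (series (u ^~ w)))%:E) D.
- by move=> n; exact/measurable_EFinP.
- by apply/measurable_EFinP; exact: measurable_limn_series.
- apply: filterS (integrable_ae measurableT iD) => w /(_ I) fw _.
  apply: cvg_EFin; first exact: nearW.
  apply: (@normed_cvg _ R); apply: nondecreasing_is_cvgn.
    apply/nondecreasing_seqP => k /=.
    by rewrite /normed_series_of /series/= big_nat_recr//= lerDl.
  exists (fine (D w)) => _ [n _ <-]; rewrite -lee_fin fineK//.
  by rewrite /normed_series_of /series/= -sumEFin.
- exact: iD.
- apply: aeW => w n _; apply: le_trans (le_D w n).
  by rewrite sumEFin lee_fin; exact: ler_norm_sum.
move=> h; have : (fun n => fine (\int[mu]_w (S n w)%:E)%E) @ \oo --> \int[mu]_w limn (series (u ^~ w)).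
  by apply: fine_cvg; rewrite EFin_Rintegral in h.
apply: cvg_trans; apply: near_eq_cvg; apply: nearW => n.
by rewrite /series/= -Rintegral_sum.
Qed.
End summable_series.

(** * Gradient of the value in the parameter *)

Lemma finite_common_radius (R : realFieldType) (H : finType) (T : Type) (nn : T -> R)
    (Q : H -> T -> Prop) :
  (forall h, exists2 dl, 0 < dl & forall z, nn z < dl -> Q h z) ->
  exists2 dl, 0 < dl & forall h z, nn z < dl -> Q h z.
Proof.
move=> hQ.
have ex h : exists dl, 0 < dl /\ forall z, nn z < dl -> Q h z.
  by have [dl ? ?] := hQ h; exists dl.
have [dl Hdl] := choice ex.
have dl0 h : 0 < dl h by have [] := Hdl h.
have S0 : 0 <= \sum_h (dl h)^-1 by apply: sumr_ge0 => h _; rewrite invr_ge0 ltW.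
exists (1 + \sum_h (dl h)^-1)^-1 => [|h z zl]; first by rewrite invr_gt0 ltr_pwDl.
have [_] := Hdl h; apply; apply: (lt_le_trans zl).
rewrite invf_ple ?posrE ?ltr_pwDl// (bigD1 h)//= addrCA lerDl addr_ge0//.
by apply: sumr_ge0 => k _; rewrite invr_ge0 ltW.
Qed.

Lemma cvg_sumr (R : realType) (T : Type) (Fl : set_system T) (FF : Filter Fl) (I : Type)
    (r : seq I) (u : I -> T -> R) (l : I -> R) :
  (forall i, u i @ Fl --> l i) ->
  (fun k => \sum_(i <- r) u i k) @ Fl --> \sum_(i <- r) l i.
Proof.
move=> ul; elim: r => [|i r IH].
  rewrite big_nil (_ : (fun k => _) = cst 0); first exact: cvg_cst.
  by apply/funext => k; rewrite big_nil.
rewrite big_cons (_ : (fun k => _) = fun k => u i k + \sum_(i <- r) u i k); first exact: cvgD.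
by apply/funext => k; rewrite big_cons.
Qed.

Section value_gradient.
Variables (R : realType) (n m d s : nat) (H : finType).
Variables (gamma : R) (varpi : H -> H -> R) (X : set 'rV[R]_n) (U : set 'rV[R]_m).
Variables (c : 'rV[R]_n -> 'rV[R]_m -> 'rV[R]_d -> R).
Variables (F : 'rV[R]_n -> 'rV[R]_m -> 'rV[R]_d -> 'rV[R]_n).
Variables (Xi : set 'rV[R]_d) (M : R).
Hypothesis mXi : measurable Xi.
Hypothesis gamma01 : 0 < gamma < 1.
Hypothesis kern : stochastic_kernel varpi.
Hypothesis mc : measurable_fun setT
    (fun z : 'rV[R]_n * 'rV[R]_m * 'rV[R]_d => c z.1.1 z.1.2 z.2).
Hypothesis cM : forall x u y, X x -> U u -> Xi y -> `|c x u y| <= M.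
Hypothesis mF : measurable_fun setT
    (fun z : 'rV[R]_n * 'rV[R]_m * 'rV[R]_d => F z.1.1 z.1.2 z.2).
Hypothesis FX : forall x u y, X x -> U u -> Xi y -> X (F x u y).
Variable pi : 'rV[R]_n -> H -> 'rV[R]_m.
Hypothesis policy : is_policy X U pi.
Variables (x1 : 'rV[R]_n) (h1 : H).
Hypothesis Xx1 : X x1.
Variables (f : 'rV[R]_d -> H -> 'rV[R]_s -> R) (ths : 'rV[R]_s) (rho : R).
Variable env : H -> 'rV[R]_d -> R.
Hypothesis rho0 : 0 < rho.
Hypothesis hF : forall h y, Xi y -> forall th, euclid_norm (th - ths) <= rho ->
  [/\ differentiable (f y h) th, 0 < f y h th &
      euclid_norm (score f y h th) ^+ 2 * f y h th <= env h y].
Hypothesis dens : forall h th, euclid_norm (th - ths) <= rho -> is_density Xi (fun y => f y h th).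
Hypothesis ienv : forall h, (lebesgue_rV R d).-integrable Xi (fun y => (env h y)%:E).
Variable Vth : 'rV[R]_s -> 'rV[R]_n -> H -> R.
Hypothesis sol : forall th, euclid_norm (th - ths) <= rho ->
  solves gamma varpi X c F Xi pi (fun y h => f y h th) (Vth th).
Variables (disp : measure_display) (Om : measurableType disp) (P : probability Om R).
Variables (xi : nat -> Om -> 'rV[R]_d) (eta : nat -> Om -> H).
Let f0 y h := f y h ths.
Hypothesis proc : is_data_process Xi varpi h1 f0 P xi eta.
Local Notation leb := (lebesgue_rV R d).
Local Notation stage := (stage_value gamma varpi c F).
Local Notation pastT t := (g_sigma_algebraType (histories xi eta t)).
Local Notation past_measurable t Z := (measurable_fun [set: pastT t] (Z : pastT t -> _)).
Local Notation vb := (value_bound gamma M).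
Local Notation state t w := (state F pi x1 xi eta t w).
Local Notation stage_cost t w := (stage_cost c F pi x1 xi eta t w).
Let Vs := Vth ths.
Let psi V x h y := stage V x h (pi x h) y.
Let sc j y h : R := score f y h ths 0 j.

Let norm0 : euclid_norm (ths - ths) <= rho.
Proof.
by rewrite subrr /euclid_norm big1 ?sqrtr0 ?(ltW rho0)// => i _; rewrite mxE expr0n.
Qed.

Let dens0 h : is_density Xi (f0 ^~ h). Proof. exact: dens norm0. Qed.
Let solS : solves gamma varpi X c F Xi pi f0 Vs. Proof. exact: sol norm0. Qed.
Let piU x h : X x -> U (pi x h). Proof. exact: policy.1. Qed.
Let Xixi t w : Xi (xi t w). Proof. exact: (process_xi_support proc). Qed.
Let i_f h th : euclid_norm (th - ths) <= rho -> leb.-integrable Xi (fun y => (f y h th)%:E).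
Proof. by move=> /(dens h)[mf f_0 f_1]; exact: integrable_unit_mass. Qed.

Let i_f' h := i_f h.

Let stX t w : X (state t w). Proof. exact: (stateX FX policy Xx1 proc). Qed.

Let vb0 : 0 <= vb.
Proof.
have [w _] := probability_inhabited P.
by apply: (value_bound_ge0 gamma01 cM piU h1 Xx1); exists (xi 0%N w).
Qed.

Let bound_of th : euclid_norm (th - ths) <= rho -> bounded_by X vb (Vth th).
Proof.
move=> thr; apply: (solution_le mXi gamma01 kern mc cM mF FX piU _ (sol thr)) => h.
exact: dens.
Qed.

Lemma measurable_score j h : measurable_fun Xi (sc j ^~ h).
Proof.
apply: (eq_measurable_fun (fun y => sc j y h * f0 y h * (f0 y h)^-1)).
  move=> y /set_mem Xy; rewrite mulfK//.
  by have [_ f_0 _] := hF h Xy norm0; rewrite gt_eqF.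
apply: measurable_funM.
  exact: (measurable_score_density rho0 (@hF h) (i_f' h)).
by apply: measurable_fun_inv_ge0; have [] := dens0 h.
Qed.

Let iscf j h : leb.-integrable Xi (EFin \o (fun y => `|sc j y h| * f0 y h)).
Proof.
have := integrable_norm (integrable_score_density mXi rho0 (@hF h) (i_f' h) (@ienv h) j).
apply: eq_integrable => // y /set_mem Xy.
by have [_ f_0 _] := hF h Xy norm0; rewrite /= normrM (gtr0_norm f_0).
Qed.

Let B j := \sum_h \int[leb]_(y in Xi) (`|sc j y h| * f0 y h).

Let scB j h : \int[leb]_(y in Xi) (`|sc j y h| * f0 y h) <= B j.
Proof.
rewrite /B (bigD1 h)//= lerDl sumr_ge0// => k _.
by apply: Rintegral_ge0 => y Xy; rewrite mulr_ge0//; have [_ ? _] := dens0 k; auto.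
Qed.

Let b j x k := \int[leb]_(y in Xi) (psi Vs x k y * sc j y k * f0 y k).

Let b_le j x k : X x -> `|b j x k| <= vb * B j.
Proof.
move=> Xx; apply: (@le_trans _ _ (vb * \int[leb]_(y in Xi) `|sc j y k * f0 y k|)).
  rewrite /b; under eq_Rintegral do rewrite -mulrA.
  apply: (Rintegral_mul_bounded mXi).
  - exact: (measurable_policy_stage gamma varpi mc mF FX piU k Xx solS.1).
  - by move=> y Xy; exact: (policy_stage_le gamma01 kern cM FX piU k (bound_of norm0) Xx Xy).
  - exact: (integrable_score_density mXi rho0 (@hF k) (i_f' k) (@ienv k) j).
rewrite ler_wpM2l//; apply: le_trans (scB j k).
rewrite le_eqVlt; apply/orP; left; apply/eqP; apply: eq_Rintegral => y /set_mem Xy.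
by have [_ f_0 _] := hF k Xy norm0; rewrite normrM (gtr0_norm f_0).
Qed.

(** What is left of V_theta - V_thstar after the first-order term and the value propagated to
    the next step are removed. *)
Definition value_increment_error th x h : R :=
  Vth th x h - Vs x h - \sum_j (th - ths) 0 j * b j x h
  - \int[leb]_(y in Xi) ((psi (Vth th) x h y - psi Vs x h y) * f0 y h).

Let one_step e : 0 < e -> exists2 dl, 0 < dl & forall th, euclid_norm (th - ths) < dl ->
  forall x h, X x -> `|value_increment_error th x h| <= e * euclid_norm (th - ths).
Proof.
move=> e0; have /andP[g0 g1] := gamma01; have g1' : 0 < 1 - gamma by rewrite subr_gt0.
have exK h : exists K, 0 <= K /\ forall th, euclid_norm (th - ths) <= rho ->
    \int[leb]_(y in Xi) `|f y h th - f y h ths| <= K * euclid_norm (th - ths).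
  have [K K0 HK] := density_L1_lipschitz mXi rho0 (@hF h) (i_f' h) (@ienv h).
  by exists K.
have [K HK] := choice exK; pose Kt := \sum_h K h.
have K0 h : 0 <= K h by have [] := HK h.
have Kt0 : 0 <= Kt by apply: sumr_ge0.
have nn0 (z : 'rV[R]_s) : 0 <= euclid_norm z by exact: sqrtr_ge0.
have qL th : euclid_norm (th - ths) <= rho -> forall h,
    \int[leb]_(y in Xi) `|f y h th - f0 y h| <= Kt * euclid_norm (th - ths).
  move=> thr h; have [_ /(_ th thr) /le_trans] := HK h; apply.
  by rewrite ler_wpM2r// /Kt (bigD1 h)//= lerDl sumr_ge0.
pose e1 := e / (2 * (vb + 1)).
have vb1 : 0 < vb + 1 by rewrite ltr_wpDl.
have e10 : 0 < e1 by rewrite divr_gt0// mulr_gt0.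
have [dl1 dl10 Hdl1] : exists2 dl, 0 < dl & forall h th, euclid_norm (th - ths) < dl ->
    \int[leb]_(y in Xi) `|f y h th - f y h ths - ((th - ths) *m (score f y h ths)^T) 0 0 * f y h ths|
       <= e1 * euclid_norm (th - ths).
  apply: (finite_common_radius (nn := fun th => euclid_norm (th - ths))) => h.
  exact: (density_L1_differentiable mXi rho0 (@hF h) (i_f' h) (@ienv h)).
(* coefficient of the second-order term of the decomposition *)
pose C := gamma * (vb * Kt / (1 - gamma)) * Kt.
have C0 : 0 <= C.
  by apply: mulr_ge0 => //; apply: mulr_ge0; [exact: ltW|apply: divr_ge0; [exact: mulr_ge0|exact: ltW]].
pose dl2 := e / (2 * (C + 1)).
have dl20 : 0 < dl2 by rewrite divr_gt0// mulr_gt0// ltr_wpDl.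
exists (Num.min dl1 (Num.min dl2 rho)); first by rewrite !lt_min dl10 dl20 rho0.
move=> th; rewrite !lt_min => /and3P[th1 th2 /ltW thr] x h Xx.
set N := euclid_norm (th - ths).
have N0 : 0 <= N by exact: nn0.
have dth k : is_density Xi (fun y => f y k th) by exact: dens.
have lin y : ((th - ths) *m (score f y h ths)^T) 0 0 = \sum_j (th - ths) 0 j * sc j y h.
  by rewrite mxE; apply: eq_bigr => j _; congr (_ * _); rewrite mxE.
have mps := measurable_policy_stage gamma varpi mc mF FX piU h Xx solS.1.
have psB y (Xy : Xi y) := policy_stage_le gamma01 kern cM FX piU h (bound_of norm0) Xx Xy.
have mpt := measurable_policy_stage gamma varpi mc mF FX piU h Xx (sol thr).1.
have iD := integrableB_EFin mXi (i_f h thr) (i_f h norm0).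
have il := integrable_score_linear mXi rho0 (@hF h) (i_f' h) (@ienv h) (th - ths).
have iR := integrableB_EFin mXi iD il.
have isc j := integrable_score_density mXi rho0 (@hF h) (i_f' h) (@ienv h) j.
have Eb : \sum_j (th - ths) 0 j * b j x h = \int[leb]_(y in Xi)
    (psi Vs x h y * (((th - ths) *m (score f y h ths)^T) 0 0 * f y h ths)).
  transitivity (\sum_j \int[leb]_(y in Xi) ((th - ths) 0 j * (psi Vs x h y * (sc j y h * f y h ths)))).
    apply: eq_bigr => j _; rewrite RintegralZl//; last exact: (integrable_mul_bounded mXi mps psB (isc j)).
    by congr (_ * _); apply: eq_Rintegral => y _; rewrite mulrA.
  rewrite -Rintegral_sum//; last first.
    by move=> j; apply: integrableZl_EFin => //; exact: (integrable_mul_bounded mXi mps psB (isc j)).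
  apply: eq_Rintegral => y _; rewrite lin mulr_suml mulr_sumr; apply: eq_bigr => j _.
  by rewrite -mulrA mulrCA.
have -> : value_increment_error th x h = \int[leb]_(y in Xi)
      (psi Vs x h y * (f y h th - f y h ths - ((th - ths) *m (score f y h ths)^T) 0 0 * f y h ths))
    + \int[leb]_(y in Xi) ((psi (Vth th) x h y - psi Vs x h y) * (f y h th - f y h ths)).
  rewrite /value_increment_error Eb.
  rewrite (solutionB_decomposition mXi gamma01 kern mc cM mF FX piU h dth dens0 (sol thr) solS Xx).
  under [X in _ = X + _]eq_Rintegral do rewrite mulrBr.
  rewrite [X in _ = X + _]RintegralB//; last 2 first.
  - exact: (integrable_mul_bounded mXi mps psB iD).
  - exact: (integrable_mul_bounded mXi mps psB il).
  rewrite /psi /f0; ring.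
have bD : bounded_by X (vb * (Kt * N) / (1 - gamma)) (fun z k => Vth th z k - Vs z k).
  apply: (solutionB_le mXi gamma01 kern mc cM mF FX piU dth dens0 (sol thr) solS) => //.
  - exact: mulr_ge0.
  - exact: qL.
rewrite (le_trans (ler_normD _ _))// [e]splitr mulrDl lerD//.
  apply: (le_trans (Rintegral_mul_bounded mXi mps psB iR)).
  apply: (@le_trans _ _ (vb * (e1 * N))); first by rewrite ler_wpM2l// Hdl1.
  rewrite mulrA ler_wpM2r// /e1 mulrA ler_pdivrMr ?mulr_gt0//.
  rewrite (_ : e / 2 * (2 * (vb + 1)) = vb * e + e); last by field.
  by rewrite lerDl ltW.
have pdB y : Xi y -> `|psi (Vth th) x h y - psi Vs x h y| <= gamma * (vb * (Kt * N) / (1 - gamma)).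
  by move=> Xy; exact: (stage_valueB_le c gamma01 kern FX h bD Xx (piU h Xx) Xy).
apply: (le_trans (Rintegral_mul_bounded mXi (measurable_funB mpt mps) pdB iD)).
apply: (@le_trans _ _ (gamma * (vb * (Kt * N) / (1 - gamma)) * (Kt * N))).
  rewrite ler_wpM2l ?qL//; apply: mulr_ge0; first exact: ltW.
  by apply: divr_ge0; [apply: mulr_ge0 => //; exact: mulr_ge0|exact: ltW].
rewrite (_ : _ * (Kt * N) = C * N * N); last by rewrite /C; field; rewrite gt_eqF.
rewrite ler_wpM2r//; apply: (@le_trans _ _ (C * dl2)); first by rewrite ler_wpM2l// ltW.
rewrite /dl2 mulrA ler_pdivrMr ?mulr_gt0 ?ltr_wpDl//.
rewrite (_ : e / 2 * (2 * (C + 1)) = C * e + e); last by field.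
by rewrite lerDl ltW.
Qed.

Let pcst t (a : R) : past_measurable t (cst a). Proof. exact: measurable_cst. Qed.
Let icst (a : R) : P.-integrable setT (EFin \o cst a).
Proof.
apply: (@bounded_integrable _ _ _ P _ `|a|) => //.
Qed.

Let iF0 k : leb.-integrable Xi (EFin \o (fun y => `|1| * f0 y k)).
Proof.
apply: eq_integrable (i_f k norm0) => // y _ /=; by rewrite normr1 mul1r.
Qed.

Let bs j t := \int[P]_w b j (state t w) (eta t w).

Let emission_score t (zeta : Om -> R) j : past_measurable t zeta -> P.-integrable setT (EFin \o zeta) ->
  [/\ P.-integrable setT (EFin \o (fun w => zeta w * (psi Vs (state t w) (eta t w) (xi t w) * sc j (xi t w) (eta t w)))),
      P.-integrable setT (EFin \o (fun w => zeta w * b j (state t w) (eta t w))) &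
      \int[P]_w (zeta w * (psi Vs (state t w) (eta t w) (xi t w) * sc j (xi t w) (eta t w)))
      = \int[P]_w (zeta w * b j (state t w) (eta t w))].
Proof.
move=> pz iz.
exact: (emission_policy mXi gamma01 kern mc cM mF FX policy Xx1 dens0 proc solS.1 (bound_of norm0) pz iz
  (measurable_score j) (iscf j)).
Qed.

Let inner V x k := \int[leb]_(y in Xi) (psi V x k y * f0 y k).

Let emission_value V t (zeta : Om -> R) : bounded_measurable X V -> bounded_by X vb V ->
  past_measurable t zeta -> P.-integrable setT (EFin \o zeta) ->
  [/\ P.-integrable setT (EFin \o (fun w => zeta w * psi V (state t w) (eta t w) (xi t w))),
      P.-integrable setT (EFin \o (fun w => zeta w * inner V (state t w) (eta t w))) &
      \int[P]_w (zeta w * psi V (state t w) (eta t w) (xi t w))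
      = \int[P]_w (zeta w * inner V (state t w) (eta t w))].
Proof.
move=> bV VB pz iz.
have [i1 i2 E] := emission_policy mXi gamma01 kern mc cM mF FX policy Xx1 dens0 proc bV VB pz iz
  (fun=> measurable_cst (1 : R)) iF0.
have innerE x k : \int[leb]_(y in Xi) (psi V x k y * cst 1 y * f0 y k) = inner V x k.
  by apply: eq_Rintegral => y _; rewrite mulr1.
split.
- by apply: eq_integrable i1 => // w _; rewrite /= mulr1.
- by apply: eq_integrable i2 => // w _; rewrite /= -innerE.
- transitivity (\int[P]_w (zeta w * (psi V (state t w) (eta t w) (xi t w) * 1))).
    by apply: eq_Rintegral => w _; rewrite mulr1.
  by rewrite [LHS]E; apply: eq_Rintegral => w _; rewrite -innerE.
Qed.

Let i_value V t : bounded_measurable X V -> bounded_by X vb V ->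
  P.-integrable setT (EFin \o (fun w => V (state t w) (eta t w))).
Proof.
move=> bV VB.
have mVk k := past_measurable_fun proc (past_value mF FX policy Xx1 proc (t := t) k bV).
apply: (@bounded_integrable _ _ _ P _ vb).
  exact: (measurable_dispatch proc t (Z := fun k w => V (state t w) k)).
by move=> w; exact: VB.
Qed.

Let i_b j t : P.-integrable setT (EFin \o (fun w => b j (state t w) (eta t w))).
Proof.
have [_ i _] := emission_score (t := t) j (pcst 1) (icst 1).
by apply: eq_integrable i => // w _ /=; rewrite mul1r.
Qed.

Let le_normr_Rintegral_cst (g : Om -> R) C : P.-integrable setT (EFin \o g) ->
  (forall w, `|g w| <= C) -> `|\int[P]_w g w| <= C.
Proof.
move=> ig gC; apply: (le_trans (le_normr_Rintegral measurableT ig)).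
rewrite -[leRHS](Rintegral_cst_prob P C); apply: le_Rintegral => //; first exact: integrable_norm.
exact: icst.
Qed.

Let bs_le j t : `|bs j t| <= vb * B j.
Proof. by apply: le_normr_Rintegral_cst => // w; exact: b_le. Qed.

Definition value_gradient : 'rV[R]_s := \row_j limn (series (fun t => gamma ^+ t * bs j t)).

Let cvg_gradient j : series (fun t => gamma ^+ t * bs j t) @ \oo --> value_gradient 0 j.
Proof. rewrite mxE; exact: (cvg_discounted_series gamma01 (bs_le j)). Qed.

Let init : forall w, state 0 w = x1 /\ eta 0%N w = h1.
Proof. by move=> w; split=> //; exact: (process_initial proc). Qed.

(** Along the process the expected differences of the values satisfy a discounted recursion
    whose error is uniformly small compared with the distance of the parameters. *)
Lemma value_differentiable e : 0 < e -> exists2 dl, 0 < dl &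
  forall th, euclid_norm (th - ths) < dl ->
  `|Vth th x1 h1 - Vth ths x1 h1 - ((th - ths) *m value_gradient^T) 0 0| <= e * euclid_norm (th - ths).
Proof.
move=> e0; have /andP[g0 g1] := gamma01; have g1' : 0 < 1 - gamma by rewrite subr_gt0.
have e10 : 0 < e * (1 - gamma) by exact: mulr_gt0.
have [dl dl0 Hdl] := one_step e10.
exists (Num.min dl rho); first by rewrite lt_min dl0 rho0.
move=> th; rewrite lt_min => /andP[thd /ltW thr].
have [bV _] := sol thr; have VB := bound_of thr.
have [bS _] := solS; have SB := bound_of norm0.
pose a t := \int[P]_w Vth th (state t w) (eta t w) - \int[P]_w Vs (state t w) (eta t w).
have := @discounted_recursion _ _ gamma01 a (fun t => \sum_j (th - ths) 0 j * bs j t)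
  (e * (1 - gamma) * euclid_norm (th - ths)) (vb + vb) (\sum_j (th - ths) 0 j * value_gradient 0 j).
rewrite (_ : _ / (1 - gamma) = e * euclid_norm (th - ths)); last by field; rewrite gt_eqF.
rewrite (_ : a 0%N - _ = Vth th x1 h1 - Vth ths x1 h1 - ((th - ths) *m value_gradient^T) 0 0); last first.
  rewrite /a; congr (_ - _ - _); last first.
  - by rewrite mxE; apply: eq_bigr => j _; congr (_ * _); rewrite [RHS]mxE.
  - rewrite -[RHS](Rintegral_cst_prob P); apply: eq_Rintegral => w _.
    by have [-> ->] := init w.
  - rewrite -[RHS](Rintegral_cst_prob P); apply: eq_Rintegral => w _.
    by have [-> ->] := init w.
apply.
- move=> t; rewrite (le_trans (ler_normB _ _))// mulrDl.
  by rewrite lerD// (@le_trans _ _ vb)// ?ler_peMr ?ler1n//; apply: le_normr_Rintegral_cst;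
    [exact: i_value|by move=> w; auto|exact: i_value|by move=> w; auto].
- move=> t.
  have [iv1 iv2 iv3] := emission_value (t := t) bV VB (pcst 1) (icst 1).
  have [is1 is2 is3] := emission_value (t := t) bS SB (pcst 1) (icst 1).
  have [_ _ tv] := transition_policy gamma kern mc cM mF FX policy Xx1 proc (t := t) bV VB (pcst 1) (icst 1).
  have [_ _ ts] := transition_policy gamma kern mc cM mF FX policy Xx1 proc (t := t) bS SB (pcst 1) (icst 1).
  have un (u : Om -> R) : \int[P]_w (cst 1 w * u w) = \int[P]_w u w.
    by apply: eq_Rintegral => w _; rewrite mul1r.
  have iu (u : Om -> R) : P.-integrable setT (EFin \o (fun w => cst 1 w * u w)) ->
      P.-integrable setT (EFin \o u).
    by apply: eq_integrable => // w _; rewrite /= mul1r.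
  move: iv2 is2 => /iu iv2 /iu is2.
  have E : gamma * a t.+1 = \int[P]_w inner (Vth th) (state t w) (eta t w)
      - \int[P]_w inner Vs (state t w) (eta t w).
    move: iv3 is3 tv ts; rewrite !un => <- <- -> ->; rewrite /a; ring.
  rewrite E.
  pose err w := value_increment_error th (state t w) (eta t w).
  have errE w : err w = Vth th (state t w) (eta t w) - Vs (state t w) (eta t w)
      - \sum_j (th - ths) 0 j * b j (state t w) (eta t w)
      - (inner (Vth th) (state t w) (eta t w) - inner Vs (state t w) (eta t w)).
    rewrite /err /value_increment_error; congr (_ - _).
    have ips V : bounded_measurable X V -> bounded_by X vb V -> leb.-integrable Xi
        (EFin \o (fun y => psi V (state t w) (eta t w) y * f0 y (eta t w))).
      move=> bW WB; apply: (integrable_mul_bounded mXi _ _ (i_f (eta t w) norm0)).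
        exact: (measurable_policy_stage gamma varpi mc mF FX piU _ (stX t w) bW).
      by move=> y Xy; exact: (policy_stage_le gamma01 kern cM FX piU _ WB (stX t w) Xy).
    rewrite -RintegralB//; [|exact: ips|exact: ips].
    by apply: eq_Rintegral => y _; rewrite mulrBl.
  have isum : P.-integrable setT (EFin \o (fun w => \sum_j (th - ths) 0 j * b j (state t w) (eta t w))).
    by apply: integrable_sum_EFin => // j; exact: integrableZl_EFin.
  have i1 := integrableB_EFin measurableT (i_value t bV VB) (i_value t bS SB).
  have i2 := integrableB_EFin measurableT i1 isum.
  have i3 := integrableB_EFin measurableT iv2 is2.
  have i4 := integrableB_EFin measurableT i2 i3.
  have ierr : P.-integrable setT (EFin \o err).
    by apply: eq_integrable i4 => // w _; rewrite /= errE.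
  rewrite (_ : a t - _ - _ = \int[P]_w err w).
    by apply: le_normr_Rintegral_cst => // w; exact: Hdl.
  under [RHS]eq_Rintegral do rewrite errE.
  rewrite RintegralB// RintegralB// RintegralB//; last exact: i_value.
    rewrite RintegralB//; congr (_ - _ - _).
    rewrite Rintegral_sum//; last by move=> j; exact: integrableZl_EFin.
    by apply: eq_bigr => j _; rewrite RintegralZl.
  exact: i_value.
- rewrite (_ : series _ = fun T => \sum_j (th - ths) 0 j * series (fun t => gamma ^+ t * bs j t) T).
    apply: cvg_sumr => j; apply: cvgMr; exact: cvg_gradient.
  apply/funext => T; rewrite /series/=; under [RHS]eq_bigr do rewrite mulr_sumr.
  rewrite exchange_big/=; apply: eq_bigr => t _; rewrite mulr_sumr; apply: eq_bigr => j _.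
  by rewrite mulrCA.
Qed.

Section score_sum.
Variable j : 'I_s.
Let S t w := \sum_(k < t) sc j (xi k w) (eta k w).

Let sc' k : 'rV[R]_d -> R := (sc j ^~ k) \_ Xi.
Let msc' k : measurable_fun setT (sc' k).
Proof. exact: (measurable_restrictT _ mXi).1 (measurable_score j k). Qed.
Let sc'E k t w : sc' k (xi t w) = sc j (xi t w) k.
Proof. by rewrite /sc' patchE mem_set. Qed.

Let past_score t : past_measurable t.+1 (fun w => sc j (xi t w) (eta t w)).
Proof.
rewrite (_ : (fun w => _) = fun w => sc' (eta t w) (xi t w)); last first.
  by apply/funext => w; rewrite sc'E.
apply: (past_measurable_dispatch h1 (Z := fun k w => sc' k (xi t w))) => k.
have mx : past_measurable t.+1 (xi t) by exact: (past_measurable_xi h1).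
exact: measurableT_comp (msc' k) mx.
Qed.

Let past_S t : past_measurable t (S t).
Proof.
apply: measurable_sum => k.
exact: (past_measurable_le h1 (ltn_ord k) (past_score (t := k))).
Qed.

Let score_moment t : P.-integrable setT (EFin \o (fun w => sc j (xi t w) (eta t w))) /\
  \int[P]_w `|sc j (xi t w) (eta t w)| <= B j.
Proof.
pose phi k (z : R * 'rV[R]_d) : R := `|sc' k z.2|.
have mphi k : measurable_fun setT (phi k).
  by apply: measurableT_comp => //; exact: measurableT_comp (msc' k) measurable_snd.
have phi_le k (w : Om) y : Xi y -> `|phi k (cst 0 w, y)| <= 1 * `|sc j y k|.
  by move=> Xy; rewrite /phi /sc' patchE mem_set// normr_id mul1r.
have em k := emission_Rintegral proc mXi dens0 (pcst (t := t) 0) (mphi k) (icst 1)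
  (iscf j k) (phi_le k).
have mS k : measurable_fun setT (\1_[set w | eta t w = k] : Om -> R).
  by apply: measurable_indic; exact: (measurable_state proc).
have E w : `|sc j (xi t w) (eta t w)| = \sum_k phi k (cst 0 w, xi t w) * \1_[set w | eta t w = k] w.
  rewrite (bigD1 (eta t w))//= big1 ?addr0 => [|k kw].
    by rewrite indicE mem_set// mulr1 /phi sc'E.
  by rewrite indicE memNset ?mulr0// => /= ek; move: kw; rewrite ek eqxx.
have i1 : P.-integrable setT (EFin \o (fun w => `|sc j (xi t w) (eta t w)|)).
  rewrite (_ : (fun w => _) = fun w => \sum_k phi k (cst 0 w, xi t w) * \1_[set w | eta t w = k] w).
    by apply: integrable_sum_EFin => // k; have [] := em k.
  exact/funext.
split.
  apply: (le_integrable_EFin measurableT _ _ i1) => //.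
  exact: (past_measurable_fun proc (past_score (t := t))).
under eq_Rintegral do rewrite E.
rewrite Rintegral_sum//; last by move=> k; have [] := em k.
apply: ler_sum => k _; have [_ i2 ->] := em k.
have innerE : \int[leb]_(y in Xi) (phi k (0, y) * f0 y k) = \int[leb]_(y in Xi) (`|sc j y k| * f0 y k).
  by apply: eq_Rintegral => y Xy; rewrite /phi /sc' patchE Xy.
rewrite -[leRHS](Rintegral_cst_prob P); apply: le_Rintegral => //; first exact: icst.
move=> w _; rewrite innerE ler_piMr ?indicE ?lern1 ?leq_b1//.
by apply: Rintegral_ge0 => y Xy; rewrite mulr_ge0//; have [_ ? _] := dens0 k; auto.
Qed.

Let i_S t : P.-integrable setT (EFin \o S t).
Proof. by apply: integrable_sum_EFin => // k; have [] := score_moment k. Qed.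

Let S_moment t : \int[P]_w `|S t w| <= B j * t%:R.
Proof.
apply: (@le_trans _ _ (\int[P]_w \sum_(k < t) `|sc j (xi k w) (eta k w)|)).
  apply: le_Rintegral => //; first exact: integrable_norm (i_S t).
    by apply: integrable_sum_EFin => // k; apply: integrable_norm; have [] := score_moment k.
  by move=> w _; exact: ler_norm_sum.
rewrite Rintegral_sum//; last by move=> k; apply: integrable_norm; have [] := score_moment k.
rewrite mulr_natr -[X in _ *+ X]card_ord -sumr_const.
by apply: ler_sum => k _; have [] := score_moment k.
Qed.

Let B0 : 0 <= B j.
Proof. by apply: le_trans (score_moment 0).2; apply: Rintegral_ge0. Qed.

Let M0 : 0 <= M.
Proof.
have [w _] := probability_inhabited P.
exact: le_trans (normr_ge0 _) (stage_cost_le cM FX policy Xx1 proc 0 w).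
Qed.

Let cost_le t w : `|stage_cost t w| <= M.
Proof. exact: (stage_cost_le cM FX policy Xx1 proc). Qed.

Let m_cost t : measurable_fun setT (fun w => stage_cost t w).
Proof. exact: (past_measurable_fun proc (past_stage_cost mc mF FX policy Xx1 proc (t := t))). Qed.

Let A t := \int[P]_w (S t w * Vs (state t w) (eta t w)).

Let SE t w : S t.+1 w = S t w + sc j (xi t w) (eta t w).
Proof. by rewrite /S big_ord_recr. Qed.

Let score_recursion t : \int[P]_w (S t.+1 w * stage_cost t w) = A t - gamma * A t.+1 + bs j t.
Proof.
have [bS eS] := solS; have SB := bound_of norm0.
have [_ _ tr] := transition_policy gamma kern mc cM mF FX policy Xx1 proc bS SB (past_S (t := t.+1)) (i_S t.+1).
have [i1 i2 e1] := emission_value bS SB (past_S (t := t)) (i_S t).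
have [i3 i4 e2] := emission_score j (pcst (t := t) 1) (icst 1).
have E : \int[P]_w (S t.+1 w * psi Vs (state t w) (eta t w) (xi t w)) = A t + bs j t.
  transitivity (\int[P]_w (S t w * psi Vs (state t w) (eta t w) (xi t w)
      + cst 1 w * (psi Vs (state t w) (eta t w) (xi t w) * sc j (xi t w) (eta t w)))).
    by apply: eq_Rintegral => w _; rewrite SE mulrDl mul1r [X in _ + X]mulrC.
  rewrite RintegralD// e1 e2; congr (_ + _).
    by apply: eq_Rintegral => w _; rewrite eS//; exact: stX.
  by apply: eq_Rintegral => w _; rewrite mul1r.
by rewrite addrAC -E [X in X - _]tr addrK.
Qed.

Let u t w := gamma ^+ t * stage_cost t w * S t.+1 w.

Let uE t w : u t w = gamma ^+ t * (S t.+1 w * stage_cost t w).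
Proof. by rewrite /u -mulrA [X in _ * X]mulrC. Qed.

Let i_Sc t : P.-integrable setT (EFin \o (fun w => S t.+1 w * stage_cost t w)).
Proof.
rewrite (_ : (fun w => _) = fun w => stage_cost t w * S t.+1 w); last first.
  by apply/funext => w; rewrite mulrC.
exact: (integrable_mul_bounded measurableT (m_cost t) (fun w _ => cost_le t w) (i_S t.+1)).
Qed.

Let u_int t : \int[P]_w u t w = gamma ^+ t * \int[P]_w (S t.+1 w * stage_cost t w).
Proof. by rewrite -RintegralZl//; apply: eq_Rintegral => w _; rewrite uE. Qed.

Let iu t : P.-integrable setT (EFin \o u t).
Proof.
rewrite (_ : u t = fun w => gamma ^+ t * (S t.+1 w * stage_cost t w)); last exact/funext.
exact: integrableZl_EFin.
Qed.

(** For A_t = E[S_t V(x_t, eta_t)], where [S] sums the scores strictly before time t, the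
    recursion [score_recursion] makes A_t solve a discounted recursion without error whose
    source is the difference of the terms of the two series; as A_0 = 0 their sums agree. *)
Lemma score_functional_gradient :
  \int[P]_w limn (series (fun t => u t w)) = value_gradient 0 j.
Proof.
have /andP[g0 g1] := gamma01.
have gt0 t : 0 <= gamma ^+ t by rewrite exprn_ge0// ltW.
have Au t : `|A t| <= vb * B j * t.+1%:R.
  apply: (@le_trans _ _ (vb * \int[P]_w `|S t w|)).
    rewrite /A; under eq_Rintegral do rewrite mulrC.
    apply: (Rintegral_mul_bounded measurableT _ _ (i_S t)).
      by have /integrableP[/measurable_EFinP] := i_value t solS.1 (bound_of norm0).
    by move=> w _; exact: (bound_of norm0).
  rewrite -mulrA ler_wpM2l//; apply: (le_trans (S_moment t)).
  by rewrite ler_wpM2l// ler_nat.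
have cu := @cvg_Rintegral_series _ _ _ P u _ iu (M * B j * (1 - gamma) ^- 2).
have := @discounted_recursion _ _ gamma01 A (fun t => \int[P]_w (S t.+1 w * stage_cost t w) - bs j t)
  0 (vb * B j) (\int[P]_w limn (series (fun t => u t w)) - value_gradient 0 j).
rewrite mul0r normr_le0 subr_eq0.
rewrite (_ : A 0%N = 0); last first.
  by rewrite /A /Rintegral integral0_eq// => w _; rewrite /S big_ord0 mul0r.
rewrite eq_sym subr_eq0 => h; apply/eqP; apply: h => //.
- by move=> t; rewrite score_recursion (_ : _ - _ = 0) ?normr0//; ring.
- rewrite (_ : series _ = fun T => \sum_(0 <= t < T) \int[P]_w u t w - series (fun t => gamma ^+ t * bs j t) T).
    apply: cvgB; last exact: cvg_gradient.
    apply: cu => [t|T]; first by have /integrableP[/measurable_EFinP] := iu t.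
    apply: (@le_trans _ _ (\sum_(0 <= t < T) M * B j * (t.+1%:R * gamma ^+ t))).
      apply: ler_sum => t _.
      apply: (@le_trans _ _ (\int[P]_w (gamma ^+ t * M * `|S t.+1 w|))).
        apply: le_Rintegral => //; first exact: integrable_norm (iu t).
          by apply: integrableZl_EFin => //; exact: integrable_norm (i_S t.+1).
        by move=> w _; rewrite /u normrM ler_wpM2r// normrM ger0_norm// ler_wpM2l.
      rewrite RintegralZl//; last exact: integrable_norm (i_S t.+1).
      apply: (le_trans (ler_wpM2l (mulr_ge0 (gt0 t) M0) (S_moment t.+1))).
      by rewrite le_eqVlt; apply/orP; left; apply/eqP; ring.
    by rewrite -mulr_sumr ler_wpM2l ?mulr_ge0//; exact: sum_discount_le.
  apply/funext => T; rewrite /series/= -sumrB; apply: eq_bigr => t _.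
  by rewrite u_int mulrBr.
Qed.
End score_sum.

Lemma row_expectation_H_functional :
  row_expectation P (fun w => H_functional gamma c F pi x1 f ths (fun i => xi i w) (fun i => eta i w))
  = value_gradient.
Proof.
apply/rowP => j; rewrite [LHS]mxE -score_functional_gradient.
apply: eq_Rintegral => w _; rewrite mxE; congr (limn (series _)); apply/funext => t.
by rewrite /cumulative_score summxE.
Qed.
End value_gradient.

(** * Functions measurable in one variable and continuous in the other *)

Section seq_continuity.
Variables (R : realType) (s : nat) (A : set 'rV[R]_s).

Definition seq_continuous_on (h : 'rV[R]_s -> R) : Prop :=
  forall (u : nat -> 'rV[R]_s) x, A x -> (forall k, A (u k)) -> u @ \oo --> x ->
    (fun k => h (u k)) @ \oo --> h x.

Lemma within_seq_continuous h : {within A, continuous h} -> seq_continuous_on h.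
Proof.
move=> /subspace_continuousP hc u x Ax Au ux.
apply: (@cvg_comp _ _ _ u h _ (within A (nbhs x)) _ _ (hc x Ax)).
move=> W; rewrite /within/= => nW.
have [N _ HN] := ux _ nW; exists N => // k Nk; exact: (HN k Nk (Au k)).
Qed.

Definition grid_cell (k : nat) (x : 'rV[R]_s) : 'rV[int]_s :=
  \row_i Num.floor (x 0 i * k.+1%:R).

Lemma measurable_grid_cell k c : measurable [set x | grid_cell k x = c].
Proof.
rewrite (_ : [set x | _] = \bigcap_(i in [set: 'I_s])
    ((fun x : 'rV[R]_s => x 0 i * k.+1%:R) @^-1` [set` `[(c 0 i)%:~R, (c 0 i + 1)%:~R[])).
  apply: fin_bigcap_measurable => // i _; rewrite -[X in measurable X]setTI.
  have mi : measurable_fun setT (fun x : 'rV[R]_s => x 0 i * k.+1%:R).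
    by apply: measurable_funM => //; exact: measurable_coord.
  exact: mi.
apply/seteqP; split=> [x /= <- i _|x /= xc].
  by rewrite /= in_itv/= mxE; exact: floor_itv.
apply/rowP => i; rewrite mxE; apply/eqP; rewrite floor_eq.
by have := xc i I; rewrite /= in_itv.
Qed.

Lemma grid_cell_close k x y i : grid_cell k x = grid_cell k y -> `|x 0 i - y 0 i| < k.+1%:R^-1.
Proof.
move=> /rowP/(_ i); rewrite !mxE => E.
have /andP[a1 a2] := floor_itv (x 0 i * k.+1%:R).
have /andP[b1 b2] := floor_itv (y 0 i * k.+1%:R).
rewrite -E in b1 b2; rewrite intrD in a2 b2.
have k0 : 0 < k.+1%:R :> R by rewrite ltr0n.
rewrite -[ltRHS]mul1r ltr_pdivlMr// -[X in _ * X](gtr0_norm k0) -normrM mulrBl.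
by rewrite ltr_norml; apply/andP; split; lra.
Qed.

(** The function is the limit of the functions that read [x] off at one point of [A] in each cell of
    a finer and finer grid, and there are only countably many cells. *)
Lemma caratheodory d (T : measurableType d) (G : T -> 'rV[R]_s -> R) : measurable A ->
  (forall x, A x -> measurable_fun setT (G ^~ x)) -> (forall w, seq_continuous_on (G w)) ->
  measurable_fun setT (fun z : T * 'rV[R]_s => G z.1 z.2 * \1_A z.2).
Proof.
move=> mA mG cG.
have ex k c : exists g : T -> R, measurable_fun setT g /\ forall x, A x -> grid_cell k x = c ->
    exists t, [/\ A t, grid_cell k t = c & g = G ^~ t].
  have [[t [At tc]]|no] := pselect (exists t, A t /\ grid_cell k t = c).
    by exists (G ^~ t); split; [exact: mG|move=> x Ax xc; exists t].
  exists (cst 0); split; first exact: measurable_cst.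
  by move=> x Ax xc; exfalso; apply: no; exists x.
have [g0 Hg0] := choice (fun kc : nat * 'rV[int]_s => ex kc.1 kc.2).
pose g_ k c := g0 (k, c); have Hg_ k c := Hg0 (k, c).
pose Gk k (z : T * 'rV[R]_s) := g_ k (grid_cell k z.2) z.1.
have mGk k : measurable_fun setT (Gk k).
  move=> _ Y mY; rewrite setTI.
  rewrite (_ : _ @^-1` Y = \bigcup_c ((g_ k c @^-1` Y) `*` [set x | grid_cell k x = c])).
    apply: countable_bigcupT_measurable => // c.
    apply: measurableX; last exact: measurable_grid_cell.
    by rewrite -[X in measurable X]setTI; apply: (Hg_ k c).1.
  apply/seteqP; split=> [[w x] /= Yx|[w x] [c _ [/= Yx xc]]]; first by exists (grid_cell k x).
  by rewrite /Gk/= xc.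
rewrite (_ : (fun z => _) = (fun z : T * 'rV[R]_s => G z.1 z.2) \_ (setT `*` A)); last first.
  apply/funext => -[w x] /=; rewrite patchE indicE.
  have [/set_mem Ax|/negP nAx] := boolP (x \in A).
    by rewrite mem_set// mulr1.
  by rewrite memNset ?mulr0// => -[_ /mem_set].
have mTA : measurable ([set: T] `*` A) by exact: measurableX.
apply: (measurable_restrictT (fun z : T * 'rV[R]_s => G z.1 z.2) mTA).1.
apply: (@measurable_fun_cvg _ _ _ _ Gk) => [k|[w x] [_ /= Ax]].
  exact: measurable_funTS.
have ext k : exists t, [/\ A t, grid_cell k t = grid_cell k x & g_ k (grid_cell k x) = G ^~ t].
  by have [_ /(_ x Ax erefl)] := Hg_ k (grid_cell k x).
have [u Hu] := choice ext.
rewrite (_ : Gk ^~ (w, x) = fun k => G w (u k)); last first.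
  by apply/funext => k; rewrite /Gk/=; have [_ _ ->] := Hu k.
apply: cG => //; first by move=> k; have [] := Hu k.
apply/cvg_ballP => e e0; have [N _ HN] := near_infty_natSinv_lt (PosNum e0).
exists N => // k /= Nk; split=> // i j.
rewrite -ball_normE/= ord1 distrC; have [_ uc _] := Hu k.
exact: lt_trans (grid_cell_close j uc) (HN _ Nk).
Qed.

Lemma seq_continuous_measurable h : measurable A -> seq_continuous_on h -> measurable_fun A h.
Proof.
move=> mA ch.
have := caratheodory (T := unit) (G := fun _ => h) mA (fun x _ => measurable_cst _) (fun _ => ch).
move=> m1; have m2 : measurable_fun setT (fun x : 'rV[R]_s => h x * \1_A x).
  exact: measurableT_comp m1 (measurable_pair1 tt).
apply: (eq_measurable_fun (fun x => h x * \1_A x)); last exact: measurable_funTS.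
by move=> x /set_mem Ax; rewrite indicE mem_set// mulr1.
Qed.

End seq_continuity.

(** * Continuity of the value and the posterior density *)

Section value_continuity.
Variables (R : realType) (n m d s : nat) (H : finType).
Variables (gamma : R) (varpi : H -> H -> R) (X : set 'rV[R]_n) (U : set 'rV[R]_m).
Variables (c : 'rV[R]_n -> 'rV[R]_m -> 'rV[R]_d -> R).
Variables (F : 'rV[R]_n -> 'rV[R]_m -> 'rV[R]_d -> 'rV[R]_n).
Variables (Xi : set 'rV[R]_d) (M : R).
Hypothesis mXi : measurable Xi.
Hypothesis gamma01 : 0 < gamma < 1.
Hypothesis kern : stochastic_kernel varpi.
Hypothesis mc : measurable_fun setT
    (fun z : 'rV[R]_n * 'rV[R]_m * 'rV[R]_d => c z.1.1 z.1.2 z.2).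
Hypothesis cM : forall x u y, X x -> U u -> Xi y -> `|c x u y| <= M.
Hypothesis mF : measurable_fun setT
    (fun z : 'rV[R]_n * 'rV[R]_m * 'rV[R]_d => F z.1.1 z.1.2 z.2).
Hypothesis FX : forall x u y, X x -> U u -> Xi y -> X (F x u y).
Variable pi : 'rV[R]_n -> H -> 'rV[R]_m.
Hypothesis piU : forall x h, X x -> U (pi x h).
Hypothesis vb0 : 0 <= value_bound gamma M.
Variables (f : 'rV[R]_d -> H -> 'rV[R]_s -> R) (Theta : set 'rV[R]_s).
Variable Vth : 'rV[R]_s -> 'rV[R]_n -> H -> R.
Hypothesis dens : forall h th, Theta th -> is_density Xi (fun y => f y h th).
Hypothesis fcont : forall y h, Xi y -> seq_continuous_on Theta (f y h).
Hypothesis sol : forall th, Theta th ->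
  solves gamma varpi X c F Xi pi (fun y h => f y h th) (Vth th).

(** Pointwise convergence of the densities implies convergence in L^1 by Scheffe's lemma, and
    the value is Lipschitz for the L^1 distance. *)
Lemma value_seq_continuous x h : X x -> seq_continuous_on Theta (fun th => Vth th x h).
Proof.
move=> Xx u th Tth Tu uth; have /andP[g0 g1] := gamma01.
pose L k := \sum_h \int[lebesgue_rV R d]_(y in Xi) `|f y h (u k) - f y h th|.
have L0 k : 0 <= L k by apply: sumr_ge0 => l _; exact: Rintegral_ge0.
have cL : L @ \oo --> 0.
  suff : L @ \oo --> \sum_(h : H) (0 : R) by rewrite big1_eq.
  apply: cvg_sumr => l; have [mf f0 f1] := dens l Tth.
  apply: (scheffe mXi (f_ := fun k y => f y l (u k))) => //.
  - by move=> k; have [] := dens l (Tu k).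
  - by move=> k; have [] := dens l (Tu k).
  - by move=> k; have [] := dens l (Tu k).
  - by move=> y Xy; exact: fcont.
apply/subr_cvg0; apply/norm_cvg0P.
apply: (@squeeze_cvgr _ _ _ _ (fun _ => 0) (fun k => value_bound gamma M / (1 - gamma) * L k)).
- apply: nearW => k; rewrite normr_ge0/=.
  rewrite mulrAC; apply: (solutionB_le mXi gamma01 kern mc cM mF FX piU _ _ (sol (Tu k)) (sol Tth)) => //.
  + by move=> l; exact: dens.
  + by move=> l; exact: dens.
  + move=> l; rewrite /L (bigD1 l)//= lerDl; apply: sumr_ge0 => l' _; exact: Rintegral_ge0.
- exact: cvg_cst.
- rewrite -(mulr0 (value_bound gamma M / (1 - gamma))); exact: cvgMr.
Qed.

End value_continuity.

Section posterior_facts.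
Variables (R : realType) (d s : nat) (H : finType).
Variables (Xi : set 'rV[R]_d) (Theta : set 'rV[R]_s) (varpi : H -> H -> R).
Variables (f : 'rV[R]_d -> H -> 'rV[R]_s -> R) (p : 'rV[R]_s -> R).
Variables (h1 : H) (g : 'rV[R]_d -> H -> R).
Variables (disp : measure_display) (Om : measurableType disp) (P : probability Om R).
Variables (xi : nat -> Om -> 'rV[R]_d) (eta : nat -> Om -> H).
Hypothesis proc : is_data_process Xi varpi h1 g P xi eta.
Hypothesis mXi : measurable Xi.
Hypothesis mTheta : measurable Theta.
Hypothesis varpi0 : forall h k, 0 <= varpi h k.
Hypothesis fpos : forall x h th, Xi x -> Theta th -> 0 < f x h th.
Hypothesis mf : forall h th, Theta th -> measurable_fun Xi (fun x => f x h th).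
Hypothesis fcont : forall y h, Xi y -> seq_continuous_on Theta (f y h).
Hypothesis mp : measurable_fun Theta p.
Hypothesis p0 : forall th, Theta th -> 0 <= p th.
Local Notation leb := (lebesgue_rV R s).
Local Notation lik w N th := (likelihood varpi f (xi ^~ w) (eta ^~ w) N th).
Local Notation post w N th := (posterior Theta varpi f p (xi ^~ w) (eta ^~ w) N th).
Let Xixi t w : Xi (xi t w). Proof. exact: (process_xi_support proc). Qed.

(** Extended by 0 outside [Theta], so that integrals over the parameter can be taken over the
    whole space. *)
Definition posterior_density (N : nat) (w : Om) (th : 'rV[R]_s) : R := post w N th * \1_Theta th.

Let kernel N w th := lik w N th * p th * \1_Theta th.
Let Z N w := \int[leb]_th kernel N w th.

Let kernel_ge0 N w th : 0 <= kernel N w th.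
Proof.
rewrite /kernel indicE; have [/set_mem Tth|_] := boolP (th \in Theta); last by rewrite mulr0.
rewrite mulr1; apply: mulr_ge0; last exact: p0.
apply: mulr_ge0; first exact/ltW/fpos.
by apply: prodr_ge0 => i _; apply: mulr_ge0 => //; exact/ltW/fpos.
Qed.

Let measurable_density i : measurable_fun setT
  (fun z : Om * 'rV[R]_s => f (xi i z.1) (eta i z.1) z.2 * \1_Theta z.2).
Proof.
apply: (caratheodory (G := fun w th => f (xi i w) (eta i w) th)) => //.
- move=> th Tth; pose fh h : 'rV[R]_d -> R := (fun x => f x h th) \_ Xi.
  have mfh h : measurable_fun setT (fh h).
    exact: (measurable_restrictT (fun x => f x h th) mXi).1 (mf h Tth).
  rewrite (_ : (fun w => _) = fun w => fh (eta i w) (xi i w)); last first.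
    by apply/funext => w; rewrite /fh patchE mem_set.
  apply: (measurable_dispatch proc i (Z := fun h w => fh h (xi i w))) => h.
  exact: measurableT_comp (mfh h) (process_xi_measurable proc i).
- by move=> w; exact: fcont.
Qed.

Let measurable_transition i : measurable_fun setT (fun w : Om => varpi (eta i.-1 w) (eta i w)).
Proof.
apply: (measurable_dispatch proc i (Z := fun h w => varpi (eta i.-1 w) h)) => h.
by apply: (measurable_dispatch proc i.-1 (Z := fun k w => varpi k h)) => k; exact: measurable_cst.
Qed.

Let measurable_prior : measurable_fun setT (fun th => p th * \1_Theta th).
Proof.
rewrite (_ : (fun th => _) = p \_ Theta); first exact: (measurable_restrictT p mTheta).1.
by apply/funext => th; rewrite patchE indicE; case: ifP => _; rewrite (mulr1, mulr0).
Qed.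

Let kernelE N w th : kernel N w th = f (xi 0%N w) (eta 0%N w) th * \1_Theta th
  * (\prod_(1 <= i < N) (f (xi i w) (eta i w) th * \1_Theta th * varpi (eta i.-1 w) (eta i w)))
  * (p th * \1_Theta th).
Proof.
rewrite /kernel indicE; case: (th \in Theta); last by rewrite !mulr0.
by rewrite !mulr1; under [in RHS]eq_bigr do rewrite mulr1.
Qed.

Let measurable_kernel N : measurable_fun setT (fun z : Om * 'rV[R]_s => kernel N z.1 z.2).
Proof.
under eq_fun do rewrite kernelE.
apply: measurable_funM; last exact: measurableT_comp measurable_prior measurable_snd.
apply: measurable_funM; first exact: measurable_density.
apply: measurable_prod => i _; apply: measurable_funM; first exact: measurable_density.
exact: measurableT_comp (measurable_transition i) measurable_fst.
Qed.

Let measurable_Z N : measurable_fun setT (Z N).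
Proof. exact: (measurable_Rintegral_param leb (measurable_kernel N)). Qed.

Let Z_ge0 N w : 0 <= Z N w.
Proof. by apply: Rintegral_ge0 => th _; exact: kernel_ge0. Qed.

Let posterior_densityE N w th : posterior_density N w th = kernel N w th * (Z N w)^-1.
Proof.
rewrite /posterior_density /posterior /kernel mulrAC; congr (_ * _^-1).
rewrite Rintegral_mkcond; apply: eq_Rintegral => t _.
by rewrite /kernel patchE indicE; case: (t \in Theta); rewrite (mulr1, mulr0).
Qed.

Let measurable_posterior_joint N :
  measurable_fun setT (fun z : Om * 'rV[R]_s => posterior_density N z.1 z.2).
Proof.
under eq_fun do rewrite posterior_densityE.
apply: measurable_funM (measurable_kernel N) _.
have mZ : measurable_fun setT (fun w => (Z N w)^-1) by exact: measurable_fun_inv_ge0.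
exact: measurableT_comp mZ measurable_fst.
Qed.

Lemma measurable_posterior_density N w : measurable_fun setT (posterior_density N w).
Proof. exact: measurableT_comp (measurable_posterior_joint N) (measurable_pair1 w). Qed.

Lemma posterior_density_ge0 N w th : 0 <= posterior_density N w th.
Proof. by rewrite posterior_densityE mulr_ge0 ?invr_ge0. Qed.

Lemma posterior_density_support N w th : posterior_density N w th != 0 -> Theta th.
Proof.
rewrite /posterior_density indicE; have [/set_mem//|_] := boolP (th \in Theta).
by rewrite mulr0 eqxx.
Qed.

(** Division by 0 gives 0 and an infinite integral counts as 0, so a sample of infinite or
    vanishing mass yields the zero density. *)
Lemma posterior_density_mass N w :
  posterior_density N w = cst 0 \/ \int[leb]_th posterior_density N w th = 1.
Proof.
have [Z0|Z0] := eqVneq (Z N w) 0.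
  by left; apply/funext => th; rewrite posterior_densityE Z0 invr0 mulr0.
right; rewrite (@eq_Rintegral _ _ _ leb setT (fun th => kernel N w th * (Z N w)^-1)); last first.
  by move=> th _; exact: posterior_densityE.
have mk : measurable_fun setT (kernel N w).
  exact: measurableT_comp (measurable_kernel N) (measurable_pair1 w).
rewrite RintegralZr//; first by rewrite mulfV.
apply/integrableP; split; first exact/measurable_EFinP.
under eq_integral do rewrite /= ger0_norm//.
rewrite ltNge leye_eq; apply/negP => /eqP Zoo.
by move: Z0; rewrite /Z /Rintegral Zoo eqxx.
Qed.

Lemma posterior_expectationE N w Y : posterior_expectation Theta varpi f p (xi ^~ w) (eta ^~ w) N Y
  = \int[leb]_th (Y th * posterior_density N w th).
Proof.
rewrite /posterior_expectation Rintegral_mkcond; apply: eq_Rintegral => th _.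
by rewrite /posterior_density patchE indicE; case: (th \in Theta); rewrite (mulr1, mulr0)// mulr0.
Qed.

Let restrict_posterior N w (Y : 'rV[R]_s -> R) th :
  Y th * posterior_density N w th = (Y \_ Theta) th * posterior_density N w th.
Proof.
rewrite patchE; have [//|nT] := boolP (th \in Theta).
by rewrite /posterior_density indicE (negbTE nT) !mulr0.
Qed.

Lemma measurable_mul_posterior_density N w (Y : 'rV[R]_s -> R) : measurable_fun Theta Y ->
  measurable_fun setT (fun th => Y th * posterior_density N w th).
Proof.
move=> mY; under eq_fun do rewrite restrict_posterior.
apply: measurable_funM (measurable_posterior_density N w).
exact: (measurable_restrictT Y mTheta).1.
Qed.

Lemma measurable_posterior_expectation N (Y : 'rV[R]_s -> R) : measurable_fun Theta Y -> measurable_fun setT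
  (fun w => posterior_expectation Theta varpi f p (xi ^~ w) (eta ^~ w) N Y).
Proof.
move=> mY; under eq_fun do rewrite posterior_expectationE.
apply: (measurable_Rintegral_param leb (psi := fun z => Y z.2 * posterior_density N z.1 z.2)).
under eq_fun do rewrite restrict_posterior.
apply: measurable_funM (measurable_posterior_joint N).
exact: measurableT_comp ((measurable_restrictT Y mTheta).1 mY) measurable_snd.
Qed.

End posterior_facts.

(** * Tightness and moments from the normal limit *)

Lemma Rintegral1_integral d (T : measurableType d) (R : realType) (mu : {measure set T -> \bar R})
    (h : T -> R) : (forall x, 0 <= h x) ->
  \int[mu]_x h x = 1 -> (\int[mu]_x (h x)%:E = 1)%E.
Proof.
move=> h0; rewrite /Rintegral.
by case: (\int[mu]_x (h x)%:E)%E => [r /= ->//| |] /= /eqP; rewrite eq_sym oner_eq0.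
Qed.

Section tightness.
Variables (R : realType) (s : nat) (Sigma : 'M[R]_s).
Variables (disp : measure_display) (Om : measurableType disp) (P : probability Om R).
Variable Y : nat -> Om -> 'rV[R]_s.
Local Notation mu := (lebesgue_rV R s).
Local Notation phi := (normal_density Sigma).
Hypothesis mY : forall N, (0 < N)%N -> measurable_fun setT (Y N).
Hypothesis cY : cvg_in_distribution P Y (mvnormal_expectation Sigma).

(** Test convergence in distribution against the constant function 1. *)
Lemma normal_mass1 : (\int[mu]_x (phi x)%:E = 1)%E.
Proof.
apply: Rintegral1_integral; first exact: normal_density_ge0.
have bnd : exists M : R, forall x : 'rV[R]_s, `|(cst 1 x : R)| <= M by exists 1 => x; rewrite normr1.
have cc : continuous (cst 1 : 'rV[R]_s -> R) by exact: cst_continuous.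
have := cY cc bnd.
rewrite (_ : (fun N => \int[P]_w cst 1 (Y N w)) = cst 1); last first.
  by apply/funext => N; exact: Rintegral_cst_prob.
move=> c1; have <- : mvnormal_expectation Sigma (cst 1) = 1.
  by apply: (cvg_unique (@Rhausdorff R) c1); exact: cvg_cst.
by apply: eq_Rintegral => x _; rewrite mul1r.
Qed.

(** The test function min(1, |Phi| / L) dominates the indicator of |Phi| > L, and its mean under
    the limit is at most that of |Phi| divided by L. *)
Lemma tight_continuous_image (Phi : 'rV[R]_s -> R) : continuous Phi ->
  mu.-integrable setT (EFin \o (fun x => Phi x * phi x)) -> tight P (fun N w => Phi (Y N w)).
Proof.
move=> cPhi iPhi e e0.
have mPhi : measurable_fun setT Phi.
  apply: (seq_continuous_measurable measurableT) => u x _ _ ux W nW.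
  exact: (ux _ (cPhi x W nW)).
pose E := \int[mu]_x (`|Phi x * phi x|).
have E0 : 0 <= E by apply: Rintegral_ge0.
pose L := 2 * E / e + 1.
have L0 : 0 < L by rewrite ltr_wpDl// divr_ge0 ?mulr_ge0// ltW.
pose g x := Num.min 1 (L^-1 * `|Phi x|).
have g0 x : 0 <= g x by rewrite le_min ler01 mulr_ge0// invr_ge0 ltW.
have g1 x : g x <= 1 by rewrite ge_min lexx.
have gb : exists M, forall x, `|g x| <= M by exists 1 => x; rewrite ger0_norm.
have cg : continuous g.
  have ch : continuous (fun r : R => Num.min 1 (L^-1 * `|r|)).
    move=> r; apply: (@continuous_min _ _ (cst 1) (fun r : R => L^-1 * `|r|)).
      exact: cst_continuous.
    by apply: cvgMr; exact: norm_continuous.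
  move=> x; apply: (@continuous_comp _ _ _ Phi (fun r : R => Num.min 1 (L^-1 * `|r|)) x (cPhi x)).
  exact: ch.
have limle : mvnormal_expectation Sigma g < e.
  have mphi := measurable_normal_density Sigma; have phi0 := normal_density_ge0 Sigma.
  have mg : measurable_fun setT g.
    by apply: measurable_minr => //; apply: measurable_funM => //; exact: measurableT_comp.
  have key x : g x * phi x <= L^-1 * `|Phi x * phi x|.
    rewrite normrM [`|phi x|]ger0_norm// [leRHS]mulrA; apply: ler_wpM2r => //.
    by rewrite /g ge_min lexx orbT.
  have idom := integrableZl_EFin L^-1 measurableT (integrable_norm iPhi).
  apply: (@le_lt_trans _ _ (\int[mu]_x (L^-1 * `|Phi x * phi x|))).
    apply: le_Rintegral => //.
    apply: (le_integrable_EFin measurableT _ _ idom); first exact: measurable_funM.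
    by move=> x _; rewrite [leLHS]ger0_norm ?key// mulr_ge0.
  rewrite RintegralZl//; last exact: integrable_norm.
  rewrite -/E mulrC ltr_pdivrMr// /L mulrDr mulr1 mulrCA divff ?gt_eqF// mulr1.
  by lra.
exists L; near=> N.
have N0 : (0 < N)%N by near: N; exists 1%N.
have lt_e : \int[P]_w g (Y N w) < e.
  by near: N; apply: (cvgr_lt _ (cY cg gb)).
have mgY : measurable_fun setT (fun w => g (Y N w)).
  apply: measurableT_comp (mY N0).
  by apply: measurable_minr => //; apply: measurable_funM => //; exact: measurableT_comp.
have mA : measurable [set w | L < `|Phi (Y N w)|].
  by apply: measurable_gt_norm; exact: measurableT_comp mPhi (mY N0).
apply: le_trans (_ : (\int[P]_w \1_[set w | L < `|Phi (Y N w)|] w)%:E <= _)%E; first by rewrite Rintegral_indic_prob// fineK// fin_num_measure.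
rewrite lee_fin; apply: le_trans (ltW lt_e); apply: le_Rintegral => //.
- by apply: (@bounded_integrable _ _ _ P _ 1) => // w; rewrite ger0_norm ?indicE// lern1 leq_b1.
- by apply: (@bounded_integrable _ _ _ P _ 1) => // w; rewrite ger0_norm.
move=> w _; rewrite indicE.
have [/set_mem /= Lw|_] := boolP (w \in [set w | L < `|Phi (Y N w)|]); last exact: g0.
by rewrite le_min lexx/= mulrC ler_pdivlMr// mul1r ltW.
Unshelve. all: by end_near. Qed.
End tightness.

Lemma compact_sqnorm_bounded (R : realType) (s : nat) (A : set 'rV[R]_s) : compact A ->
  exists B, forall x, A x -> sqnorm x <= B.
Proof.
move=> /compact_bounded [K [_ HK]].
exists (\sum_(i < s) (K + 1) ^+ 2) => x Ax; apply: ler_sum => i _.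
have xK : `|x| <= K + 1 by apply: HK => //; rewrite ltrDl.
have xi : `|x 0 i| <= K + 1.
  apply: le_trans xK; rewrite [leRHS]mx_normrE.
  by rewrite (le_bigmax _ (fun ij : 'I_1 * 'I_s => `|x ij.1 ij.2|) (0, i)).
by rewrite -[leLHS]real_normK ?num_real// lerXn2r// nnegrE// (le_trans _ xi).
Qed.

(** At distance at least [dl] from [ths], constants and linear terms are dominated by the
    squared distance. *)
Lemma global_expansion (R : realType) (s : nat) (Theta : set 'rV[R]_s) (v : 'rV[R]_s -> R)
    (ths g : 'rV[R]_s) (B : R) : 0 <= B -> (forall x, Theta x -> `|v x - v ths| <= B) ->
  (forall e, 0 < e -> exists2 dl, 0 < dl & forall x, euclid_norm (x - ths) < dl ->
     `|v x - v ths - ((x - ths) *m g^T) 0 0| <= e * euclid_norm (x - ths)) ->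
  forall e, 0 < e -> exists2 C, 0 <= C & forall x, Theta x ->
     `|v x - v ths - ((x - ths) *m g^T) 0 0| <=
     e * euclid_norm (x - ths) + C * euclid_norm (x - ths) ^+ 2.
Proof.
move=> B0 vB dv e e0; have [dl dl0 Hdl] := dv e e0.
pose G := s%:R * euclid_norm g.
have G0 : 0 <= G by rewrite mulr_ge0// sqrtr_ge0.
exists (B / dl ^+ 2 + G / dl).
  by rewrite addr_ge0// divr_ge0// ?exprn_ge0// ltW.
move=> x Tx; set n := euclid_norm (x - ths); have n0 : 0 <= n by exact: sqrtr_ge0.
have [ndl|dln] := ltP n dl.
  rewrite (le_trans (Hdl x ndl))// lerDl mulr_ge0 ?sqr_ge0// addr_ge0//.
    by rewrite divr_ge0 ?exprn_ge0// ltW.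
  by rewrite divr_ge0// ltW.
rewrite (le_trans (ler_normB _ _))// ler_wpDl ?mulr_ge0 ?(ltW e0)// mulrDl lerD//.
  rewrite (le_trans (vB x Tx))// mulrAC ler_pdivlMr ?exprn_gt0// ler_wpM2l//.
  by rewrite lerXn2r// nnegrE// ltW.
rewrite (le_trans (inner_le_euclid_norm _ _))// -/n (_ : s%:R * (n * euclid_norm g) = G * n); last first.
  by rewrite /G; ring.
have -> : G / dl * n ^+ 2 = G * (n ^+ 2 / dl) by field; rewrite gt_eqF.
by apply: ler_wpM2l => //; rewrite ler_pdivlMr// expr2; apply: ler_wpM2l.
Qed.

Lemma rescaled_second_moment (R : realType) (s : nat) (Sigma : 'M[R]_s) (Theta : set 'rV[R]_s)
    (rho : 'rV[R]_s -> R) (th : 'rV[R]_s) (r : R) : 0 < r -> compact Theta ->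
  (\int[lebesgue_rV R s]_x (normal_density Sigma x)%:E = 1)%E ->
  measurable_fun setT rho -> (forall x, 0 <= rho x) -> (forall x, rho x != 0 -> Theta x) ->
  (rho = cst 0 \/ \int[lebesgue_rV R s]_x rho x = 1) ->
  (\int[lebesgue_rV R s]_x ((1 + sqnorm x) *
     `|rescaled rho th r x - normal_density Sigma x|)%:E < +oo)%E ->
  (lebesgue_rV R s).-integrable setT (EFin \o (fun x => (1 + sqnorm x) * normal_density Sigma x)).
Proof.
move=> r0 cT mass1 mrho rho_0 suppT rho01 fin.
have [B HB] := compact_sqnorm_bounded cT.
have k0 x : 0 <= rescaled rho th r x by rewrite mulr_ge0// exprn_ge0// ltW.
have mk := measurable_rescaled th r mrho.
apply: (@normal_second_moment _ _ _ (rescaled rho th r) (r ^- 2 * (2 * B + 2 * sqnorm th))) => //.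
- apply/integrableP; split; first exact/measurable_EFinP.
  under eq_integral do rewrite /= ger0_norm//.
  case: rho01 => [rhoE|rho1].
    rewrite integral0_eq ?ltry// => x _.
    by rewrite /rescaled rhoE mulr0.
  rewrite Rintegral1_integral ?ltry//.
  by rewrite Rintegral_rescaled.
- move=> x kx; have /suppT/HB Tx : rho (th + r *: x) != 0.
    by apply: contra_neq kx => h; rewrite /rescaled h mulr0.
  rewrite mulrC ler_pdivlMr ?exprn_gt0// mulrC -sqnormZ.
  rewrite (_ : r *: x = (th + r *: x) + - th); last by rewrite addrAC subrr add0r.
  apply: (le_trans (sqnormD_le _ _)).
  rewrite -[- th]scaleN1r sqnormZ sqrrN expr1n mul1r.
  by rewrite lerD2r ler_wpM2l.
Qed.

(** * Asymptotic normality *)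

Lemma closed_measurable_rV (R : realType) n (A : set 'rV[R]_n) : closed A -> measurable A.
Proof.
by move=> cA; rewrite -[A]setCK; apply: measurableC; apply: open_measurable_rV; exact: closed_openC.
Qed.

Lemma continuous_linear_form (R : realType) s (a : 'rV[R]_s) :
  continuous (fun x : 'rV[R]_s => (x *m a^T) 0 0).
Proof.
move=> x; under eq_fun do rewrite mxE.
apply: (cvg_sumr (nbhs_filter x)) => i.
by apply: cvgM; [exact: coord_continuous|exact: cvg_cst].
Qed.

Lemma continuous_sqnorm (R : realType) s : continuous (@sqnorm R s).
Proof.
move=> x; apply: (cvg_sumr (nbhs_filter x)) => i; rewrite expr2; under eq_fun do rewrite expr2.
by apply: cvgM; exact: coord_continuous.
Qed.

Lemma ae_exists d (T : measurableType d) (R : realType) (P : probability T R) (Q : T -> Prop) :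
  {ae P, forall w, Q w} -> exists w, Q w.
Proof.
move=> [N [mN N0 QN]]; apply: contrapT => no.
have : P setT = 0%E by apply: subset_measure0 N0 => // w _; apply: QN => Qw; apply: no; exists w.
by move=> /eqP; rewrite probability_setT onee_eq0.
Qed.

Lemma fisher_information_sym (R : realType) (d s : nat) (H : finType) (Xi : set 'rV[R]_d)
    (f : 'rV[R]_d -> H -> 'rV[R]_s -> R) (nu : H -> R) (th : 'rV[R]_s) :
  (fisher_information Xi f nu th)^T = fisher_information Xi f nu th.
Proof.
rewrite /fisher_information linear_sum/=; apply: eq_bigr => h _; rewrite linearZ/=; congr (_ *: _).
apply/matrixP => i j; rewrite !mxE; apply: eq_Rintegral => x _; congr (_ * _).
by rewrite mulrC.
Qed.

Theorem theorem4p1 (R : realType) (n m d s : nat) (H : finType)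
    (* data and model *)
    (Xi : set 'rV[R]_d) (Theta : set 'rV[R]_s)
    (varpi : H -> H -> R) (nu : H -> R)
    (q : 'rV[R]_d -> H -> R) (f : 'rV[R]_d -> H -> 'rV[R]_s -> R)
    (p : 'rV[R]_s -> R) (thstar : 'rV[R]_s)
    (* control problem *)
    (gamma : R) (X : set 'rV[R]_n) (U : set 'rV[R]_m)
    (c : 'rV[R]_n -> 'rV[R]_m -> 'rV[R]_d -> R)
    (F : 'rV[R]_n -> 'rV[R]_m -> 'rV[R]_d -> 'rV[R]_n)
    (x1 : 'rV[R]_n) (h1 : H)
    (* a process with law P^* *)
    (disp : measure_display) (Om : measurableType disp) (P : probability Om R)
    (xi : nat -> Om -> 'rV[R]_d) (eta : nat -> Om -> H)
    (* a process with law P_theta^* *)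
    (disp' : measure_display) (Om' : measurableType disp')
    (P' : probability Om' R)
    (xi' : nat -> Om' -> 'rV[R]_d) (eta' : nat -> Om' -> H)
    (* maximum likelihood estimators, value functions, optimal policy *)
    (that : nat -> Om -> 'rV[R]_s)
    (Vstar : 'rV[R]_n -> H -> R) (VN : nat -> Om -> 'rV[R]_n -> H -> R)
    (Vth : 'rV[R]_s -> 'rV[R]_n -> H -> R)
    (pistar : 'rV[R]_n -> H -> 'rV[R]_m) :
  let smp w i := xi i w in
  let smh w i := eta i w in
  let I := fisher_information Xi f nu thstar in
  let Hstar w := H_functional gamma c F pistar x1 f thstar
                   (fun i => xi' i w) (fun i => eta' i w) in
  let EH := row_expectation P' Hstar in
  (* standing assumptions: data and model *)
  closed Xi ->
  stochastic_kernel varpi ->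
  stationary_distribution varpi nu ->
  (forall h, is_density Xi (q ^~ h)) ->
  (forall h th, Theta th -> is_density Xi (fun x => f x h th)) ->
  is_density Theta p ->
  is_data_process Xi varpi h1 q P xi eta ->
  is_data_process Xi varpi h1 (fun x h => f x h thstar) P' xi' eta' ->
  (forall N, (0 < N)%N -> measurable_fun setT (that N)) ->
  (forall N w, (0 < N)%N -> is_mle Theta f (smp w) (smh w) N (that N w)) ->
  (* standing assumptions: control problem *)
  0 < gamma < 1 ->
  U !=set0 ->
  measurable_fun setT
    (fun z : 'rV[R]_n * 'rV[R]_m * 'rV[R]_d => c z.1.1 z.1.2 z.2) ->
  (exists M, forall x u y, X x -> U u -> Xi y -> `|c x u y| <= M) ->
  measurable_fun setT
    (fun z : 'rV[R]_n * 'rV[R]_m * 'rV[R]_d => F z.1.1 z.1.2 z.2) ->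
  (forall x u y, X x -> U u -> Xi y -> X (F x u y)) ->
  unique_bounded_solution X
    (optimal_bellman gamma varpi U c F (density_expectation Xi q)) Vstar ->
  (forall N w, (0 < N)%N ->
    unique_bounded_solution X
      (optimal_bellman gamma varpi U c F
        (predictive_expectation Xi Theta varpi f p (smp w) (smh w) N))
      (VN N w)) ->
  is_policy X U pistar ->
  (forall th, Theta th ->
    unique_bounded_solution X
      (policy_bellman gamma varpi c F
        (density_expectation Xi (fun x h => f x h th)) pistar)
      (Vth th)) ->
  (* (i) *)
  convex_set (Theta : set (convex_lmodType 'rV[R]_s)) ->
  compact Theta ->
  Theta° !=set0 ->
  (* (ii) *)
  (exists c1 c2 : R, [/\ c2 <= c1, 0 < c2 &
    forall th, Theta th -> c2 <= p th <= c1]) ->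
  (* (iii) *)
  (forall x h th, Xi x -> Theta th -> 0 < f x h th) ->
  (* (iv) *)
  (forall x h, Xi x -> {within Theta, continuous (f x h)}) ->
  (* (v) *)
  irreducible_chain varpi ->
  aperiodic_chain varpi ->
  (* (vi) *)
  (exists2 g : 'rV[R]_d -> H -> R, stationary_integrable Xi nu q g &
    forall x h th, Xi x -> Theta th -> `|ln (f x h th)| <= g x h) ->
  (* (vii) *)
  Theta° thstar ->
  (forall x h, Xi x -> q x h = f x h thstar) ->
  (forall th, Theta th ->
    (forall x h, Xi x -> f x h thstar = f x h th) -> th = thstar) ->
  (* (viii) *)
  (exists2 eps : R, 0 < eps &
    [/\ euclid_ball thstar eps `<=` Theta,
        forall x h, Xi x ->
          continuously_differentiable_on (euclid_ball thstar eps) (f x h) &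
        forall h, exists2 g : 'rV[R]_d -> R,
          (lebesgue_rV R d).-integrable Xi (fun x => (g x)%:E) &
          forall x th, Xi x -> euclid_closed_ball thstar (eps / 2) th ->
            euclid_norm (score f x h th) ^+ 2 * f x h th <= g x]) ->
  (* (ix) *)
  (forall x h, X x ->
    let Q := action_value gamma varpi c F (density_expectation Xi q) Vstar x h in
    [/\ U (pistar x h), Q (pistar x h) = inf [set Q u | u in U] &
        forall u, U u -> Q u = inf [set Q u' | u' in U] -> u = pistar x h]) ->
  (* (x) *)
  I \in unitmx ->
  cvg_in_distribution P (fun N w => Num.sqrt N%:R *: (that N w - thstar))
    (mvnormal_expectation (invmx I)) ->
  {ae P, forall w,
    (fun N => \int[lebesgue_rV R s]_tau
       ((1 + euclid_norm tau ^+ 2) *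
        `|local_posterior Theta varpi f p (smp w) (smh w) N (that N w) tau
          - normal_density (invmx I) tau|)%:E)%E @ \oo --> 0%E} ->
  (* initial values and the additional hypothesis *)
  X x1 ->
  (forall N, (0 < N)%N -> measurable_fun setT (fun w => VN N w x1 h1)) ->
  cvg_in_probability0 P (fun N w => Num.sqrt N%:R *
    (VN N w x1 h1
     - posterior_expectation Theta varpi f p (smp w) (smh w) N
         (fun th => Vth th x1 h1))) ->
  cvg_in_distribution P
    (fun N w => Num.sqrt N%:R * (VN N w x1 h1 - Vstar x1 h1))
    (normal_expectation 0 ((EH *m invmx I *m EH^T) 0 0)).
Proof.
move=> smp smh I Hstar EH cXi kern stat dq df [mp p_0 _] proc proc' mthat mle gamma01 Une mc
  [M cM] mF FX [bVs eqVs _] _ policy solth _ cT _ _ fpos fcont _ _ _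
  thint qf _ [eps eps0 [ballT cdf envf]] opt Iu cY aeY Xx1 mVN cA.
have mXi := closed_measurable_rV cXi.
have clT : closed Theta by apply: compact_closed cT; exact: norm_hausdorff.
have mT := closed_measurable_rV clT.
have piU x h : X x -> U (pistar x h) by exact: policy.1.
have Tths : Theta thstar by exact: interior_subset.
have scont y h : Xi y -> seq_continuous_on Theta (f y h).
  by move=> Xy; exact/within_seq_continuous/fcont.
have vb0 : 0 <= value_bound gamma M.
  have [w _] := probability_inhabited P.
  apply: (value_bound_ge0 gamma01 cM piU h1 Xx1); exists (xi 0%N w).
  exact: (process_xi_support proc).
have sol th : Theta th -> solves gamma varpi X c F Xi pistar (fun x h => f x h th) (Vth th).
  by move=> /solth[].
have densf h th (Tth : Theta th) := df h th Tth.
have VthB th : Theta th -> bounded_by X (value_bound gamma M) (Vth th).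
  move=> Tth; apply: (solution_le mXi gamma01 kern mc cM mF FX piU _ (sol th Tth)) => h.
  exact: densf.
(* by optimality and correct specification, Vstar solves the Bellman equation of pistar *)
have VstarE : Vstar x1 h1 = Vth thstar x1 h1.
  have [_ _ uniq] := solth _ Tths; apply: uniq => // x h Xx.
  rewrite eqVs// /optimal_bellman /policy_bellman; have [_ <- _] := opt x h Xx.
  by apply: eq_Rintegral => y /set_mem Xy; rewrite qf.
have exenv h : exists g : 'rV[R]_d -> R,
    (lebesgue_rV R d).-integrable Xi (fun x => (g x)%:E) /\
    forall x th, Xi x -> euclid_closed_ball thstar (eps / 2) th ->
            euclid_norm (score f x h th) ^+ 2 * f x h th <= g x.
  by have [g ig Hg] := envf h; exists g.
have [env Henv] := choice exenv.
(* a closed ball inside the open one on which the densities are differentiable *)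
have rho0 : 0 < eps / 2 by rewrite divr_gt0.
have inball th : euclid_norm (th - thstar) <= eps / 2 -> euclid_ball thstar eps th.
  by move=> /le_lt_trans; apply; rewrite ltr_pdivrMr// ltr_pMr// ltr1n.
have inT th : euclid_norm (th - thstar) <= eps / 2 -> Theta th.
  by move=> /inball /ballT.
have hF h y : Xi y -> forall th, euclid_norm (th - thstar) <= eps / 2 ->
  [/\ differentiable (f y h) th, 0 < f y h th &
      euclid_norm (score f y h th) ^+ 2 * f y h th <= env h y].
  move=> Xy th thr; split; first by have [+ _] := cdf y h Xy; apply; exact: inball.
    by apply: fpos => //; exact: inT.
  by have [_] := Henv h; apply.
have densr h th (thr : euclid_norm (th - thstar) <= eps / 2) := densf h th (inT th thr).
have ienv h : (lebesgue_rV R d).-integrable Xi (fun y => (env h y)%:E) by have [] := Henv h.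
have solr th (thr : euclid_norm (th - thstar) <= eps / 2) := sol th (inT th thr).
have diffv := value_differentiable mXi gamma01 kern mc cM mF FX policy Xx1 rho0 hF densr ienv solr proc'.
have EHE := row_expectation_H_functional mXi gamma01 kern mc cM mF FX policy Xx1 rho0 hF densr ienv solr proc'.
rewrite -EHE -/Hstar -/EH in diffv.
pose v th := Vth th x1 h1.
have mv : measurable_fun Theta v.
  apply: seq_continuous_measurable => //.
  have h := value_seq_continuous mXi gamma01 kern mc cM mF FX piU vb0 densf scont sol.
  exact: h.
have gexp := global_expansion (v := v) (addr_ge0 vb0 vb0) _ diffv.
have {}gexp : forall e, 0 < e -> exists2 C, 0 <= C & forall x, Theta x ->
     `|v x - v thstar - ((x - thstar) *m EH^T) 0 0| <=
     e * euclid_norm (x - thstar) + C * euclid_norm (x - thstar) ^+ 2.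
  apply: gexp => th Tth; rewrite (le_trans (ler_normB _ _))// lerD//; exact: VthB.
pose Sg := invmx I.
pose Y N w : 'rV[R]_s := Num.sqrt N%:R *: (that N w - thstar).
have mY N : (0 < N)%N -> measurable_fun setT (Y N).
  move=> N0; apply/measurable_fun_rVP => i.
  under eq_fun do rewrite !mxE.
  apply: measurable_funM => //; apply: measurable_funB => //.
  by have /measurable_fun_rVP := mthat N N0; apply.
have mass1 := normal_mass1 cY.
pose rho N w := posterior_density Theta varpi f p xi eta N w.
have varpi0 h k : 0 <= varpi h k by exact: kern.1.
have mf h th (Tth : Theta th) : measurable_fun Xi (fun x => f x h th).
  by have [] := densf h th Tth.
have mrho := measurable_posterior_density proc mXi mT varpi0 fpos mf scont mp p_0.
have rho_0 := posterior_density_ge0 proc varpi0 fpos p_0.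
have rho01 := posterior_density_mass proc mXi mT varpi0 fpos mf scont mp p_0.
have rhoT := @posterior_density_support _ _ _ _ Theta varpi f p _ _ xi eta.
have mvrho N w := measurable_mul_posterior_density proc mXi mT varpi0 fpos mf scont mp p_0 N w mv.
have mEv N := measurable_posterior_expectation proc mXi mT varpi0 fpos mf scont mp p_0 N mv.
have aeR : {ae P, forall w, (fun N => \int[lebesgue_rV R s]_x ((1 + sqnorm x) *
     `|rescaled (rho N w) (that N w) (Num.sqrt N%:R)^-1 x - normal_density Sg x|)%:E)%E @ \oo --> 0%E}.
  apply: filterS aeY => w; apply: cvg_trans; apply: near_eq_cvg; apply: nearW => N.
  by apply: eq_integral => x _; rewrite euclid_norm_sqr.
have iphi : (lebesgue_rV R s).-integrable setT (EFin \o (fun x => (1 + sqnorm x) * normal_density Sg x)).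
  have [w cw] := ae_exists aeR.
  have [[N1 _ HN1] _] := (fine_cvgP _ _).1 cw.
  have r0 : 0 < (Num.sqrt N1.+1%:R)^-1 :> R by rewrite invr_gt0 sqrtr_gt0.
  apply: (rescaled_second_moment r0 cT mass1 (mrho N1.+1 w) (rho_0 N1.+1 w) _ (rho01 N1.+1 w)).
    by move=> x; exact: rhoT.
  by rewrite ltey_eq; apply/orP; left; apply: (HN1 N1.+1); exact: leqnSn.
(* Q is the remainder B of the posterior mean, normalised so as to tend to 0 almost surely *)
pose W N w : R := (Y N w *m EH^T) 0 0.
pose B N w : R := Num.sqrt N%:R * (posterior_expectation Theta varpi f p (smp w) (smh w) N v - v thstar) - W N w.
pose T N w : R := 1 + sqnorm (Y N w).
pose Q N w : R := `|B N w| / T N w.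
have T1 N w : 1 <= T N w by rewrite lerDl sqnorm_ge0.
have T0 N w : 0 < T N w by exact: lt_le_trans (T1 N w).
have mW N : (0 < N)%N -> measurable_fun setT (W N).
  by move=> N0; exact: measurableT_comp (measurable_rV_linear _) (mY N N0).
have mT' N : (0 < N)%N -> measurable_fun setT (T N).
  move=> N0; apply: measurable_funD => //; exact: measurableT_comp (@measurable_sqnorm _ _) (mY N N0).
have mB N : (0 < N)%N -> measurable_fun setT (B N).
  move=> N0; apply: measurable_funB; last exact: mW.
  by apply: measurable_funM => //; apply: measurable_funB => //; exact: mEv.
have mQ N : (0 < N)%N -> measurable_fun setT (Q N).
  move=> N0; apply: measurable_funM; first by apply: measurableT_comp => //; exact: mB.
  by apply: measurable_fun_inv_ge0; [move=> w _; exact: ltW|exact: mT'].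
have aeQ : {ae P, forall w, Q ^~ w @ \oo --> 0}.
  apply: filterS aeR => w cw; apply/cvgr0Pnorm_le => e e0.
  have := posterior_mean_expansion mass1 (fun N => mrho N w) (fun N => rho_0 N w) (fun N => rho01 N w)
    (fun N => rhoT N w) (fun N => mvrho N w) gexp iphi cw e0.
  apply: filterS => N /= hN.
  rewrite /Q normrM normr_id normfV (gtr0_norm (T0 N w)) ler_pdivrMr//.
  rewrite /B posterior_expectationE; exact: hN.
have cT' : tight P T.
  apply: (tight_continuous_image mY cY (Phi := fun x => 1 + sqnorm x)) => //.
  move=> x; apply: (@continuous_comp _ _ _ (@sqnorm R s) (fun r : R => 1 + r) x).
    exact: continuous_sqnorm.
  by apply: cvgD; [exact: cvg_cst|exact: cvg_id].
have cB : cvg_in_probability0 P B.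
  apply: (tight_mul_cvg_in_probability mQ mT' mB _ (ae_cvg_in_probability mQ aeQ) cT').
  move=> N w; rewrite /Q normrM normr_id normfV (gtr0_norm (T0 N w)) divfK// gt_eqF//.
have cW : tight P W.
  apply: (tight_continuous_image mY cY (Phi := fun x => (x *m EH^T) 0 0)) => //.
    exact: continuous_linear_form.
  have := integrableZl_EFin (\sum_i `|EH 0 i|) measurableT iphi.
  apply: (le_integrable_EFin measurableT).
    by apply: measurable_linear_mul; exact: measurable_normal_density.
  move=> x _; rewrite normrM [`|normal_density _ _|]ger0_norm ?normal_density_ge0// [leRHS]mulrA.
  by apply: ler_wpM2r; [exact: normal_density_ge0|exact: norm_linear_le].
(* the error differs from the linear form W of Y by A + B, both negligible *)
move=> g cg [K gK].
pose A N w := Num.sqrt N%:R * (VN N w x1 h1 - posterior_expectation Theta varpi f p (smp w) (smh w) N v).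
pose Xn N w := Num.sqrt N%:R * (VN N w x1 h1 - Vstar x1 h1).
have mA N : (0 < N)%N -> measurable_fun setT (A N).
  move=> N0; apply: measurable_funM => //; apply: measurable_funB; [exact: mVN|exact: mEv].
have mX N : (0 < N)%N -> measurable_fun setT (Xn N).
  by move=> N0; apply: measurable_funM => //; apply: measurable_funB => //; exact: mVN.
have cXW : cvg_in_probability0 P (fun N w => Xn N w - W N w).
  rewrite (_ : (fun N w => _) = fun N w => A N w + B N w).
    exact: cvg_in_probability0D.
  by apply/funext => N; apply/funext => w; rewrite /Xn /A /B VstarE /v; ring.
have slk := slutsky mW mX cW cXW cg gK.
have symS : Sg^T = Sg by rewrite /Sg trmx_inv fisher_information_sym.
rewrite -(normal_expectation_projection EH symS _ mass1); last 2 first.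
- by rewrite unitmx_inv.
- exact: continuous_measurable_fun.
have cgW : (fun N => \int[P]_w g (W N w)) @ \oo --> mvnormal_expectation Sg (fun x => g ((x *m EH^T) 0 0)).
  apply: (cY (fun x => g ((x *m EH^T) 0 0))); last by exists K.
  move=> x; apply: (@continuous_comp _ _ _ (fun x : 'rV[R]_s => (x *m EH^T) 0 0) g).
    exact: continuous_linear_form.
  exact: cg.
rewrite -[X in _ --> X]add0r.
rewrite (_ : (fun N => _) = fun N => (\int[P]_w g (Xn N w) - \int[P]_w g (W N w))
    + \int[P]_w g (W N w)); first exact: (cvgD slk cgW).
by apply/funext => N; rewrite subrK.
Qed.
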